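(* Let $X$ be a normed linear space, $Y$ a Banach space, and $k\in\mathbb N\cup\{\infty\}$ such that the pair $(X,Y)$ has property (LA$_k$). Suppose that $A\subset X$ is one of the following types: (a) $A$ is an image of a closed convex bounded set with a non-empty interior under a bi-Lipschitz automorphism of $X$; (b) $A$ is a Lipschitz submanifold of $X$; (c) $A$ is the closure of a Lipschitz domain in $X$. Suppose that $f\colon A\to Y$ satisfies condition (W) with $G\colon A\to\mathcal L(X;Y)$. Then $f$ can be extended to a mapping $g\in C^1(X;Y)$ such that $Dg=G$ on $A$ and $g$ is $C^k$-smooth on $X\setminus A$. Moreover, if (a) holds, $f$ is Lipschitz, and the mapping $G$ is bounded, then one can additionally assert that $g$ is Lipschitz.
   Context: All normed linear spaces are real. $U(x,r)$ is the open ball with centre $x$ and radius $r$, $U_X$ is the open unit ball of $X$. An $L$-Lipschitz mapping is a mapping with a (not necessarily minimal) Lipschitz constant $L$. $\mathcal L(X;Y)$ is the normed space of continuous linear operators from $X$ to $Y$. $Dg$ is the Fréchet derivative. For open $\Omega\subset X$, $C^k(\Omega;Y)$ is the space of $C^k$-smooth (in the Fréchet sense) mappings from $\Omega$ to $Y$. A bi-Lipschitz automorphism of $X$ is a (not necessarily linear) bi-Lipschitz bijection of $X$ onto $X$. $E_1\oplus_\infty E_2$ is the direct sum with the maximum norm. Lipschitz submanifold: a non-empty subset $A$ of a normed linear space $X$ is a Lipschitz submanifold of $X$ if for each $x\in A$ there exist an open neighbourhood $U$ of $x$, two non-trivial normed linear spaces $E_1$, $E_2$, and a bi-Lipschitz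 mapping $\Phi$ of $U$ onto $U_{E_1}\times U_{E_2}\subset E_1\oplus_\infty E_2$ such that $\Phi(A\cap U)=U_{E_1}\times\{0\}$. Lipschitz domain: an open non-empty subset $G$ of a normed linear space $X$ is a Lipschitz domain in $X$ if for each $a\in\partial G$ there exist an open neighbourhood $V$ of $a$, a normed linear space $E$, and a bi-Lipschitz mapping $\Phi$ of $V$ onto $U_E\times(-1,1)\subset E\oplus_\infty\mathbb R$ such that $\Phi(G\cap V)=U_E\times(0,1)$ and $\Phi(\partial G\cap V)=U_E\times\{0\}$. Condition (W): a mapping $f\colon A\to Y$, $A\subset X$, satisfies condition (W) with $G$ if $G\colon A\to\mathcal L(X;Y)$ is continuous and for each $x\in A$ the operator $G(x)$ is a strict derivative of $f$ at $x$ with respect to $A$, i.e. for each $\varepsilon>0$ there is $\delta>0$ such that $\|f(z)-f(y)-G(x)[z-y]\|\le\varepsilon\|z-y\|$ whenever $y,z\in U(x,\delta)\cap A$. Property (LA$_k$), $k\in\mathbb N\cup\{\infty\}$: the pair $(X,Y)$ of normed linear spaces has property (LA$_k$) if there is $C\ge0$ such that for any $L$-Lipschitz mapping $f\colon U_X\to Y$ and any $\varepsilon>0$ there is a $CL$-Lipschitz mapping $g\in C^k(U_X;Y)$ such that $\sup_{U_X}\|f-g\|\le\varepsilon$.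
   Formalization: In (b) the Lipschitz submanifold A is additionally assumed closed; otherwise X∖A is not open and the claim fails, e.g. A=(0,1)×{0} in R², f(x,0)=1/x. *)

(* Defs.v *)
(* MathComp-Analysis; the real normed linear spaces are the [normedModType R]
   with [R : realType], the Banach spaces the [completeNormedModType R].
   A mapping defined on a subset A of X is represented by a total function on X
   of which only the values on A are used. *)
From HB Require Import structures.
From mathcomp Require Import all_boot all_order all_algebra.
From mathcomp Require Import all_classical all_reals all_analysis.

Set Implicit Arguments.
Unset Strict Implicit.
Unset Printing Implicit Defensive.
Import Order.TTheory GRing.Theory Num.Theory.
Import numFieldNormedType.Exports.
Local Open Scope classical_set_scope.
Local Open Scope ring_scope.

Section ContinuousLinearOperators.
Context {R : realType} (X Y : normedModType R).

Definition contlin_pred : {pred X -> Y} :=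
  [pred T : X -> Y | `[< linear T /\ continuous T >]].

Lemma contlin_predP (T : X -> Y) :
  reflect (linear T /\ continuous T) (T \in contlin_pred).
Proof. exact: asboolP. Qed.

Record contlin := Contlin {
  contlin_fun :> X -> Y;
  contlinP : contlin_fun \in contlin_pred }.

HB.instance Definition _ := [isSub for contlin_fun].
HB.instance Definition _ := [Choice of contlin by <:].

Lemma contlin_submod_closed : submod_closed contlin_pred.
Proof.
split.
  apply/contlin_predP; split; last by move=> x; exact: cvg_cst.
  by move=> a u v; rewrite -[LHS]/(0 : Y) -[RHS]/(a *: (0 : Y) + 0) scaler0 addr0.
move=> a f g /contlin_predP[lf cf] /contlin_predP[lg cg].
apply/contlin_predP; split.
  move=> b u v; rewrite -[LHS]/(a *: f (b *: u + v) + g (b *: u + v)).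
  rewrite -[RHS]/(b *: (a *: f u + g u) + (a *: f v + g v)).
  by rewrite lf lg !scalerDr !scalerA (mulrC a b) addrACA.
by move=> x; apply: cvgD; [apply: cvgZr; exact: cf|exact: cg].
Qed.

HB.instance Definition _ :=
  GRing.isSubmodClosed.Build _ _ contlin_pred contlin_submod_closed.
HB.instance Definition _ := [SubChoice_isSubLmodule of contlin by <:].

Lemma contlin_linear (T : contlin) : linear T.
Proof. by have /contlin_predP[] := contlinP T. Qed.

Lemma contlin_continuous (T : contlin) : continuous T.
Proof. by have /contlin_predP[] := contlinP T. Qed.

HB.instance Definition _ (T : contlin) :=
  GRing.isLinear.Build R X Y *:%R T (@contlin_linear T).

Definition opnorm (T : contlin) : R := sup [set `|T x| | x in [set x | `|x| <= 1]].

Lemma opnorm_nonempty (T : contlin) :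
  [set `|T x| | x in [set x | `|x| <= 1]] !=set0.
Proof. by exists `|T 0|, 0 => //=; rewrite normr0. Qed.

Lemma opnorm_has_ubound (T : contlin) :
  has_ubound [set `|T x| | x in [set x | `|x| <= 1]].
Proof.
have /linear_boundedP[M [Mr TM]] : bounded_near T (nbhs (0 : X)).
  exact/linear_bounded_continuous/contlin_continuous.
exists (`|M| + 1) => _ [x /= x1 <-].
have := TM (`|M| + 1); rewrite (le_lt_trans (ler_norm _)) ?ltrDl//.
move=> /(_ isT x) /le_trans; apply.
by rewrite ler_piMr // addr_ge0.
Qed.

Lemma le_opnorm (T : contlin) (x : X) : `|T x| <= opnorm T * `|x|.
Proof.
have [->|x0] := eqVneq x 0; first by rewrite linear0 !normr0 mulr0.
have nx : 0 < `|x| by rewrite normr_gt0.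
rewrite -ler_pdivrMr//.
have -> : `|T x| / `|x| = `|T (`|x|^-1 *: x)|.
  by rewrite linearZ normrZ ger0_norm ?invr_ge0// mulrC.
apply: (ub_le_sup (opnorm_has_ubound T)); exists (`|x|^-1 *: x) => //=.
by rewrite normrZ ger0_norm ?invr_ge0// mulVf ?gt_eqF.
Qed.

Lemma opnorm_le (T : contlin) (M : R) :
  (forall x, `|x| <= 1 -> `|T x| <= M) -> opnorm T <= M.
Proof.
move=> TM; apply: (ge_sup (opnorm_nonempty T)) => _ [x /= x1 <-].
exact: TM.
Qed.

Lemma opnorm_ge0 (T : contlin) : 0 <= opnorm T.
Proof.
apply: (le_trans (normr_ge0 (T 0))); apply: (ub_le_sup (opnorm_has_ubound T)).
by exists 0 => //=; rewrite normr0.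
Qed.

Lemma opnormD (S T : contlin) : opnorm (S + T) <= opnorm S + opnorm T.
Proof.
apply: opnorm_le => x x1.
rewrite (le_trans (ler_normD _ _))// lerD// (le_trans (le_opnorm _ _))//;
  by rewrite ler_piMr// opnorm_ge0.
Qed.

Lemma opnormZ_le (a : R) (T : contlin) : opnorm (a *: T) <= `|a| * opnorm T.
Proof.
apply: opnorm_le => x x1; rewrite normrZ ler_wpM2l//.
by rewrite (le_trans (le_opnorm _ _))// ler_piMr// opnorm_ge0.
Qed.

Lemma opnormZ (a : R) (T : contlin) : opnorm (a *: T) = `|a| * opnorm T.
Proof.
apply/eqP; rewrite eq_le opnormZ_le/=.
have [->|a0] := eqVneq a 0; first by rewrite normr0 mul0r opnorm_ge0.
have := opnormZ_le a^-1 (a *: T); rewrite scalerA mulVf// scale1r.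
by rewrite normfV mulrC ler_pdivlMr ?normr_gt0// mulrC.
Qed.

Lemma opnorm_eq0 (T : contlin) : opnorm T = 0 -> T = 0.
Proof.
move=> T0; apply/val_inj/funext => x /=; apply/normr0_eq0/eqP.
by rewrite eq_le normr_ge0 andbT (le_trans (le_opnorm T x))// T0 mul0r.
Qed.

HB.instance Definition _ :=
  Lmodule_isNormed.Build R contlin opnormD opnormZ opnorm_eq0.

End ContinuousLinearOperators.

Section Smoothness.
Context {R : realType} (X : normedModType R).

(* Omega is meant to be open. *)
Fixpoint Cn_on (n : nat) (Y : normedModType R) (Omega : set X) (f : X -> Y) :
    Prop :=
  if n is n'.+1 then
    exists2 Df : X -> contlin X Y,
      forall x, Omega x -> is_diff x f (Df x) &
      @Cn_on n' (contlin X Y) Omega Df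
  else forall x, Omega x -> {for x, continuous f}.

(* [Some n] stands for the finite order n, [None] for the order infinity. *)
Definition Ck_on (k : option nat) (Y : normedModType R) (Omega : set X)
    (f : X -> Y) : Prop :=
  if k is Some n then Cn_on n Omega f else forall n, Cn_on n Omega f.

Definition property_LA (Y : normedModType R) (k : option nat) : Prop :=
  exists2 C : R, 0 <= C &
    forall (L : R) (f : X -> Y) (eps : R), 0 <= L -> 0 < eps ->
      L.-lipschitz_(ball 0 1) f ->
      exists g : X -> Y,
        [/\ (C * L).-lipschitz_(ball 0 1) g,
            Ck_on k (ball 0 1) g &
            forall x, ball 0 1 x -> `|f x - g x| <= eps].

Definition condition_W (Y : normedModType R) (A : set X) (f : X -> Y)
    (G : X -> contlin X Y) : Prop :=
  {within A, continuous G} /\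
  forall x, A x -> forall eps : R, 0 < eps ->
    exists2 delta : R, 0 < delta &
      forall y z, (ball x delta `&` A) y -> (ball x delta `&` A) z ->
        `|f z - f y - G x (z - y)| <= eps * `|z - y|.

End Smoothness.

Section BiLipschitz.
Context {R : realType}.

Definition bilipschitz_onto (X Y : normedModType R) (Phi : X -> Y) (U : set X)
    (V : set Y) : Prop :=
  Phi @` U = V /\
  exists2 K : R, 0 < K &
    forall x y, U x -> U y ->
      K^-1 * `|x - y| <= `|Phi x - Phi y| <= K * `|x - y|.

(* The norm of a product of normed modules is the maximum norm. *)
Definition lipschitz_submanifold (X : normedModType R) (A : set X) : Prop :=
  A !=set0 /\
  forall x, A x ->
    exists (U : set X) (E1 E2 : normedModType R) (Phi : X -> (E1 * E2)%type),
      [/\ open_nbhs x U,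
          (exists e : E1, e != 0),
          (exists e : E2, e != 0),
          bilipschitz_onto Phi U (ball 0 1 `*` ball 0 1) &
          Phi @` (A `&` U) = ball 0 1 `*` [set 0]].

Definition boundary (T : topologicalType) (A : set T) : set T :=
  closure A `\` A°.

Definition lipschitz_domain (X : normedModType R) (D : set X) : Prop :=
  [/\ open D, D !=set0 &
  forall a, boundary D a ->
    exists (V : set X) (E : normedModType R) (Phi : X -> (E * R^o)%type),
      [/\ open_nbhs a V,
          bilipschitz_onto Phi V (ball 0 1 `*` `]-1, 1[),
          Phi @` (D `&` V) = ball 0 1 `*` `]0, 1[ &
          Phi @` (boundary D `&` V) = ball 0 1 `*` [set 0]]].

Definition bilipschitz_convex_body (X : normedModType R) (A : set X) : Prop :=
  exists (B : set X) (Psi : X -> X),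
    [/\ closed B, convex_set B, bounded_set B, B° !=set0 &
        bilipschitz_onto Psi setT setT /\ A = Psi @` B].

End BiLipschitz.

(* Main.v *)
(* Idea. In each of the three cases every point of A has a neighbourhood U with
   a Lipschitz retraction r of U into A (radial projection by the gauge of a
   convex body, projection in a chart otherwise), and C^k partitions of unity
   reduce the theorem to extending f over such a U. With a strict derivative G
   on A, the map
     F(z) = f(r(z)) + H(z)[z - r(z)]
   differs near each x in A from the operator G(x) by a map with small Lipschitz
   constant, as soon as H is close to G o r and the local Lipschitz constant of H
   at z times dist(z, A) tends to 0 at A. Such an H is obtained by passing,
   slowly enough as z approaches A, along a sequence of locally Lipschitz
   approximations of G o r. Off A, property (LA_k) applied to F minus the
   operators H(z) gives a C^k map g with g - F and Dg - H as small as desired,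
   and extending g by f on A yields a C^1 map with derivative G there. Starting
   the sequence at 0 keeps dist(z, A) times the local Lipschitz constant of H
   bounded, which makes g Lipschitz when the retraction is global and f is
   Lipschitz with G bounded.
   The C^k partitions of unity come from (LA_k) as well: composing with a norming
   functional of Y gives C^k approximations of real Lipschitz functions, which
   are applied to the distances to the sets of a sigma-discrete refinement. *)
Require Import Defs.
From mathcomp Require Import all_boot all_order all_algebra.
From mathcomp Require Import all_classical all_reals all_analysis.
From mathcomp Require Import wochoice ring lra.
Import Order.TTheory GRing.Theory Num.Theory.
Import numFieldNormedType.Exports.
Set Implicit Arguments.
Unset Strict Implicit.
Unset Printing Implicit Defensive.
Local Open Scope classical_set_scope.
Local Open Scope ring_scope.

(** * Derivatives and bounded bilinear maps *)

(** The constant C of (LA_k) shapes the argument. Smoothing [F] directly would only bound the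
    derivative by C times a Lipschitz constant, which does not make it close to [H]; once an
    operator is subtracted, the remainder has a small Lipschitz constant w near A, and C w is small
    too. In the term [H(z)[z - r(z)]] the variation of [H] is multiplied by |z - r(z)|, whence the
    condition on [H]. The distance to A is always measured by e(z) = |z - r(z)|, which is Lipschitz
    and on U vanishes exactly on A. Since [r] is only Lipschitz, [F] need not be differentiable:
    derivatives of the approximation are bounded through local Lipschitz constants, and the
    approximation errors are chosen small against the Lipschitz constants of the partition
    functions. Chain rules occur only for affine inner maps and for a scalar cutoff, so a Leibniz
    rule for bounded bilinear maps carries the C^k calculus. Global Lipschitz bounds do not survive
    a partition of unity, which is why the last claim uses a retraction of the whole space. *)

Section Pointwise.
Context {R : realType}.
Implicit Types X Y Z : normedModType R.

Lemma near_normP X (P : X -> Prop) (x : X) :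
  (\forall y \near x, P y) <->
  exists2 d : R, 0 < d & forall y, `|y - x| < d -> P y.
Proof.
split=> [/nbhs_ballP[d d0 dP]|[d d0 dP]].
  by exists d => // y yx; apply: dP; rewrite -ball_normE /= distrC.
apply/nbhs_ballP; exists d => // y; rewrite -ball_normE /= distrC; exact: dP.
Qed.

Lemma openP_norm X (U : set X) :
  open U <-> forall x, U x -> exists2 d : R, 0 < d & forall y, `|y - x| < d -> U y.
Proof.
rewrite openE; split=> [UU x /UU /near_normP//|UU x Ux].
by apply/near_normP; exact: UU.
Qed.

Lemma continuous_normP X Y (f : X -> Y) (x : X) :
  {for x, continuous f} <->
  forall e : R, 0 < e -> exists2 d : R, 0 < d &
    forall y, `|y - x| < d -> `|f y - f x| <= e.
Proof.
split=> [/cvgrPdist_le fx e e0|fx].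
  have /near_normP[d d0 dP] := fx _ e0.
  by exists d => // y yx; rewrite distrC; exact: dP.
apply/cvgrPdist_le => e e0; apply/near_normP.
have [d d0 dP] := fx _ e0.
by exists d => // y yx; rewrite distrC; exact: dP.
Qed.

(** ['d f x] is a chosen operator, so the direction from the estimate goes through uniqueness of the
    differential, which uses the continuity built into [contlin]. *)
Lemma is_diff_normP X Y (f : X -> Y) (x : X) (T : contlin X Y) :
  is_diff x f T <->
  forall e : R, 0 < e -> exists2 d : R, 0 < d &
    forall y, `|y - x| < d -> `|f y - f x - T (y - x)| <= e * `|y - x|.
Proof.
split=> [[fx dfx] e e0|fT].
  have /eqaddoP := diff_locally fx; rewrite dfx => /(_ e e0) /near_normP[d d0 dP].
  exists d => // y yx; have := dP (y - x); rewrite subr0 => /(_ yx) fy.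
  have {fy} : `|f (y - x + x) - (f x + T (y - x))| <= e * `|y - x| by exact: fy.
  by rewrite subrK opprD addrA.
have Tf : f \o shift x = cst (f x) + T +o_ 0 id.
  apply/eqaddoP => e e0; apply/near_normP.
  have [d d0 dP] := fT _ e0; exists d => // h; rewrite subr0 => hd.
  have := dP (h + x); rewrite addrK => /(_ hd) fh.
  suff : `|f (h + x) - (f x + T h)| <= e * `|h| by [].
  by rewrite opprD addrA.
have dT : 'd f x = T :> (X -> Y).
  exact: (@diff_unique _ _ _ f T x (@contlin_continuous _ _ _ T) Tf).
split=> //; apply/diff_locallyP; rewrite dT; split=> //.
exact: contlin_continuous.
Qed.

Lemma is_diff_unique X Y (f : X -> Y) (x : X) (S T : contlin X Y) :
  is_diff x f S -> is_diff x f T -> S = T.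
Proof.
by move=> [_ fS] [_ fT]; apply/val_inj; rewrite /= -[LHS]fS fT.
Qed.

Lemma is_diff_continuous X Y (f : X -> Y) (x : X) (T : contlin X Y) :
  is_diff x f T -> {for x, continuous f}.
Proof. by move=> fT; apply: differentiable_continuous. Qed.

Lemma is_diff_near_eq X Y (f g : X -> Y) (x : X) (T : contlin X Y) :
  (\forall y \near x, f y = g y) -> is_diff x f T -> is_diff x g T.
Proof.
move=> /near_normP[d d0 fg] /is_diff_normP fT; apply/is_diff_normP => e e0.
have [d' d'0 d'P] := fT _ e0.
exists (Num.min d d'); first by rewrite lt_min d0.
move=> y; rewrite lt_min => /andP[yd yd'].
by rewrite -fg// -[g x]fg ?subrr ?normr0//; exact: d'P.
Qed.

Lemma contlin_bounded_pred X Y (T : X -> Y) (M : R) :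
  linear T -> (forall x, `|T x| <= M * `|x|) -> T \in @contlin_pred R X Y.
Proof.
move=> lT bT; apply/contlin_predP; split=> //.
move=> x; apply/continuous_normP => e e0.
have M0 : 0 < `|M| + 1 by rewrite ltr_wpDl.
exists (e / (`|M| + 1)); first by rewrite divr_gt0.
move=> y; rewrite ltr_pdivlMr// => yx.
have -> : T y - T x = T (y - x) by rewrite [y - x]addrC -(scaleN1r x) lT scaleN1r addrC.
rewrite (le_trans (bT _))// (le_trans _ (ltW yx))// mulrC ler_wpM2l//.
by rewrite (le_trans (ler_norm _))// lerDl.
Qed.

Definition mk_contlin X Y (T : X -> Y) (M : R) (lT : linear T)
  (bT : forall x, `|T x| <= M * `|x|) : contlin X Y :=
  Contlin (contlin_bounded_pred lT bT).

Lemma contlin_le X Y (T : contlin X Y) (x : X) : `|T x| <= `|T| * `|x|.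
Proof. exact: le_opnorm. Qed.

Lemma contlin_norm_le X Y (T : contlin X Y) (M : R) : 0 <= M ->
  (forall x, `|T x| <= M * `|x|) -> `|T| <= M.
Proof.
move=> M0 TM; apply: opnorm_le => x x1.
by rewrite (le_trans (TM _))// ler_piMr.
Qed.

Lemma contlinDE X Y (S T : contlin X Y) (x : X) : (S + T) x = S x + T x.
Proof. by []. Qed.
Lemma contlinNE X Y (T : contlin X Y) (x : X) : (- T) x = - T x.
Proof. by []. Qed.
Lemma contlinBE X Y (S T : contlin X Y) (x : X) : (S - T) x = S x - T x.
Proof. by []. Qed.
Lemma contlinZE X Y (a : R) (T : contlin X Y) (x : X) : (a *: T) x = a *: T x.
Proof. by []. Qed.
Lemma contlin0E X Y (x : X) : (0 : contlin X Y) x = 0.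
Proof. by []. Qed.

(** Difference quotients in a direction h are bounded by L |h| and converge to T h. Only increments
    from x itself enter, so a Lipschitz estimate centred at x is enough. *)
Lemma is_diff_bound X Y (f : X -> Y) (x : X) (T : contlin X Y) (L : R) :
  0 <= L -> (\forall y \near x, `|f y - f x| <= L * `|y - x|) ->
  is_diff x f T -> `|T| <= L.
Proof.
move=> L0 /near_normP[d d0 fL] /is_diff_normP fT.
apply: contlin_norm_le => // h; apply/ler_addgt0Pl => e e0.
have h1 : 0 < `|h| + 1 by rewrite ltr_wpDl.
have [d' d'0 d'P] := fT _ (divr_gt0 e0 h1).
pose t := Num.min d d' / (`|h| + 1).
have m0 : 0 < Num.min d d' by rewrite lt_min d0.
have t0 : 0 < t by rewrite divr_gt0.
have nth : `|t *: h| < Num.min d d'.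
  rewrite normrZ gtr0_norm// /t mulrAC ltr_pdivrMr// ltr_pM2l//.
  by rewrite ltrDl.
move: nth; rewrite lt_min => /andP[hd hd'].
have := fL (x + t *: h); rewrite addrAC subrr add0r => /(_ hd) A.
have := d'P (x + t *: h); rewrite addrAC subrr add0r => /(_ hd') B.
rewrite -(ler_pM2l t0) -{1}(gtr0_norm t0) -normrZ -linearZ/=.
have -> : T (t *: h) = (f (x + t *: h) - f x) - (f (x + t *: h) - f x - T (t *: h)).
  by rewrite opprB addrCA subrr addr0.
rewrite (le_trans (ler_normB _ _))// mulrDr addrC lerD//.
  rewrite (le_trans B)// normrZ gtr0_norm// mulrCA ler_wpM2l ?(ltW t0)//.
  by rewrite mulrAC ler_pdivrMr// ler_wpM2l ?(ltW e0)// lerDl.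
by rewrite (le_trans A)// normrZ gtr0_norm// mulrCA.
Qed.

Lemma is_diff_add X Y (f g : X -> Y) (x : X) (S T : contlin X Y) :
  is_diff x f S -> is_diff x g T -> is_diff x (fun z => f z + g z) (S + T).
Proof. by move=> fS gT; exact: is_diffD. Qed.

Lemma is_diff_const X Y (y : Y) (x : X) : is_diff x (fun=> y) (0 : contlin X Y).
Proof.
apply/is_diff_normP => e e0; exists 1 => // z _.
by rewrite subrr contlin0E subr0 normr0 mulr_ge0// ltW.
Qed.

Lemma is_diff_contlin X Y (T : contlin X Y) (x : X) : is_diff x T T.
Proof.
apply/is_diff_normP => e e0; exists 1 => // z _.
by rewrite linearB subrr normr0 mulr_ge0// ltW.
Qed.

End Pointwise.

(** * Bounded bilinear maps and the Leibniz rule *)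

Section BoundedBilinear.
Context {R : realType}.
Implicit Types X U V W : normedModType R.

(** Scalar multiplication and evaluation of operators are both instances, and the class is stable
    under the lifts below to operator-valued arguments, so the Leibniz rule can be iterated to any
    order. *)
Record bilin U V W := Bilin {
  bil :> U -> V -> W;
  bil_linl : forall v, linear (bil^~ v);
  bil_linr : forall u, linear (bil u);
  bilM : R;
  bilM_ge0 : 0 <= bilM;
  bil_bound : forall u v, `|bil u v| <= bilM * `|u| * `|v| }.

Lemma bilDl U V W (B : bilin U V W) u u' v : B (u + u') v = B u v + B u' v.
Proof. by have := bil_linl B v 1 u u'; rewrite !scale1r. Qed.
Lemma bilDr U V W (B : bilin U V W) u v v' : B u (v + v') = B u v + B u v'.
Proof. by have := bil_linr B u 1 v v'; rewrite !scale1r. Qed.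
Lemma bil0l U V W (B : bilin U V W) v : B 0 v = 0.
Proof. by apply: (addrI (B 0 v)); rewrite -bilDl !addr0. Qed.
Lemma bil0r U V W (B : bilin U V W) u : B u 0 = 0.
Proof. by apply: (addrI (B u 0)); rewrite -bilDr !addr0. Qed.
Lemma bilZl U V W (B : bilin U V W) a u v : B (a *: u) v = a *: B u v.
Proof. by have := bil_linl B v a u 0; rewrite !addr0 bil0l addr0. Qed.
Lemma bilZr U V W (B : bilin U V W) a u v : B u (a *: v) = a *: B u v.
Proof. by have := bil_linr B u a v 0; rewrite !addr0 bil0r addr0. Qed.
Lemma bilBl U V W (B : bilin U V W) u u' v : B (u - u') v = B u v - B u' v.
Proof. by rewrite bilDl -[- u']scaleN1r bilZl scaleN1r. Qed.
Lemma bilBr U V W (B : bilin U V W) u v v' : B u (v - v') = B u v - B u v'.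
Proof. by rewrite bilDr -[- v']scaleN1r bilZr scaleN1r. Qed.

Section Lift.
Context X U V W (B : bilin U V W).

Lemma bil_liftl_linear (T : contlin X U) (v : V) : linear (fun h => B (T h) v).
Proof. by move=> a h h'; rewrite linearP bilDl bilZl. Qed.
Lemma bil_liftl_bound (T : contlin X U) (v : V) (h : X) :
  `|B (T h) v| <= bilM B * `|T| * `|v| * `|h|.
Proof.
rewrite (le_trans (bil_bound _ _ _))//.
rewrite [leRHS](_ : _ = bilM B * (`|T| * `|h|) * `|v|); last by ring.
by rewrite ler_wpM2r// ler_wpM2l ?bilM_ge0// contlin_le.
Qed.
Definition bil_liftl_fun T v := mk_contlin (bil_liftl_linear T v) (bil_liftl_bound T v).

Lemma bil_liftr_linear (u : U) (T : contlin X V) : linear (fun h => B u (T h)).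
Proof. by move=> a h h'; rewrite linearP bilDr bilZr. Qed.
Lemma bil_liftr_bound (u : U) (T : contlin X V) (h : X) :
  `|B u (T h)| <= bilM B * `|u| * `|T| * `|h|.
Proof.
rewrite (le_trans (bil_bound _ _ _))// -[leRHS]mulrA.
by rewrite ler_wpM2l ?contlin_le// mulr_ge0 ?bilM_ge0.
Qed.
Definition bil_liftr_fun u T := mk_contlin (bil_liftr_linear u T) (bil_liftr_bound u T).

Lemma bil_liftl_linl v : linear (bil_liftl_fun^~ v).
Proof. by move=> a S T; apply/val_inj/funext => h /=; rewrite -[LHS]/(B (a *: S h + T h) v) bilDl bilZl. Qed.
Lemma bil_liftl_linr T : linear (bil_liftl_fun T).
Proof. by move=> a u v; apply/val_inj/funext => h /=; rewrite bilDr bilZr. Qed.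
Lemma bil_liftl_fun_bound T v : `|bil_liftl_fun T v| <= bilM B * `|T| * `|v|.
Proof.
apply: contlin_norm_le => [|h]; last exact: bil_liftl_bound.
by rewrite !mulr_ge0 ?bilM_ge0.
Qed.
Definition bil_liftl : bilin (contlin X U) V (contlin X W) :=
  Bilin bil_liftl_linl bil_liftl_linr (bilM_ge0 B) bil_liftl_fun_bound.

Lemma bil_liftr_linr u : linear (bil_liftr_fun u).
Proof. by move=> a S T; apply/val_inj/funext => h /=; rewrite -[LHS]/(B u (a *: S h + T h)) bilDr bilZr. Qed.
Lemma bil_liftr_linl T : linear (bil_liftr_fun^~ T).
Proof. by move=> a u v; apply/val_inj/funext => h /=; rewrite bilDl bilZl. Qed.
Lemma bil_liftr_fun_bound u T : `|bil_liftr_fun u T| <= bilM B * `|u| * `|T|.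
Proof.
apply: contlin_norm_le => [|h]; last exact: bil_liftr_bound.
by rewrite !mulr_ge0 ?bilM_ge0.
Qed.
Definition bil_liftr : bilin U (contlin X V) (contlin X W) :=
  Bilin bil_liftr_linl bil_liftr_linr (bilM_ge0 B) bil_liftr_fun_bound.

Lemma continuous_bil (f : X -> U) (g : X -> V) (x : X) :
  {for x, continuous f} -> {for x, continuous g} ->
  {for x, continuous (fun z => B (f z) (g z))}.
Proof.
move=> /continuous_normP cf /continuous_normP cg; apply/continuous_normP => e e0.
set M := bilM B * (`|g x| + 1) + bilM B * `|f x| + 1.
have M0 : 0 < M.
  by rewrite /M ltr_wpDl// addr_ge0// mulr_ge0 ?bilM_ge0// addr_ge0.
have [d1 d10 f1] := cf _ (divr_gt0 e0 M0).
have [d2 d20 g1] := cg _ (divr_gt0 e0 M0).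
have [d3 d30 g2] := cg _ (@ltr01 R).
exists (Num.min d1 (Num.min d2 d3)); first by rewrite !lt_min d10 d20.
move=> y; rewrite !lt_min => /and3P[/f1 A /g1 C /g2 D].
have -> : B (f y) (g y) - B (f x) (g x) = B (f y - f x) (g y) + B (f x) (g y - g x).
  by rewrite bilBl bilBr addrA subrK.
have gy : `|g y| <= `|g x| + 1.
  by rewrite -[g y](subrK (g x)) addrC (le_trans (ler_normD _ _))// lerD2l.
rewrite (le_trans (ler_normD _ _))//.
apply: (@le_trans _ _ (bilM B * (e / M) * (`|g x| + 1) + bilM B * `|f x| * (e / M))).
  rewrite lerD// (le_trans (bil_bound _ _ _))//.
    by rewrite ler_pM ?mulr_ge0 ?bilM_ge0// ler_wpM2l ?bilM_ge0.
  by rewrite ler_wpM2l// mulr_ge0 ?bilM_ge0.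
rewrite [leLHS](_ : _ = (bilM B * (`|g x| + 1) + bilM B * `|f x|) * (e / M)); last by ring.
rewrite mulrA ler_pdivrMr// mulrC ler_wpM2l ?(ltW e0)//.
by rewrite /M lerDl.
Qed.

Lemma is_diff_bil (f : X -> U) (g : X -> V) (x : X) (S : contlin X U) (T : contlin X V) :
  is_diff x f S -> is_diff x g T ->
  is_diff x (fun z => B (f z) (g z)) (bil_liftl S (g x) + bil_liftr (f x) T).
Proof.
move=> fS gT; have cg := is_diff_continuous gT.
move: fS gT cg => /is_diff_normP fS /is_diff_normP gT /continuous_normP cg.
apply/is_diff_normP => e e0.
set M := bilM B * (`|g x| + 1) + bilM B * `|S| + bilM B * `|f x| + 1.
have M0 : 0 < M.
  by rewrite /M ltr_wpDl// !addr_ge0// mulr_ge0 ?bilM_ge0// addr_ge0.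
have eM0 : 0 < e / M by rewrite divr_gt0.
have [d1 d10 f1] := fS _ eM0.
have [d2 d20 g1] := gT _ eM0.
have [d3 d30 g2] := cg _ (@ltr01 R).
have [d4 d40 g3] := cg _ eM0.
exists (Num.min (Num.min d1 d2) (Num.min d3 d4)).
  by rewrite !lt_min d10 d20 d30.
move=> y; rewrite !lt_min => /andP[/andP[/f1 A /g1 C] /andP[/g2 D /g3 E]].
set h := y - x in A C *.
(* Remainder of f, cross term, remainder of g: each is at most e/M times |h| times one of the
   summands of [M]. *)
have -> : B (f y) (g y) - B (f x) (g x) - (bil_liftl S (g x) + bil_liftr (f x) T) h
  = B (f y - f x - S h) (g y) + B (S h) (g y - g x) + B (f x) (g y - g x - T h).
  rewrite contlinDE/= !bilBl !bilBr opprD !addrA subrK.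
  by rewrite (addrAC _ (- B (f x) (g y))) subrK (addrAC _ (- B (f x) (g x))).
have gy : `|g y| <= `|g x| + 1.
  by rewrite -[g y](subrK (g x)) addrC (le_trans (ler_normD _ _))// lerD2l.
rewrite (le_trans (ler_normD _ _))//.
apply: (@le_trans _ _ (bilM B * (e / M * `|h|) * (`|g x| + 1) +
   bilM B * (`|S| * `|h|) * (e / M) + bilM B * `|f x| * (e / M * `|h|))).
  rewrite lerD//.
    rewrite (le_trans (ler_normD _ _))// lerD// (le_trans (bil_bound _ _ _))//.
      by rewrite ler_pM ?mulr_ge0 ?bilM_ge0// ler_wpM2l ?bilM_ge0// A.
    by rewrite ler_pM ?mulr_ge0 ?bilM_ge0// ler_wpM2l ?bilM_ge0// contlin_le.
  by rewrite (le_trans (bil_bound _ _ _))// ler_wpM2l// mulr_ge0 ?bilM_ge0.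
rewrite [leLHS](_ : _ = (bilM B * (`|g x| + 1) + bilM B * `|S| + bilM B * `|f x|) * (e / M) * `|h|); last by ring.
rewrite ler_wpM2r// mulrA ler_pdivrMr// mulrC ler_wpM2l ?(ltW e0)//.
by rewrite /M lerDl.
Qed.

End Lift.

Lemma scale_linl V (v : V) : linear (fun a : R^o => a *: v).
Proof. by move=> a b c; rewrite scalerDl scalerA. Qed.
Lemma scale_linr V (a : R^o) : linear (fun v : V => a *: v).
Proof. by move=> b v w; rewrite scalerDr !scalerA mulrC. Qed.
Lemma scale_bound V (a : R^o) (v : V) : `|a *: v| <= 1 * `|a| * `|v|.
Proof. by rewrite mul1r normrZ. Qed.
Definition bil_scale V : bilin (R^o : normedModType R) V V :=
  Bilin (@scale_linl V) (@scale_linr V) (@ler01 R) (@scale_bound V).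

Lemma scalel_bound V (v : V) (a : R^o) : `|a *: v| <= `|v| * `|a|.
Proof. by rewrite normrZ mulrC. Qed.
Definition scalel_contlin V (v : V) : contlin R^o V :=
  mk_contlin (@scale_linl V v) (@scalel_bound V v).

Lemma apply_linl X V (v : X) : linear (fun T : contlin X V => T v).
Proof. by move=> a S T. Qed.
Lemma apply_linr X V (T : contlin X V) : linear T.
Proof. exact: contlin_linear. Qed.
Lemma apply_bound X V (T : contlin X V) v : `|T v| <= 1 * `|T| * `|v|.
Proof. by rewrite mul1r contlin_le. Qed.
Definition bil_apply X V : bilin (contlin X V) X V :=
  Bilin (@apply_linl X V) (@apply_linr X V) (@ler01 R) (@apply_bound X V).

End BoundedBilinear.

(** * Stability of C^n and C^k maps under sums, products and compositions *)

Section CnCalculus.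
Context {R : realType} {X : normedModType R}.
Implicit Types (Y U V W : normedModType R) (Omega : set X).

Lemma Cn_on_sub n Y Omega Omega' (f : X -> Y) :
  Omega' `<=` Omega -> Cn_on n Omega f -> Cn_on n Omega' f.
Proof.
move=> sub; elim: n Y f => [|n IH] Y f /=; first by move=> h x /sub; exact: h.
by move=> [Df fD CDf]; exists Df; [move=> x /sub; exact: fD|exact: IH].
Qed.

Lemma Cn_on_pred n Y Omega (f : X -> Y) : Cn_on n.+1 Omega f -> Cn_on n Omega f.
Proof.
elim: n Y f => [|n IH] Y f [Df fD CDf].
  by move=> x /fD /is_diff_continuous.
by exists Df => //; exact: IH.
Qed.

Lemma Cn_on_le m n Y Omega (f : X -> Y) :
  (m <= n)%N -> Cn_on n Omega f -> Cn_on m Omega f.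
Proof.
by move=> /subnK <-; elim: (n - m)%N => // p IH; rewrite addSn => /Cn_on_pred.
Qed.

Lemma Cn_on_eq n Y Omega (f g : X -> Y) : open Omega ->
  (forall x, Omega x -> f x = g x) -> Cn_on n Omega f -> Cn_on n Omega g.
Proof.
move=> oO fg; have nfg x : Omega x -> \forall y \near x, f y = g y.
  by move=> Ox; near=> y; apply: fg; near: y; exact: open_nbhs_nbhs.
case: n => [|n] /=; last first.
  by move=> [Df fD CDf]; exists Df => // x Ox; apply: is_diff_near_eq (fD x Ox); exact: nfg.
move=> cf x Ox; move: (cf _ Ox) (nfg _ Ox) => /continuous_normP cfx /near_normP[d d0 dP].
apply/continuous_normP => e e0; have [d' d'0 d'P] := cfx _ e0.
exists (Num.min d d'); first by rewrite lt_min d0.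
by move=> y; rewrite lt_min => /andP[yd yd']; rewrite -dP// -fg//; exact: d'P.
Unshelve. all: by end_near. Qed.

(** [Cn_on] asks for one derivative map on all of Omega. Local witnesses agree where they overlap
    because derivatives are unique, so a map choosing a derivative wherever one exists extends them
    all, and the induction applies to it. *)
Lemma Cn_on_local n Y Omega (f : X -> Y) :
  (forall x, Omega x -> exists U : set X, [/\ open U, U x & Cn_on n U f]) ->
  Cn_on n Omega f.
Proof.
elim: n Y f => [|n IH] Y f floc.
  by move=> x /floc[U [_ Ux]]; exact.
have dloc x : exists T : contlin X Y, Omega x -> is_diff x f T.
  have [Ox|nOx] := pselect (Omega x); last by exists 0.
  by have [U [_ Ux [Df fD _]]] := floc x Ox; exists (Df x) => _; exact: fD.
pose Df x := sval (cid (dloc x)).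
have fD x : Omega x -> is_diff x f (Df x) by exact: svalP (cid (dloc x)).
pose Dg x : contlin X Y :=
  if pselect (exists T : contlin X Y, is_diff x f T) is left h then sval (cid h) else 0.
have fDg x (T : contlin X Y) : is_diff x f T -> Dg x = T.
  rewrite /Dg; case: pselect => [h fT|h fT]; last by exfalso; apply: h; exists T.
  exact: is_diff_unique (svalP (cid h)) fT.
exists Dg => [x Ox|]; first by rewrite (fDg _ _ (fD _ Ox)); exact: fD.
apply: IH => x /floc[U [oU Ux [DU fU CU]]]; exists U; split=> //.
by apply: Cn_on_eq CU => // y Uy; rewrite (fDg _ _ (fU _ Uy)).
Qed.

Lemma Cn_on_const n Y Omega (y : Y) : Cn_on n Omega (fun=> y : Y).
Proof.
elim: n Y y => [|n IH] Y y /=; first by move=> x _; exact: cst_continuous.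
by exists (fun=> 0) => // x _; exact: is_diff_const.
Qed.

Lemma Cn_on_contlin n Y Omega (T : contlin X Y) : Cn_on n Omega T.
Proof.
case: n => [|n] /=; first by move=> x _; exact: contlin_continuous.
by exists (fun=> T); [move=> x _; exact: is_diff_contlin|exact: Cn_on_const].
Qed.

Lemma Cn_on_add n Y Omega (f g : X -> Y) :
  Cn_on n Omega f -> Cn_on n Omega g -> Cn_on n Omega (fun x => f x + g x).
Proof.
elim: n Y f g => [|n IH] Y f g /=.
  by move=> cf cg x Ox; apply: cvgD; [exact: cf|exact: cg].
move=> [Df fD CDf] [Dg gD CDg]; exists (fun x => Df x + Dg x); last exact: IH.
by move=> x Ox; apply: is_diff_add; [exact: fD|exact: gD].
Qed.

(** The derivative is a sum of two products of the same kind with other bilinear maps, so the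
    induction runs over all bounded bilinear maps at once. *)
Lemma Cn_on_bil n U V W (B : bilin U V W) Omega (f : X -> U) (g : X -> V) :
  Cn_on n Omega f -> Cn_on n Omega g -> Cn_on n Omega (fun x => B (f x) (g x)).
Proof.
elim: n U V W B f g => [|n IH] U V W B f g.
  by move=> cf cg x Ox; apply: continuous_bil; [exact: cf|exact: cg].
move=> Cf Cg; case: (Cf) (Cg) => Df fD CDf [Dg gD CDg].
exists (fun x => bil_liftl X B (Df x) (g x) + bil_liftr X B (f x) (Dg x)).
  by move=> x Ox; apply: is_diff_bil; [exact: fD|exact: gD].
apply: Cn_on_add; apply: IH => //; exact: Cn_on_pred.
Qed.

Lemma Cn_on_scale n Y Omega (q : X -> R^o) (g : X -> Y) :
  Cn_on n Omega q -> Cn_on n Omega g -> Cn_on n Omega (fun x => q x *: g x).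
Proof. exact: (Cn_on_bil (bil_scale Y)). Qed.

Lemma Cn_on_comp_contlin n U V Omega (T : contlin U V) (f : X -> U) :
  Cn_on n Omega f -> Cn_on n Omega (fun x => T (f x)).
Proof. by move=> Cf; apply: (Cn_on_bil (bil_apply U V)) => //; exact: Cn_on_const. Qed.

(** Affine inner maps are enough to transport (LA_k) from the unit ball to any ball. *)
Lemma Cn_on_affine n Y Omega (a : R) (b : X) (f : X -> Y) :
  Cn_on n Omega f ->
  Cn_on n [set x | Omega (a *: x + b)] (fun x => f (a *: x + b)).
Proof.
elim: n Y f => [|n IH] Y f.
  move=> cf x Ox; apply: (@continuous_comp _ _ _ (fun x => a *: x + b) f).
    by apply: cvgD; [apply: cvgZr; exact: cvg_id|exact: cvg_cst].
  exact: cf.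
move=> [Df fD CDf]; exists (fun x => a *: Df (a *: x + b)).
  move=> x Ox; have /is_diff_normP fDx := fD _ Ox.
  apply/is_diff_normP => e e0.
  have a0 : 0 < `|a| + 1 by rewrite ltr_wpDl.
  have [d d0 dP] := fDx _ (divr_gt0 e0 a0).
  exists (d / (`|a| + 1)); first by rewrite divr_gt0.
  move=> y; rewrite ltr_pdivlMr// => yx.
  have E : a *: y + b - (a *: x + b) = a *: (y - x).
    by rewrite opprD addrACA subrr addr0 scalerBr.
  have na : `|a *: (y - x)| <= `|y - x| * (`|a| + 1).
    by rewrite normrZ mulrC ler_wpM2l// lerDl.
  have := dP (a *: y + b); rewrite E => /(_ (le_lt_trans na yx)).
  rewrite contlinZE linearZ => /le_trans; apply.
  rewrite -mulrA ler_wpM2l ?(ltW e0)// ler_pdivrMl// mulrC.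
  by rewrite [leRHS]mulrC [leRHS]mulrC.
by apply: (Cn_on_scale (q := fun=> a)); [exact: Cn_on_const|exact: IH].
Qed.

(** With a sequence closed under differentiation, the derivative of [theta i] after q is
    [theta i.+1] after q times Dq, to which the induction applies again. *)
Lemma Cn_on_comp_real n (theta : nat -> R -> R) Omega (q : X -> R^o) i :
  (forall i t, is_derive t (1 : R^o) (theta i : R^o -> R^o) (theta i.+1 t)) ->
  Cn_on n Omega q -> Cn_on n Omega (fun x => theta i (q x) : R^o).
Proof.
move=> dtheta; elim: n i q => [|n IH] i q.
  move=> cq x Ox; apply: (@continuous_comp _ _ _ q (theta i : R^o -> R^o)); first exact: cq.
  apply: differentiable_continuous; apply/derivable1_diffP.
  exact: (@ex_derive _ _ _ _ _ _ _ (dtheta i (q x))).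
move=> Cq; case: (Cq) => Dq qD CDq.
exists (fun x => theta i.+1 (q x) *: Dq x).
  move=> x Ox; have qDx := qD _ Ox.
  have thx : differentiable (theta i : R^o -> R^o) (q x).
    by apply/derivable1_diffP; exact: (@ex_derive _ _ _ _ _ _ _ (dtheta i (q x))).
  have H := @is_diff_comp _ _ _ _ q (Dq x) _ _ x qDx (differentiableP thx).
  suff <- : 'd (theta i : R^o -> R^o) (q x) \o Dq x =
    (theta i.+1 (q x) *: Dq x : contlin X R^o) :> (X -> R^o) by exact: H.
  apply/funext => h /=; rewrite deriv1E; last by apply/derivable1_diffP.
  rewrite derive1E (@derive_val _ _ _ _ _ _ _ (dtheta i (q x))).
  exact: mulrC.
by apply: (@Cn_on_scale _ _ _ (fun x => theta i.+1 (q x))) => //; apply: IH; exact: Cn_on_pred.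
Qed.

End CnCalculus.

Section CkCalculus.
Context {R : realType} {X : normedModType R}.
Implicit Types (Y U V W : normedModType R) (Omega : set X) (k : option nat).

Lemma Ck_on_sub k Y Omega Omega' (f : X -> Y) :
  Omega' `<=` Omega -> Ck_on k Omega f -> Ck_on k Omega' f.
Proof.
case: k => [n|] sub; first exact: Cn_on_sub.
by move=> Cf n; exact: Cn_on_sub (Cf n).
Qed.

Lemma Ck_on_eq k Y Omega (f g : X -> Y) : open Omega ->
  (forall x, Omega x -> f x = g x) -> Ck_on k Omega f -> Ck_on k Omega g.
Proof.
case: k => [n|] oO fg; first exact: Cn_on_eq.
by move=> Cf n; exact: Cn_on_eq (Cf n).
Qed.

Lemma Ck_on_local k Y Omega (f : X -> Y) :
  (forall x, Omega x -> exists U : set X, [/\ open U, U x & Ck_on k U f]) ->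
  Ck_on k Omega f.
Proof.
case: k => [n|] floc; first exact: Cn_on_local.
by move=> n; apply: Cn_on_local => x /floc[U [oU Ux CU]]; exists U; split.
Qed.

Lemma Ck_on_const k Y Omega (y : Y) : Ck_on k Omega (fun=> y : Y).
Proof. by case: k => [n|]; [|move=> n]; exact: Cn_on_const. Qed.

Lemma Ck_on_contlin k Y Omega (T : contlin X Y) : Ck_on k Omega T.
Proof. by case: k => [n|]; [|move=> n]; exact: Cn_on_contlin. Qed.

Lemma Ck_on_add k Y Omega (f g : X -> Y) :
  Ck_on k Omega f -> Ck_on k Omega g -> Ck_on k Omega (fun x => f x + g x).
Proof. by case: k => [n|] Cf Cg; [|move=> n]; apply: Cn_on_add. Qed.

Lemma Ck_on_scale k Y Omega (q : X -> R^o) (g : X -> Y) :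
  Ck_on k Omega q -> Ck_on k Omega g -> Ck_on k Omega (fun x => q x *: g x).
Proof. by case: k => [n|] Cf Cg; [|move=> n]; apply: Cn_on_scale. Qed.

Lemma Ck_on_comp_contlin k U V Omega (T : contlin U V) (f : X -> U) :
  Ck_on k Omega f -> Ck_on k Omega (fun x => T (f x)).
Proof. by case: k => [n|] Cf; [|move=> n]; apply: Cn_on_comp_contlin. Qed.

Lemma Ck_on_affine k Y Omega (a : R) (b : X) (f : X -> Y) :
  Ck_on k Omega f ->
  Ck_on k [set x | Omega (a *: x + b)] (fun x => f (a *: x + b)).
Proof. by case: k => [n|] Cf; [|move=> n]; apply: Cn_on_affine. Qed.

Lemma Ck_on_comp_real k (theta : nat -> R -> R) Omega (q : X -> R^o) i :
  (forall i t, is_derive t (1 : R^o) (theta i : R^o -> R^o) (theta i.+1 t)) ->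
  Ck_on k Omega q -> Ck_on k Omega (fun x => theta i (q x) : R^o).
Proof. by case: k => [n|] dt Cf; [|move=> n]; apply: Cn_on_comp_real. Qed.

Lemma Ck_on_C1 k Y Omega (f : X -> Y) : k <> Some 0%N ->
  Ck_on k Omega f -> Ck_on (Some 1%N) Omega f.
Proof.
case: k => [[|n]|] // _; last by apply.
exact: Cn_on_le.
Qed.

Lemma Ck_on_diff k Y Omega (f : X -> Y) x : k <> Some 0%N ->
  Ck_on k Omega f -> Omega x -> exists T : contlin X Y, is_diff x f T.
Proof. by move=> /Ck_on_C1 h /h[Df fD _] Ox; exists (Df x); exact: fD. Qed.

End CkCalculus.

(** * The mean value inequality and a smooth cutoff *)

Section MeanValue.
Context {R : realType}.
Implicit Types X Y : normedModType R.

(** Continuous induction: the set of t with |g t - g 0| <= c t contains its supremum, and a supremum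
    below 1 could be pushed to the right. The local estimate compares with the centre t only, which
    is all that a derivative provides. *)
Lemma pointwise_lipschitz_itv Y (g : R -> Y) (c : R) :
  (forall t, 0 <= t <= 1 -> exists2 d : R, 0 < d &
    forall s, 0 <= s <= 1 -> `|s - t| < d -> `|g s - g t| <= c * `|s - t|) ->
  `|g 1 - g 0| <= c.
Proof.
move=> gloc.
pose S := [set t : R | 0 <= t <= 1 /\ `|g t - g 0| <= c * t].
have S0 : S 0 by rewrite /S /= lexx ler01 subrr normr0 mulr0.
have supS : has_sup S by split; [exists 0|exists 1 => t [/andP[]]].
set s := sup S.
have s0 : 0 <= s by apply: ub_le_sup => //; case: supS.
have s1 : s <= 1 by apply: ge_sup; [exists 0|move=> t [/andP[]]].
have s01 : 0 <= s <= 1 by rewrite s0.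
have [d d0 dP] := gloc _ s01.
have [t [t01 gt] st] := sup_adherent d0 supS; rewrite -/s in st.
have ts : t <= s by apply: ub_le_sup => //; case: supS.
have Ss : S s.
  split=> //; rewrite (le_trans (ler_distD (g t) _ _))//.
  have -> : c * s = c * `|t - s| + c * t.
    by rewrite distrC ger0_norm ?subr_ge0// -mulrDr subrK.
  rewrite lerD// distrC; apply: dP => //.
  by rewrite distrC ger0_norm ?subr_ge0// ltrBlDl -ltrBlDr.
move: s1; rewrite le_eqVlt => /predU1P[s1|s1].
  by case: Ss => _; rewrite s1 mulr1.
pose u := Num.min 1 (s + d / 2).
have su : s < u by rewrite lt_min s1 ltrDl divr_gt0.
have u01 : 0 <= u <= 1 by rewrite (le_trans s0 (ltW su))// ge_min lexx.
have uS : S u.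
  split=> //; rewrite (le_trans (ler_distD (g s) _ _))//.
  have -> : c * u = c * `|u - s| + c * s.
    by rewrite gtr0_norm ?subr_gt0// -mulrDr subrK.
  rewrite lerD//; last by case: Ss.
  apply: dP => //; rewrite gtr0_norm ?subr_gt0// ltrBlDl.
  by rewrite (@le_lt_trans _ _ (s + d / 2)) ?ge_min ?lexx ?orbT// ltrD2l ltr_pdivrMr// mulr_natr mulr2n ltrDl.
have : u <= s by apply: ub_le_sup => //; case: supS.
by rewrite leNgt su.
Qed.

Lemma pointwise_lipschitz X Y (f : X -> Y) (x y : X) (c : R) :
  (forall t, 0 <= t <= 1 -> \forall w \near x + t *: (y - x),
    `|f w - f (x + t *: (y - x))| <= c * `|w - (x + t *: (y - x))|) ->
  `|f y - f x| <= c * `|y - x|.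
Proof.
move=> floc; pose g t := f (x + t *: (y - x)).
have -> : f y = g 1 by rewrite /g scale1r addrC subrK.
have -> : f x = g 0 by rewrite /g scale0r addr0.
apply: pointwise_lipschitz_itv => t /floc /near_normP[d d0 dP].
have n0 : 0 < `|y - x| + 1 by rewrite ltr_wpDl.
exists (d / (`|y - x| + 1)); first by rewrite divr_gt0.
move=> s _; rewrite ltr_pdivlMr// => sd.
have E : x + s *: (y - x) - (x + t *: (y - x)) = (s - t) *: (y - x).
  by rewrite opprD addrACA subrr add0r scalerBl.
have := dP (x + s *: (y - x)); rewrite E normrZ => h.
rewrite -mulrA [_ * `|s - t|]mulrC; apply: h.
by rewrite (le_lt_trans _ sd)// ler_wpM2l// lerDl.
Qed.

(** Near each point of the segment the pointwise Lipschitz constant is M plus an arbitrary excess;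
    the excess e / (|y - x| + 1) costs at most e in total. *)
Lemma mean_value_le X Y (f : X -> Y) (x y : X) (M : R) :
  (forall t, 0 <= t <= 1 -> exists2 T : contlin X Y,
    is_diff (x + t *: (y - x)) f T & `|T| <= M) ->
  `|f y - f x| <= M * `|y - x|.
Proof.
move=> fM; apply/ler_addgt0Pl => e e0.
have n0 : 0 < `|y - x| + 1 by rewrite ltr_wpDl.
have en0 : 0 < e / (`|y - x| + 1) by rewrite divr_gt0.
apply: (@le_trans _ _ ((M + e / (`|y - x| + 1)) * `|y - x|)); last first.
  rewrite mulrDl addrC lerD2r mulrAC ler_pdivrMr// ler_wpM2l ?(ltW e0)//.
  by rewrite lerDl.
apply: pointwise_lipschitz => t /fM[T /is_diff_normP/(_ _ en0)[d d0 dP] TM].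
apply/near_normP; exists d => // w /dP {dP}; set z := x + _ => wz.
rewrite -[f w - f z](subrK (T (w - z))) (le_trans (ler_normD _ _))//.
rewrite mulrDl addrC lerD// (le_trans (contlin_le _ _))// ler_wpM2r//.
Qed.

End MeanValue.

(** * A smooth cutoff on the line built from exp(-1/t) *)

Section SmoothCutoff.
Context {R : realType}.

(* The functions P(1/t) exp(-1/t), extended by 0 to t <= 0, form a class closed
   under differentiation. *)
Definition flat_poly (P : {poly R}) (t : R) : R :=
  if 0 < t then P.[t^-1] * expR (- t^-1) else 0.

Lemma horner_bound (P : {poly R}) :
  exists2 A : R, 0 <= A & forall s, 1 <= s -> `|P.[s]| <= A * s ^+ size P.
Proof.
exists (\sum_(i < size P) `|P`_i|); first exact: sumr_ge0.
move=> s s1; rewrite horner_coef (le_trans (ler_norm_sum _ _ _))// mulr_suml.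
apply: ler_sum => i _; rewrite normrM ler_wpM2l//.
by rewrite ger0_norm ?exprn_ge0 ?(le_trans ler01 s1)// ler_weXn2l// ltnW.
Qed.

(** The factor t^2 on the right yields the derivative 0 at the origin, whatever P is. *)
Lemma flat_poly_bound (P : {poly R}) :
  exists2 C : R, 0 <= C & forall t, t <= 1 -> `|flat_poly P t| <= C * `|t| ^+ 2.
Proof.
have [A A0 AP] := horner_bound P.
(* exp(1/t) dominates t^-(m+1) / (m+1)!, and m + 1 = size P + 2 leaves two powers of t after the
   growth t^-(size P) of P(1/t). *)
pose m := (size P + 1)%N.
exists (A * m.+1`!%:R); first by rewrite mulr_ge0.
move=> t t1; rewrite /flat_poly; case: ltP => [t0|_]; last first.
  by rewrite normr0 !mulr_ge0// exprn_ge0.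
have s1 : 1 <= t^-1 by rewrite invf_ge1.
have s0 : 0 < t^-1 by rewrite invr_gt0.
have f0 : 0 < m.+1`!%:R :> R by rewrite ltr0n fact_gt0.
rewrite normrM (ger0_norm (expR_ge0 _)).
have E : t^-1 ^+ m.+1 / m.+1`!%:R <= expR t^-1.
  by rewrite (le_trans _ (expR_ge1Dxn m (ltW s0)))// lerDr.
have {}E : expR (- t^-1) <= m.+1`!%:R / t^-1 ^+ m.+1.
  by rewrite expRN -[leRHS]invf_div lef_pV2 ?posrE ?divr_gt0 ?exprn_gt0 ?expR_gt0.
apply: (@le_trans _ _ (A * t^-1 ^+ size P * (m.+1`!%:R / t^-1 ^+ m.+1))).
  by rewrite ler_pM ?expR_ge0// AP.
rewrite gtr0_norm// -!mulrA ler_wpM2l// mulrCA ler_wpM2l ?(ltW f0)//.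
rewrite /m addn1 -addn2 exprD invfM mulrA divff ?mul1r ?expf_neq0 ?gt_eqF//.
by rewrite exprVn invrK.
Qed.

(** For t > 0, differentiating P(1/t) and exp(-1/t) both produce a factor t^-2, which is the X^2;
    for t < 0 the function is locally 0; at 0 the quadratic bound applies. *)
Lemma is_derive_flat_poly (P : {poly R}) (t : R) :
  is_derive t (1 : R^o) (flat_poly P : R^o -> R^o)
    (flat_poly ('X^2 * (P - P^`())) t).
Proof.
have [t0|t0|t0] := ltgtP t 0.
- have -> : flat_poly ('X^2 * (P - P^`())) t = 0 by rewrite /flat_poly ltNge (ltW t0).
  apply: (@near_eq_is_derive _ _ _ (cst 0)) => //.
  near=> s; rewrite /flat_poly ltNge ltW//.
  by near: s; apply: lt_nbhsl.
- have tN0 : t != 0 by rewrite gt_eqF.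
  pose inv_ := (fun y : R => y^-1).
  have dinv : is_derive t (1 : R) inv_ (- t ^- 2).
    have := @is_deriveV R id t 1 1 tN0 (is_derive_id _ _).
    by rewrite -[_ *: 1]/(_ * 1) mulr1.
  have dP := @is_derive1_comp R (horner P) inv_ t _ _ (is_derive_poly P (inv_ t)) dinv.
  have dE := @is_derive1_comp R expR (fun y => - y^-1) t _ _ (is_derive_expR (- t^-1)) (is_deriveN dinv).
  have H := is_deriveM dP dE.
  apply: (@near_eq_is_derive _ _ _ ((horner P \o inv_) * (expR \o (fun y => - y^-1)))) => //.
    near=> s; rewrite /flat_poly ifT//.
    by near: s; apply: lt_nbhsr.
  apply: is_derive_eq; rewrite /flat_poly t0 !hornerE /=.
  rewrite -![_ *: _]/(_ * _) /inv_ exprVn; ring.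
- have -> : flat_poly ('X^2 * (P - P^`())) t = 0 by rewrite /flat_poly t0 ltxx.
  have [C C0 CP] := flat_poly_bound P.
  have fd : is_diff (t : R^o) (flat_poly P : R^o -> R^o) (0 : contlin R^o R^o).
    apply/is_diff_normP => e e0.
    exists (Num.min 1 (e / (C + 1))); first by rewrite lt_min ltr01 divr_gt0// ltr_wpDl.
    move=> s; rewrite t0 subr0 contlin0E subr0 lt_min => /andP[s1 se].
    have -> : flat_poly P 0 = 0 by rewrite /flat_poly ltxx.
    rewrite subr0 (le_trans (CP _ _))//.
      by rewrite (le_trans (ler_norm _))// ltW.
    rewrite expr2 mulrA ler_wpM2r// mulrC.
    move: se; rewrite ltr_pdivlMr ?ltr_wpDl// => /ltW; apply: le_trans.
    by rewrite ler_wpM2l// lerDl.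
  apply: DeriveDef; first by apply/derivable1_diffP; exact: (@ex_diff _ _ _ _ _ _ _ fd).
  rewrite deriveE; last exact: (@ex_diff _ _ _ _ _ _ _ fd).
  by rewrite (@diff_val _ _ _ _ _ _ _ fd).
Unshelve. all: by end_near. Qed.

Definition flat_poly_seq (i : nat) : {poly R} :=
  iter i (fun P => 'X^2 * (P - P^`())) 1.

Definition flat := flat_poly (flat_poly_seq 0).

Lemma flatE t : flat t = if 0 < t then expR (- t^-1) else 0.
Proof. by rewrite /flat /flat_poly /= hornerE mul1r. Qed.

Lemma flat_ge0 t : 0 <= flat t.
Proof. by rewrite flatE; case: ifP => // _; exact: expR_ge0. Qed.

Lemma flat_gt0 t : 0 < t -> 0 < flat t.
Proof. by rewrite flatE => ->; exact: expR_gt0. Qed.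

Lemma flat_eq0 t : t <= 0 -> flat t = 0.
Proof. by rewrite flatE ltNge => ->. Qed.

Lemma flat_le s t : s <= t -> flat s <= flat t.
Proof.
move=> st; have [s0|s0] := leP s 0; first by rewrite flat_eq0 ?flat_ge0.
have t0 := lt_le_trans s0 st.
by rewrite !flatE s0 t0 ler_expR lerN2 lef_pV2.
Qed.

Lemma flat_lipschitz : exists2 L : R, 0 <= L & forall s t, `|flat s - flat t| <= L * `|s - t|.
Proof.
have [A A0 AP] := flat_poly_bound (flat_poly_seq 1).
have fT (t : R^o) : is_diff t (flat : R^o -> R^o)
    (scalel_contlin (flat_poly (flat_poly_seq 1) t : R^o)).
  have dt := is_derive_flat_poly (flat_poly_seq 0) t.
  have df : differentiable (flat : R^o -> R^o) t.
    by apply/derivable1_diffP; exact: (@ex_derive _ _ _ _ _ _ _ dt).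
  split=> //; apply/funext => h /=.
  rewrite deriv1E; last by apply/derivable1_diffP.
  by rewrite derive1E (@derive_val _ _ _ _ _ _ _ dt).
have [B B0 BP] : exists2 B : R, 0 <= B & forall t, `|flat_poly (flat_poly_seq 1) t| <= B.
  (* The derivative is s^2 exp(-s) with s = 1/t, and exp(s) >= s^2 / 2. *)
  exists 2 => // t; rewrite /flat_poly; case: ifP => t0; last by rewrite normr0.
  rewrite /= derivC subr0 mulr1 hornerXn normrM !ger0_norm ?expR_ge0 ?exprn_ge0 ?invr_ge0 ?(ltW t0)//.
  rewrite expRN ler_pdivrMr ?expR_gt0//.
  have s0 : 0 <= t^-1 by rewrite invr_ge0 ltW.
  rewrite -ler_pdivrMl// mulrC (le_trans _ (expR_ge1Dxn 1 s0))//.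
  by rewrite lerDr.
exists B => // s t; apply: (@mean_value_le R R^o R^o flat t s) => u _.
eexists; first exact: fT.
apply: contlin_norm_le => // h /=.
by rewrite -[_ *: _]/(_ * _) normrM mulrC ler_wpM2r.
Qed.

(** Nesting [flat] replaces the usual quotient: the inner difference equals flat 1 for t <= 1 and is
    nonpositive for t >= 2. Only sums, constants and composition with [flat] occur, so smoothness
    follows at once. *)
Definition cutoff (t : R) : R :=
  (flat (flat 1))^-1 * flat (flat 1 - flat (t - 1)).

Let flat1_gt0 : 0 < flat (flat 1).
Proof. by rewrite !flat_gt0. Qed.

Lemma cutoff_ge0 t : 0 <= cutoff t.
Proof. by rewrite mulr_ge0 ?invr_ge0 ?flat_ge0. Qed.

Lemma cutoff_le1 t : cutoff t <= 1.
Proof.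
rewrite /cutoff mulrC ler_pdivrMr// mul1r; apply: flat_le.
by rewrite lerBlDr lerDl flat_ge0.
Qed.

Lemma cutoff_eq1 t : t <= 1 -> cutoff t = 1.
Proof.
move=> t1; rewrite /cutoff [flat (t - 1)]flat_eq0 ?subr_le0// subr0 mulVf//.
by rewrite gt_eqF.
Qed.

Lemma cutoff_eq0 t : 2 <= t -> cutoff t = 0.
Proof.
move=> t2; rewrite /cutoff [flat (_ - _)]flat_eq0 ?mulr0// subr_le0; apply: flat_le.
by rewrite lerBrDr.
Qed.

Lemma cutoff_lipschitz :
  exists2 L : R, 0 <= L & forall s t, `|cutoff s - cutoff t| <= L * `|s - t|.
Proof.
have [L L0 fL] := flat_lipschitz.
exists ((flat (flat 1))^-1 * (L * L)); first by rewrite mulr_ge0 ?invr_ge0 ?mulr_ge0// ltW.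
move=> s t; rewrite /cutoff -mulrBr normrM gtr0_norm ?invr_gt0// -mulrA.
rewrite ler_wpM2l ?invr_ge0 ?(ltW flat1_gt0)// (le_trans (fL _ _))// -mulrA ler_wpM2l//.
rewrite opprB addrC addrA subrK distrC (le_trans (fL _ _))//.
by rewrite opprB addrA subrK.
Qed.

Lemma Ck_on_cutoff (X : normedModType R) k (Omega : set X) (q : X -> R^o) :
  Ck_on k Omega q -> Ck_on k Omega (fun x => cutoff (q x) : R^o).
Proof.
move=> Cq; have dflat i t := is_derive_flat_poly (flat_poly_seq i) t.
have Cflat (p : X -> R^o) : Ck_on k Omega p -> Ck_on k Omega (fun x => flat (p x) : R^o).
  exact: (@Ck_on_comp_real _ _ _ (fun i => flat_poly (flat_poly_seq i)) _ p 0%N dflat).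
apply: (@Ck_on_scale _ _ _ _ _ (fun=> (flat (flat 1))^-1) (fun x => flat (flat 1 - flat (q x - 1)))).
  exact: Ck_on_const.
apply: (Cflat _); apply: (@Ck_on_add _ _ _ R^o _ (fun=> flat 1)); first exact: Ck_on_const.
have -> : (fun x => - flat (q x - 1)) = (fun x => (-1 : R^o) *: (flat (q x - 1) : R^o)).
  by apply/funext => x; rewrite scaleN1r.
apply: (@Ck_on_scale _ _ _ _ _ (fun=> -1)); first exact: Ck_on_const.
by apply: (Cflat _); apply: (@Ck_on_add _ _ _ R^o _ q) => //; exact: Ck_on_const.
Qed.

End SmoothCutoff.

(** * Norming functionals and approximation on balls *)

Section HahnBanach.
Context {R : realType} {Y : normedModType R}.

Definition sublinear (q : Y -> R) : Prop :=
  [/\ forall v, q v <= `|v|, forall u v, q (u + v) <= q u + q v &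
      forall a v, 0 <= a -> q (a *: v) <= a * q v].

Lemma sublinear0 q : sublinear q -> q 0 = 0.
Proof.
move=> [qn qD qZ]; apply/eqP; rewrite eq_le; apply/andP; split.
  by have := qn 0; rewrite normr0.
by have := qD 0 0; rewrite addr0 -lerBlDr subrr.
Qed.

Lemma sublinear_opp q v : sublinear q -> - q (- v) <= q v.
Proof.
move=> sq; have [qn qD qZ] := sq.
by have := qD v (- v); rewrite subrr sublinear0// -lerBlDr sub0r.
Qed.

Lemma sublinear_ge q v : sublinear q -> - `|v| <= q v.
Proof.
move=> sq; have [qn _ _] := sq.
by apply: le_trans (sublinear_opp v sq); rewrite lerN2 -normrN qn.
Qed.

Lemma sublinearZ q a v : sublinear q -> 0 <= a -> q (a *: v) = a * q v.
Proof.
move=> sq; have [_ _ qZ] := sq.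
rewrite le_eqVlt => /predU1P[<-|a0]; first by rewrite scale0r mul0r sublinear0.
apply/eqP; rewrite eq_le qZ ?(ltW a0)//= -ler_pdivlMl//.
have := qZ a^-1 (a *: v); rewrite scalerA mulVf ?gt_eqF// scale1r; apply.
by rewrite invr_ge0 ltW.
Qed.

(* Any minimal sublinear functional is linear, since it coincides with all its tilts. *)
Definition tilt (q : Y -> R) (z v : Y) : R :=
  inf [set q (v + t *: z) - t * q z | t in [set t | 0 <= t]].

Lemma tilt_lbound q z v : sublinear q ->
  lbound [set q (v + t *: z) - t * q z | t in [set t | 0 <= t]] (- q (- v)).
Proof.
move=> sq; have [qn qD _] := sq; move=> _ [t /= t0 <-].
rewrite lerBrDr addrC -(sublinearZ _ sq t0) lerBlDr addrC.
by have := qD (- v) (v + t *: z); rewrite addKr.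
Qed.

Lemma tilt_le q z v t : sublinear q -> 0 <= t ->
  tilt q z v <= q (v + t *: z) - t * q z.
Proof.
move=> sq t0; apply: ge_inf; last by exists t.
by exists (- q (- v)); exact: tilt_lbound.
Qed.

Lemma tilt_ge q z v m : 
  (forall t, 0 <= t -> m <= q (v + t *: z) - t * q z) -> m <= tilt q z v.
Proof.
move=> mq; apply: lb_le_inf; first by exists (q (v + 0 *: z) - 0 * q z), 0 => /=.
by move=> _ [t /= t0 <-]; exact: mq.
Qed.

Lemma tilt_le_id q z v : sublinear q -> tilt q z v <= q v.
Proof. by move=> sq; have := tilt_le z v sq (lexx 0); rewrite scale0r addr0 mul0r subr0. Qed.

Lemma tilt_sublinear q z : sublinear q -> sublinear (tilt q z).
Proof.
move=> sq; have [qn qD qZ] := sq; split.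
- by move=> v; exact: le_trans (tilt_le_id z v sq) (qn v).
- move=> u v; rewrite -lerBlDr; apply: tilt_ge => s s0.
  rewrite lerBlDr -lerBlDl; apply: tilt_ge => t t0.
  rewrite lerBlDl (le_trans (tilt_le z _ sq (addr_ge0 s0 t0)))//.
  by rewrite scalerDl addrACA mulrDl opprD [leRHS]addrACA lerD2r.
- move=> a v; rewrite le_eqVlt => /predU1P[<-|a0].
    by rewrite scale0r mul0r (le_trans (tilt_le_id z 0 sq))// sublinear0.
  rewrite -ler_pdivrMl//; apply: tilt_ge => t t0.
  rewrite ler_pdivrMl// (le_trans (tilt_le z _ sq (mulr_ge0 (ltW a0) t0)))//.
  by rewrite -scalerA -scalerDr mulrBr mulrA lerD2r qZ// ltW.
Qed.

Lemma norm_sublinear : sublinear (fun v : Y => `|v|).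
Proof. by split=> // [u v|a v a0]; [exact: ler_normD|rewrite normrZ ger0_norm]. Qed.

(** Hahn-Banach by Zorn's lemma among sublinear functionals with q(-y) <= -|y|, a class that
    contains the tilt of the norm along y. A minimal element is linear, and then q(y) = -q(-y) >=
    |y|. *)
Lemma exists_norming (y : Y) :
  exists2 phi : contlin Y (R^o : normedModType R), phi y = `|y| & `|phi| <= 1.
Proof.
pose S := {q : Y -> R | sublinear q /\ q (- y) <= - `|y|}.
have S0 : S.
  exists (tilt (fun v => `|v|) y); split; first exact: tilt_sublinear norm_sublinear.
  have := tilt_le y (- y) norm_sublinear ler01.
  by rewrite scale1r addNr normr0 mul1r sub0r.
(* The order is reversed, so that Zorn's maximal element is a minimal functional. *)
pose rel (p q : S) := `[< forall v, sval q v <= sval p v >].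
have [||A Atot|q qmin] := @ZL_preorder S S0 rel.
- by move=> t; apply/asboolP.
- by move=> r s t /asboolP rs /asboolP st; apply/asboolP => v; exact: le_trans (rs v).
- have [[a0 Aa0]|A0] := pselect (A !=set0); last first.
    by exists S0 => s As; exfalso; apply: A0; exists s.
  (* The pointwise infimum bounds the chain; it is finite since sublinear functionals are at least
     -|v|. Subadditivity compares two members of the chain through the smaller one. *)
  pose q v := inf [set sval p v | p in A].
  have qlb v : lbound [set sval p v | p in A] (- `|v|).
    by move=> _ [p Ap <-]; apply: sublinear_ge; case: (svalP p).
  have q_le p v : A p -> q v <= sval p v.
    by move=> Ap; apply: ge_inf; [exists (- `|v|); exact: qlb|exists p].
  have q_ge v m : (forall p, A p -> m <= sval p v) -> m <= q v.
    move=> mA; apply: lb_le_inf; first by exists (sval a0 v), a0.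
    by move=> _ [p Ap <-]; exact: mA.
  have sq : sublinear q /\ q (- y) <= - `|y|.
    split; [split|].
    + by move=> v; rewrite (le_trans (q_le _ _ Aa0))//; case: (svalP a0) => -[].
    + move=> u v; rewrite -lerBlDr; apply: (q_ge) => p1 Ap1.
      rewrite lerBlDr -lerBlDl; apply: (q_ge) => p2 Ap2; rewrite lerBlDl.
      have [[_ D1 _] _] := svalP p1; have [[_ D2 _] _] := svalP p2.
      have [/asboolP h|/asboolP h] := Atot _ _ Ap1 Ap2.
        by rewrite (le_trans (q_le _ _ Ap2))// (le_trans (D2 _ _))// lerD2r.
      by rewrite (le_trans (q_le _ _ Ap1))// (le_trans (D1 _ _))// lerD2l.
    + move=> a v; rewrite le_eqVlt => /predU1P[<-|ap].
        have [s0 _] := svalP a0.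
        by rewrite scale0r mul0r (le_trans (q_le _ _ Aa0))// sublinear0.
      rewrite -ler_pdivrMl//; apply: (q_ge) => p Ap; rewrite ler_pdivrMl//.
      rewrite (le_trans (q_le _ _ Ap))//; have [[_ _ Z] _] := svalP p.
      by rewrite Z// ltW.
    + by rewrite (le_trans (q_le _ _ Aa0))//; case: (svalP a0).
  by exists (exist _ q sq) => s As; apply/asboolP => v; exact: q_le.
have [sq qy] := svalP q; have [qn qD qZ] := sq.
have qadd u v : sval q (u + v) = sval q u + sval q v.
  apply/eqP; rewrite eq_le qD/=.
  have ty : sublinear (tilt (sval q) v) /\ tilt (sval q) v (- y) <= - `|y|.
    by split; [exact: tilt_sublinear|rewrite (le_trans (tilt_le_id _ _ sq))].
  (* The tilt along v lies in the class and below q, so by minimality q lies below it; the choice t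
     = 1 gives q(u) <= q(u + v) - q(v). *)
  have /asboolP/(_ u) /= h : rel (exist _ _ ty) q.
    by apply: qmin; apply/asboolP => w; exact: tilt_le_id.
  rewrite -lerBrDr; apply: (le_trans h).
  by have := tilt_le v u sq ler01; rewrite scale1r mul1r.
have qN v : sval q (- v) = - sval q v.
  by apply/eqP; rewrite -addr_eq0 -qadd addNr sublinear0.
have ql : linear (sval q : Y -> R^o).
  move=> a u v; rewrite qadd; congr (_ + _).
  have [a0|a0] := leP 0 a; first exact: sublinearZ.
  by rewrite -[a]opprK scaleNr qN sublinearZ ?oppr_ge0 ?(ltW a0)// scaleNr.
have qb v : `|(sval q v : R^o)| <= 1 * `|v|.
  by rewrite mul1r ler_norml sublinear_ge// qn.
exists (mk_contlin ql qb); last exact: contlin_norm_le.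
apply/eqP; rewrite eq_le /= qn/= -lerN2.
by rewrite -qN.
Qed.

End HahnBanach.

(** * Property (LA_k) on arbitrary balls and for real-valued maps *)

Section LipschitzOn.
Context {R : realType}.
Implicit Types X Y Z : normedModType R.

Definition lip_on X Y (S : set X) (L : R) (f : X -> Y) : Prop :=
  forall x y, S x -> S y -> `|f x - f y| <= L * `|x - y|.

Lemma lip_onP X Y (S : set X) (L : R) (f : X -> Y) : L.-lipschitz_S f <-> lip_on S L f.
Proof.
split=> [h x y Sx Sy|h [x y] /= [Sx Sy]]; first exact: (h (x, y)).
exact: h.
Qed.

Definition LA_balls X Y (k : option nat) (C : R) : Prop :=
  forall (p : X) (s L : R) (F : X -> Y) (eps : R), 0 < s -> 0 <= L -> 0 < eps ->
    lip_on (ball p s) L F ->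
    exists g : X -> Y, [/\ lip_on (ball p s) (C * L) g, Ck_on k (ball p s) g &
      forall x, ball p s x -> `|F x - g x| <= eps].

(** Dilation by s turns L into L s and its inverse divides by s, so the same C serves all balls. *)
Lemma property_LA_balls X Y k : property_LA X Y k ->
  exists2 C : R, 0 <= C & LA_balls X Y k C.
Proof.
move=> [C C0 LA]; exists C => // p s L F eps s0 L0 e0 FL.
have sN0 : s != 0 by rewrite gt_eqF.
have ballE x : ball 0 1 (s^-1 *: x + - (s^-1 *: p)) <-> ball p s x.
  rewrite -!ball_normE /= sub0r normrN -scalerBr normrZ gtr0_norm ?invr_gt0//.
  by rewrite ltr_pdivrMl// mulr1 distrC.
have FL' : (L * s).-lipschitz_(ball 0 1) (fun u => F (p + s *: u)).
  apply/lip_onP => u v u1 v1; rewrite -mulrA -(gtr0_norm s0) -normrZ (gtr0_norm s0).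
  have -> : s *: (u - v) = p + s *: u - (p + s *: v).
    by rewrite opprD addrACA subrr add0r scalerBr.
  have bp w : ball 0 1 w -> ball p s (p + s *: w).
    rewrite -!ball_normE /= sub0r normrN opprD addNKr normrN normrZ gtr0_norm// => w1.
    by rewrite -[ltRHS]mulr1 ltr_pM2l.
  by apply: FL; exact: bp.
have [g [gL gC gF]] := LA _ _ _ (mulr_ge0 L0 (ltW s0)) e0 FL'.
move/lip_onP in gL.
exists (fun x => g (s^-1 *: x + - (s^-1 *: p))); split.
- move=> x y xs ys; rewrite (le_trans (gL _ _ _ _)) ?ballE//.
  have -> : s^-1 *: x - s^-1 *: p - (s^-1 *: y - s^-1 *: p) = s^-1 *: (x - y).
    by rewrite opprB addrA subrK scalerBr.
  by rewrite normrZ gtr0_norm ?invr_gt0// !mulrA mulfK.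
- have := @Ck_on_affine _ _ k Y (ball 0 1) s^-1 (- (s^-1 *: p)) g gC.
  by apply: Ck_on_sub => x /ballE.
- move=> x /ballE /gF.
  have -> // : p + s *: (s^-1 *: x - s^-1 *: p) = x.
  by rewrite -scalerBr scalerA divff// scale1r addrC subrK.
Qed.

Lemma LA_balls_real X Y k C (y : Y) : y != 0 -> 0 <= C -> LA_balls X Y k C ->
  LA_balls X (R^o : normedModType R) k C.
Proof.
move=> y0 C0 LA p s L u eps s0 L0 e0 uL.
have ny : 0 < `|y| by rewrite normr_gt0.
have [phi phiy phi1] := exists_norming y.
have uyL : lip_on (ball p s) (L * `|y|) (fun x => u x *: y).
  move=> x z xs zs; rewrite -scalerBl normrZ mulrAC ler_wpM2r//; exact: uL.
have [g [gL gC gu]] := LA p s _ _ (eps * `|y|) s0 (mulr_ge0 L0 (ltW ny)) (mulr_gt0 e0 ny) uyL.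
have phib v : `|phi v| <= `|v|.
  by rewrite (le_trans (contlin_le _ _))// ler_piMl.
exists (fun x => `|y|^-1 *: phi (g x)); split.
- move=> x z xs zs; rewrite -scalerBr normrZ gtr0_norm ?invr_gt0//.
  rewrite -linearB ler_pdivrMl// (le_trans (phib _))// (le_trans (gL _ _ xs zs))//.
  by rewrite [leLHS](_ : _ = `|y| * (C * L * `|x - z|))//; ring.
- apply: (@Ck_on_scale _ _ _ _ _ (fun=> `|y|^-1)); first exact: Ck_on_const.
  exact: Ck_on_comp_contlin.
- move=> x xs.
  have -> : u x = `|y|^-1 *: phi (u x *: y).
    have phiZ : phi (u x *: y) = u x *: phi y by exact: linearZ.
    rewrite phiZ phiy -![_ *: _]/(_ * _) mulrCA mulVf ?mulr1//.
    by rewrite gt_eqF.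
  rewrite -scalerBr normrZ gtr0_norm ?invr_gt0// -linearB.
  rewrite ler_pdivrMl// (le_trans (phib _))// mulrC; exact: gu.
Qed.

End LipschitzOn.

(** * Smooth partitions of unity *)

Section TruncatedDistance.
Context {R : realType} {X : normedModType R}.

Implicit Type S : set X.

(** The extra value 1 gives a meaning to the distance from the empty set and keeps the function
    1-Lipschitz; only distances below 1 are used. *)
Definition dist1 S (x : X) : R :=
  inf [set t | t = 1 \/ exists2 s, S s & t = `|x - s|].

Lemma dist1_lbound S (x : X) : lbound [set t | t = 1 \/ exists2 s, S s & t = `|x - s|] 0.
Proof. by move=> _ [->|[s _ ->]]. Qed.

Lemma dist1_le S x s : S s -> dist1 S x <= `|x - s|.
Proof.
by move=> Ss; apply: ge_inf; [exists 0; exact: dist1_lbound|right; exists s].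
Qed.

Lemma dist1_lt S x r : r <= 1 -> dist1 S x < r -> exists2 s, S s & `|x - s| < r.
Proof.
move=> r1 xr.
have hinf : has_inf [set t | t = 1 \/ exists2 s, S s & t = `|x - s|].
  by split; [exists 1; left|exists 0; exact: dist1_lbound].
have d0 : 0 < r - dist1 S x by rewrite subr_gt0.
have [_ [->|[s Ss ->]]] := inf_adherent d0 hinf; rewrite -/(dist1 S x) [ltRHS]addrC subrK.
  by rewrite ltNge r1.
by exists s.
Qed.

Lemma dist1_lipschitz S x y : `|dist1 S x - dist1 S y| <= `|x - y|.
Proof.
suff h u v : dist1 S u - dist1 S v <= `|u - v|.
  by rewrite ler_norml h andbT lerNl opprB distrC h.
rewrite lerBlDl -lerBlDr; apply: lb_le_inf; first by exists 1; left.
have le1 w : dist1 S w <= 1.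
  by apply: ge_inf; [exists 0; exact: dist1_lbound|left].
move=> _ [->|[s Ss ->]].
  by rewrite lerBlDr (le_trans (le1 _))// lerDl.
rewrite lerBlDr (le_trans (dist1_le _ Ss))// [leRHS]addrC; exact: ler_distD.
Qed.

End TruncatedDistance.

Section PartitionOfUnity.
Context {R : realType} {X : normedModType R}.

(* The supports at one level are far apart, so that a single function
   [phi n] serves a whole discrete family of members of the cover [N];
   [c n y] is the index of the member containing the piece around [y]. *)
Record partition_of_unity (k : option nat) (Omega : set X) (N : X -> set X)
    (phi : nat -> X -> R^o) (c : nat -> X -> X) (L : nat -> R) : Prop := {
  pou_Ck : forall n, Ck_on k setT (phi n);
  pou_ge0 : forall n x, 0 <= phi n x;
  pou_L_ge0 : forall n, 0 <= L n;
  pou_lip : forall n, lip_on setT (L n) (phi n);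
  pou_sum : forall x, Omega x -> exists m, \forall y \near x,
    (forall n, (m <= n)%N -> phi n y = 0) /\ \sum_(n < m) phi n y = 1;
  pou_sub : forall n x, (\forall y \near x, phi n y = 0) \/
    exists p, [/\ Omega p, N p x & \forall y \near x, c n y = p] }.

Context (k : option nat) (C : R) (C0 : 0 <= C)
  (LA : LA_balls X (R^o : normedModType R) k C).
Context (Omega : set X) (N : X -> set X).
Hypothesis openN : forall p, Omega p -> open (N p).
Hypothesis Np : forall p, Omega p -> N p p.

Let eps n : R := 2^-1 ^+ n.
Let eps_gt0 n : 0 < eps n. Proof. by rewrite exprn_gt0. Qed.
Let eps_le1 n : eps n <= 1.
Proof. by rewrite exprn_ile1// invf_le1// ler1n. Qed.

(* [own x] is the least p, in a well-order of X, with x in N p (Stone). *)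
Let owner_exists : exists own : X -> X,
  (forall x, Omega x -> Omega (own x) /\ N (own x) x) /\
  forall x y, Omega x -> Omega y -> N (own x) y -> N (own y) x -> own x = own y.
Proof.
have [W Wwo] := well_ordering_principle X.
pose A x : {pred X} := fun p => `[< Omega p /\ N p x >].
have minA x : exists p, Omega x -> minimum_of W (A x) p.
  have [Ox|nOx] := pselect (Omega x); last by exists 0.
  have [|p [pmin _]] := Wwo (A x); last by exists p.
  by exists x; apply/asboolP; split=> //; exact: Np.
pose own x := sval (cid (minA x)).
have ownP x : Omega x -> minimum_of W (A x) (own x) by exact: (svalP (cid (minA x))).
exists own; split=> [x /ownP[/asboolP]//|x y Ox Oy Nxy Nyx].
have [/asboolP[Opx Npx] minx] := ownP _ Ox.
have [/asboolP[Opy Npy] miny] := ownP _ Oy.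
(* Both owners belong to A x and to A y, hence each is the least element of the intersection. *)
pose B : {pred X} := fun p => (p \in A x) && (p \in A y).
have Bx : own x \in B by apply/andP; split; apply/asboolP.
have By : own y \in B by apply/andP; split; apply/asboolP.
have [|z [_ uz]] := Wwo B; first by exists (own x).
have <- : z = own x by apply: uz; split=> // p /andP[/minx].
by apply: uz; split=> // p /andP[_ /miny].
Qed.

Let own := sval (cid owner_exists).
Let ownP x : Omega x -> Omega (own x) /\ N (own x) x.
Proof. exact: (svalP (cid owner_exists)).1. Qed.
Let own_eq x y : Omega x -> Omega y -> N (own x) y -> N (own y) x -> own x = own y.
Proof. exact: (svalP (cid owner_exists)).2. Qed.

(** The norm condition confines the piece to a ball, where (LA_k) applies; the last condition keeps
    points of one level with different owners at least eps n apart. *)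
Let S n : set X := [set x | [/\ Omega x, `|x| <= n%:R &
  forall y, `|y - x| < eps n -> N (own x) y]].

Let S_sep n x y : S n x -> S n y -> `|x - y| < eps n -> own x = own y.
Proof.
move=> [Ox _ Nx] [Oy _ Ny] xy; apply: own_eq => //; last exact: Ny.
by apply: Nx; rewrite distrC.
Qed.

Let S_cover x : Omega x -> exists n, S n x.
Proof.
move=> Ox; have [Op Nx] := ownP Ox.
have [d d0 dP] := (openP_norm (N (own x))).1 (openN Op) _ Nx.
pose n := maxn (Num.truncn `|x|).+1 (Num.truncn d^-1).+1.
exists n; split=> //.
  rewrite ltW// (lt_le_trans (truncnS_gt _))// ler_nat; exact: leq_maxl.
move=> y yx; apply: dP; apply: (lt_le_trans yx).
rewrite /eps exprVn invf_ple ?posrE ?exprn_gt0//.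
rewrite (@le_trans _ _ n%:R)//.
  by rewrite ltW// (lt_le_trans (truncnS_gt _))// ler_nat leq_maxr.
by rewrite -natrX ler_nat ltnW// ltn_expl.
Qed.

Let u n : X -> R^o := dist1 (S n).

Let approx_exists n : exists q : X -> R^o,
  [/\ lip_on (ball 0 (n.+3%:R)) (C * 1) q, Ck_on k (ball 0 (n.+3%:R)) q &
      forall x, ball 0 (n.+3%:R) x -> `|u n x - q x| <= eps n / 16].
Proof.
apply: LA => //; first by rewrite divr_gt0.
by move=> x y _ _; rewrite mul1r; exact: dist1_lipschitz.
Qed.

Let q n := sval (cid (approx_exists n)).
Let q_lip n : lip_on (ball 0 (n.+3%:R)) C (q n).
Proof. by rewrite -[C]mulr1; case: (svalP (cid (approx_exists n))). Qed.
Let q_Ck n : Ck_on k (ball 0 (n.+3%:R)) (q n).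
Proof. by case: (svalP (cid (approx_exists n))). Qed.
Let q_near n x : `|x| < n.+3%:R -> `|u n x - q n x| <= eps n / 16.
Proof.
move=> xn; have [_ _] := svalP (cid (approx_exists n)); apply.
by rewrite -ball_normE /= sub0r normrN.
Qed.

(** [cutoff] is 1 below q = eps/8 and 0 above q = eps/4; as q is within eps/16 of u inside radius n
    + 3, there psi is 1 for u <= eps/16 and 0 for u > 5 eps/16. The nonzero values lie within radius
    n + 1, so the extension by 0 is smooth. *)
Let psi n : X -> R^o :=
  fun x => if `|x| < n.+3%:R then cutoff (8 / eps n * q n x) else 0.

Let psi_ge0 n x : 0 <= psi n x.
Proof. by rewrite /psi; case: ifP => // _; exact: cutoff_ge0. Qed.
Let psi_le1 n x : psi n x <= 1.
Proof. by rewrite /psi; case: ifP => // _; exact: cutoff_le1. Qed.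

Let psi_neq0 n x : psi n x != 0 -> u n x <= eps n * (5 / 16).
Proof.
rewrite /psi; case: ifP => [xn c0|_]; last by rewrite eqxx.
have : 8 / eps n * q n x < 2.
  by rewrite ltNge; apply: contra c0 => /cutoff_eq0 ->.
rewrite -mulrA mulrCA -ltr_pdivlMl ?invr_gt0// invrK => h.
have := q_near xn; rewrite ler_norml => /andP[_].
rewrite lerBlDr => /le_trans; apply.
by move: h (eps_gt0 n); move: (eps n) => e; lra.
Qed.

Let psi_neq0_near n x : psi n x != 0 -> exists2 s, S n s & `|x - s| < eps n * (3 / 8).
Proof.
move=> /psi_neq0 h; apply: dist1_lt.
  by move: (eps_le1 n); lra.
by apply: (le_lt_trans h); move: (eps_gt0 n); lra.
Qed.

Let psi_neq0_norm n x : psi n x != 0 -> `|x| <= n.+1%:R.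
Proof.
move=> /psi_neq0_near[s [_ sn _] xs].
rewrite -[x](subrK s) (le_trans (ler_normD _ _))// -natr1 addrC lerD//.
by rewrite ltW// (lt_le_trans xs)//; move: (eps_le1 n); lra.
Qed.

Let psi_eq1 n s x : S n s -> `|x - s| <= eps n / 16 -> psi n x = 1.
Proof.
move=> Ss xs; have [_ sn _] := Ss.
have e1 := eps_le1 n.
have xn : `|x| < n.+3%:R.
  rewrite -[x](subrK s) (le_lt_trans (ler_normD _ _))// addrC.
  have : n.+3%:R = n%:R + 3 :> R by rewrite -natrD addn3.
  by move: xs sn; move: (`|s|) (`|x - s|) => a b; lra.
rewrite /psi xn cutoff_eq1//.
rewrite -mulrA mulrCA ler_pdivrMl// mulr1.
have := q_near xn; rewrite distrC ler_norml => /andP[_].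
have : u n x <= eps n / 16 by apply: le_trans xs; exact: dist1_le.
by move: (eps n) (u n x) (q n x) => e ? ?; lra.
Qed.

Let psi_Ck n : Ck_on k setT (psi n).
Proof.
apply: Ck_on_local => x _; have [xn|xn] := ltP `|x| n.+2%:R.
  exists (ball 0 n.+3%:R); split; first exact: ball_open.
    by rewrite -ball_normE /= sub0r normrN (lt_trans xn)// ltr_nat.
  apply: (@Ck_on_eq _ _ _ _ _ (fun x => cutoff ((8 / eps n : R^o) *: q n x))).
  - exact: ball_open.
  - by move=> y; rewrite -ball_normE /= sub0r normrN /psi => ->.
  - apply: Ck_on_cutoff; apply: (@Ck_on_scale _ _ _ _ _ (fun=> 8 / eps n)) => //.
    exact: Ck_on_const.
exists [set y | n.+1%:R < `|y|]; split.
- apply/openP_norm => y /= ny; exists (`|y| - n.+1%:R); first by rewrite subr_gt0.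
  move=> z zy; rewrite -ltrN2 -(ltrD2l `|y|) (le_lt_trans _ zy)//.
  by rewrite distrC lerB_dist.
- by rewrite /= (lt_le_trans _ xn)// ltr_nat.
- apply: (@Ck_on_eq _ _ _ _ _ (fun=> 0)); last exact: Ck_on_const.
    apply/openP_norm => y /= ny; exists (`|y| - n.+1%:R); first by rewrite subr_gt0.
    move=> z zy; rewrite -ltrN2 -(ltrD2l `|y|) (le_lt_trans _ zy)//.
    by rewrite distrC lerB_dist.
  move=> y /= ny; apply/esym/eqP/negPn/negP => /psi_neq0_norm.
  by rewrite leNgt ny.
Qed.

Let psi_lip_exists n : exists2 L : R, 0 <= L & lip_on setT L (psi n).
Proof.
have [A A0 AP] := @cutoff_lipschitz R.
have K0 : 0 <= A * (8 / eps n * C) by rewrite !mulr_ge0// invr_ge0 ltW.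
exists (A * (8 / eps n * C) + 1); first exact: addr_ge0.
(* The cut at radius n + 3 is harmless: if psi n y is nonzero then |y| <= n + 1, so |x - y| >= 2
   while psi n y <= 1. *)
have out x y : ~~ (`|x| < n.+3%:R) -> `|psi n x - psi n y| <= 1 * `|x - y|.
  move=> xn; have -> : psi n x = 0 by rewrite /psi (negbTE xn).
  rewrite sub0r normrN mul1r; have [->|y0] := eqVneq (psi n y) 0; first by rewrite normr0.
  have yn := psi_neq0_norm y0.
  rewrite ger0_norm ?psi_ge0// (le_trans (psi_le1 _ _))//.
  rewrite (le_trans _ (lerB_dist _ _))//.
  move: xn yn; rewrite -leNgt -[n.+3%:R]natr1 -[n.+2%:R]natr1; lra.
move=> x y _ _; rewrite mulrDl; have [xn|xn] := boolP (`|x| < n.+3%:R); last first.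
  by rewrite (le_trans (out _ _ xn))// lerDr mulr_ge0.
have [yn|yn] := boolP (`|y| < n.+3%:R); last first.
  by rewrite distrC (distrC x) (le_trans (out _ _ yn))// lerDr mulr_ge0.
rewrite (@le_trans _ _ (A * (8 / eps n * C) * `|x - y|))// ?lerDl ?mul1r//.
rewrite /psi xn yn (le_trans (AP _ _))// -[leRHS]mulrA ler_wpM2l// -mulrBr normrM.
rewrite ger0_norm ?divr_ge0 ?(ltW (eps_gt0 n))// -[leRHS]mulrA ler_wpM2l ?divr_ge0 ?(ltW (eps_gt0 n))//.
by apply: q_lip; rewrite -ball_normE /= sub0r normrN.
Qed.

Let Lpsi n := s2val (cid2 (psi_lip_exists n)).
Let Lpsi_ge0 n : 0 <= Lpsi n. Proof. exact: (s2valP (cid2 (psi_lip_exists n))). Qed.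
Let psi_lip n : lip_on setT (Lpsi n) (psi n).
Proof. exact: (s2valP' (cid2 (psi_lip_exists n))). Qed.

(** A partition of unity without division: the products psi n * rest n telescope to the sum 1 - rest
    m, and rest m vanishes where some psi n with n < m is 1. *)
Let rest n : X -> R^o := fun x => \prod_(m < n) (1 - psi m x).

Let restS n x : rest n.+1 x = rest n x * (1 - psi n x).
Proof. exact: big_ord_recr. Qed.

Let rest_01 n x : 0 <= rest n x <= 1.
Proof.
elim: n => [|n /andP[h0 h1]]; first by rewrite /rest big_ord0 ler01 lexx.
have a0 : 0 <= 1 - psi n x by rewrite subr_ge0 psi_le1.
have a1 : 1 - psi n x <= 1 by rewrite lerBlDr lerDl psi_ge0.
by rewrite restS mulr_ge0//= -[leRHS]mulr1 ler_pM.
Qed.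

Let mul_lip (f g : X -> R^o) (a b : R) : 0 <= a -> 0 <= b ->
  (forall x, `|f x| <= 1) -> (forall x, `|g x| <= 1) ->
  lip_on setT a f -> lip_on setT b g -> lip_on setT (a + b) (fun x => f x * g x : R^o).
Proof.
move=> a0 b0 f1 g1 fa gb x y _ _.
have -> : f x * g x - f y * g y = (f x - f y) * g x + f y * (g x - g y).
  by rewrite mulrBl mulrBr addrA subrK.
rewrite (le_trans (ler_normD _ _))// [leRHS]mulrDl lerD// normrM.
  rewrite (le_trans (ler_piMr _ (g1 _)))//; exact: fa.
rewrite (le_trans (ler_piMl _ (f1 _)))//; exact: gb.
Qed.

Let onem_psi_lip n : lip_on setT (Lpsi n) (fun x => 1 - psi n x : R^o).
Proof.
move=> x y _ _; rewrite opprB addrC addrA subrK distrC; exact: psi_lip.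
Qed.

Let rest_lip n : lip_on setT (\sum_(m < n) Lpsi m) (rest n).
Proof.
elim: n => [|n IH].
  by move=> x y _ _; rewrite /rest !big_ord0 subrr normr0 mul0r.
have -> : rest n.+1 = (fun x => rest n x * (1 - psi n x)).
  by apply/funext => x; exact: restS.
rewrite big_ord_recr /=; apply: mul_lip => //.
- exact: sumr_ge0.
- by move=> x; have /andP[h0 h1] := rest_01 n x; rewrite ger0_norm.
- by move=> x; rewrite ger0_norm ?subr_ge0 ?psi_le1// lerBlDr lerDl psi_ge0.
Qed.

Let rest_Ck n : Ck_on k setT (rest n).
Proof.
elim: n => [|n IH].
  have -> : rest 0 = (fun=> 1) by apply/funext => x; rewrite /rest big_ord0.
  exact: Ck_on_const.
have -> : rest n.+1 = (fun x => rest n x *: (1 + (-1 : R^o) *: psi n x)).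
  by apply/funext => x; rewrite restS scaleN1r.
apply: (@Ck_on_scale _ _ k R^o setT (rest n)) => //.
apply: (@Ck_on_add _ _ k R^o setT (fun=> 1) (fun x => (-1 : R^o) *: psi n x)).
  exact: Ck_on_const.
by apply: (@Ck_on_scale _ _ _ _ _ (fun=> -1)) => //; exact: Ck_on_const.
Qed.

Let phi n : X -> R^o := fun x => psi n x * rest n x.

Let sum_phi m x : \sum_(n < m) phi n x = 1 - rest m x.
Proof.
elim: m => [|m IH]; first by rewrite /rest !big_ord0 subrr.
by rewrite big_ord_recr /= IH restS /phi; ring.
Qed.

(** Any s of level n within eps/2 gives the same owner, since two such points are less than eps
    apart; 0 is a default. *)
Let c n x : X := if pselect (exists2 s, S n s & `|x - s| < eps n / 2) is left h
  then own (s2val (cid2 h)) else 0.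

Let cE n s x : S n s -> `|x - s| < eps n / 2 -> c n x = own s.
Proof.
move=> Ss xs; rewrite /c; case: pselect => [h|]; last by case; exists s.
case: (cid2 h) => s' /= Ss' xs'; apply: (S_sep Ss' Ss).
rewrite -[s'](subrK x) -addrA (le_lt_trans (ler_normD _ _))// distrC.
by rewrite [eps n]splitr ltrD.
Qed.

Lemma partition_of_unity_exists :
  exists (phi : nat -> X -> R^o) (c : nat -> X -> X) (L : nat -> R),
    partition_of_unity k Omega N phi c L.
Proof.
exists phi, c, (fun n => Lpsi n + \sum_(m < n) Lpsi m); split.
- by move=> n; exact: Ck_on_scale.
- by move=> n x; rewrite mulr_ge0//; case/andP: (rest_01 n x).
- by move=> n; rewrite addr_ge0// sumr_ge0.
- move=> n; apply: mul_lip => //; first exact: sumr_ge0.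
    by move=> x; rewrite ger0_norm.
  by move=> x; have /andP[h0 h1] := rest_01 n x; rewrite ger0_norm.
- move=> x /S_cover[n Sx]; exists n.+1; apply/near_normP.
  exists (eps n / 16); first by rewrite divr_gt0.
  move=> y /ltW /(psi_eq1 Sx) py.
  have r0 m : (n < m)%N -> rest m y = 0.
    by move=> nm; rewrite /rest (bigD1 (Ordinal nm))//= py subrr mul0r.
  split=> [m /r0 rm|]; first by rewrite /phi rm mulr0.
  by rewrite sum_phi r0// subr0.
(* At the threshold 3/8 both margins fit: below it [c n] is constant within eps/8, as 3/8 + 1/8 =
   1/2; above it [phi n] vanishes within eps/16, as 3/8 - 1/16 = 5/16. *)
- move=> n x; have [h|h] := ltP (u n x) (eps n * (3 / 8)); [right|left].
    have [|s Ss xs] := dist1_lt _ h; first by move: (eps_le1 n); lra.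
    have [Os sn Ns] := Ss.
    exists (own s); split; first by case: (ownP Os).
      by apply: Ns; apply: (lt_trans xs); move: (eps_gt0 n); lra.
    apply/near_normP; exists (eps n / 8); first by rewrite divr_gt0.
    move=> y yx; apply: cE => //; rewrite -[y](subrK x) -addrA.
    rewrite (le_lt_trans (ler_normD _ _))//.
    by move: xs yx; move: (`|x - s|) (`|y - x|) => a b; lra.
  apply/near_normP; exists (eps n / 16); first by rewrite divr_gt0.
  move=> y yx; rewrite /phi; have [->|/psi_neq0 uy] := eqVneq (psi n y) 0.
    by rewrite mul0r.
  have := dist1_lipschitz (S n) x y; rewrite distrC in yx.
  move=> /(le_trans (ler_norm _)); rewrite -!/(u n _).
  by move: yx h uy; move: (`|x - y|) => a; lra.
Qed.

End PartitionOfUnity.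

(** * Local Lipschitz estimates *)

Section LipschitzNear.
Context {R : realType}.
Implicit Types X Y Z : normedModType R.

Definition lip_near X Y (x : X) (L : R) (f : X -> Y) : Prop :=
  exists2 r : R, 0 < r & lip_on (ball x r) L f.

Lemma lip_on_sub X Y (S S' : set X) (L : R) (f : X -> Y) :
  S' `<=` S -> lip_on S L f -> lip_on S' L f.
Proof. by move=> sub fL x y Sx Sy; apply: fL; exact: sub. Qed.

Lemma lip_on_le X Y (S : set X) (L L' : R) (f : X -> Y) :
  L <= L' -> lip_on S L f -> lip_on S L' f.
Proof. by move=> LL fL x y Sx Sy; rewrite (le_trans (fL _ _ Sx Sy))// ler_wpM2r. Qed.

Lemma lip_near_le X Y (x : X) (L L' : R) (f : X -> Y) :
  L <= L' -> lip_near x L f -> lip_near x L' f.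
Proof. by move=> LL [r r0 fL]; exists r => //; exact: lip_on_le fL. Qed.

Lemma lip_nearP X Y (x : X) (L : R) (f : X -> Y) (P : X -> Prop) :
  lip_near x L f -> (\forall y \near x, P y) ->
  exists r : R, [/\ 0 < r, lip_on (ball x r) L f & ball x r `<=` P].
Proof.
move=> [r r0 fL] /near_normP[d d0 dP].
exists (Num.min r d); split; first by rewrite lt_min r0.
  by apply: lip_on_sub fL; apply: le_ball; rewrite ge_min lexx.
by move=> y; rewrite -ball_normE /= lt_min distrC => /andP[_ /dP].
Qed.

Lemma lip_near_eq X Y (x : X) (L : R) (f g : X -> Y) :
  (\forall y \near x, f y = g y) -> lip_near x L f -> lip_near x L g.
Proof.
move=> fg fL; have [r [r0 {}fL rP]] := lip_nearP fL fg.
by exists r => // y z yr zr; rewrite -!rP//; exact: fL.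
Qed.

Lemma lip_near_cst X Y (x : X) (y : Y) : lip_near x 0 (fun=> y).
Proof. by exists 1 => // u v _ _; rewrite subrr normr0 mul0r. Qed.

Lemma lip_near_both X Y Z (x : X) (L L' : R) (f : X -> Y) (g : X -> Z) :
  lip_near x L f -> lip_near x L' g ->
  exists2 r : R, 0 < r & lip_on (ball x r) L f /\ lip_on (ball x r) L' g.
Proof.
move=> [r r0 fL] [r' r'0 gL]; exists (Num.min r r'); first by rewrite lt_min r0.
split; [apply: lip_on_sub fL|apply: lip_on_sub gL]; apply: le_ball.
  by rewrite ge_min lexx.
by rewrite ge_min lexx orbT.
Qed.

Lemma lip_near_add X Y (x : X) (L L' : R) (f g : X -> Y) :
  lip_near x L f -> lip_near x L' g -> lip_near x (L + L') (fun z => f z + g z).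
Proof.
move=> fL gL; have [r r0 [{}fL {}gL]] := lip_near_both fL gL.
exists r => // y z yr zr; rewrite opprD addrACA (le_trans (ler_normD _ _))//.
by rewrite mulrDl lerD// ?fL ?gL.
Qed.

Lemma lip_near_sum X Y (x : X) a b (L : nat -> R) (f : nat -> X -> Y) :
  (forall n, (a <= n < b)%N -> lip_near x (L n) (f n)) ->
  lip_near x (\sum_(a <= n < b) L n) (fun z => \sum_(a <= n < b) f n z).
Proof.
elim: b => [|b IH] fL.
  rewrite big_geq//; apply: lip_near_eq (lip_near_cst x 0).
  by apply: nearW => y; rewrite big_geq.
have [ab|ba] := leqP a b; last first.
  rewrite big_geq//; apply: lip_near_eq (lip_near_cst x 0).
  by apply: nearW => y; rewrite big_geq.
rewrite big_nat_recr//=.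
have -> : (fun z => \sum_(a <= n < b.+1) f n z) =
    (fun z => \sum_(a <= n < b) f n z + f b z).
  by apply/funext => z; rewrite big_nat_recr.
apply: lip_near_add; last by apply: fL; rewrite ab ltnSn.
by apply: IH => n /andP[an nb]; apply: fL; rewrite an ltnS ltnW.
Qed.

Lemma lip_near_scale X Y (x : X) (L L' M M' : R) (s : X -> R^o) (f : X -> Y) :
  0 <= L -> 0 <= L' ->
  (\forall y \near x, `|s y| <= M) -> (\forall y \near x, `|f y| <= M') ->
  lip_near x L s -> lip_near x L' f ->
  lip_near x (L * M' + M * L') (fun z => s z *: f z).
Proof.
move=> L0 L'0 sM fM sL fL.
have [r [r0 {}sL rs]] := lip_nearP sL sM.
have [r' [r'0 {}fL rf]] := lip_nearP fL fM.
have sL' : lip_near x L s by exists r.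
have fL' : lip_near x L' f by exists r'.
have [d d0 dP] : exists2 d : R, 0 < d & forall y, ball x d y -> ball x r y /\ ball x r' y.
  exists (Num.min r r'); first by rewrite lt_min r0.
  by move=> y; rewrite -!ball_normE /= lt_min => /andP.
exists d => // y z /dP[yr yr'] /dP[zr zr'].
have -> : s y *: f y - s z *: f z = (s y - s z) *: f y + s z *: (f y - f z).
  by rewrite scalerBl scalerBr addrA subrK.
rewrite (le_trans (ler_normD _ _))// mulrDl lerD// normrZ.
  by rewrite mulrAC ler_pM ?rf ?sL.
by rewrite -mulrA ler_pM ?rs ?fL.
Qed.

Lemma continuous_near_le X (e : X -> R^o) (x : X) (a : R) :
  {for x, continuous e} -> e x < a -> \forall y \near x, e y < a.
Proof.
move=> /continuous_normP ce ea; have d0 : 0 < (a - e x) / 2 by rewrite divr_gt0// subr_gt0.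
apply/near_normP; have [d dpos dP] := ce _ d0; exists d => // y /dP.
by rewrite ler_norml => /andP[_]; lra.
Qed.

Lemma continuous_near_ge X (e : X -> R^o) (x : X) (a : R) :
  {for x, continuous e} -> a < e x -> \forall y \near x, a < e y.
Proof.
move=> /continuous_normP ce ea; have d0 : 0 < (e x - a) / 2 by rewrite divr_gt0// subr_gt0.
apply/near_normP; have [d dpos dP] := ce _ d0; exists d => // y /dP.
by rewrite ler_norml => /andP[+ _]; lra.
Qed.

Lemma lip_near_continuous X Y (x : X) (L : R) (f : X -> Y) :
  lip_near x L f -> {for x, continuous f}.
Proof.
move=> [r r0 fL]; apply/continuous_normP => e e0.
have L0 : 0 < `|L| + 1 by rewrite ltr_wpDl.
exists (Num.min r (e / (`|L| + 1))); first by rewrite lt_min r0 divr_gt0.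
move=> y; rewrite lt_min ltr_pdivlMr// => /andP[yr ye].
have bx : ball x r x by exact: ballxx.
have by_ : ball x r y by rewrite -ball_normE /= distrC.
rewrite (le_trans (fL _ _ by_ bx))// (le_trans _ (ltW ye))// mulrC ler_wpM2l//.
by rewrite (le_trans (ler_norm _))// lerDl.
Qed.

Lemma lip_on_near X Y (S : set X) (L : R) (f : X -> Y) x :
  open S -> S x -> lip_on S L f -> lip_near x L f.
Proof.
move=> /openP_norm oS /oS[d d0 dP] fL; exists d => //; apply: lip_on_sub fL.
by move=> y; rewrite -ball_normE /= distrC; exact: dP.
Qed.

End LipschitzNear.

Section Glue.
Context {R : realType} {X Y : normedModType R}.

(* Junk value 0 when [phi n x] does not vanish for all large n. *)
Definition glue (phi : nat -> X -> R^o) (g : nat -> X -> Y) (x : X) : Y :=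
  if pselect (exists m, forall n, (m <= n)%N -> phi n x = 0) is left h
  then \sum_(n < sval (cid h)) phi n x *: g n x else 0.

Lemma glueE phi g x m : (forall n, (m <= n)%N -> phi n x = 0) ->
  glue phi g x = \sum_(0 <= n < m) phi n x *: g n x.
Proof.
move=> phi0; rewrite /glue; case: pselect => [h|]; last by case; exists m.
case: (cid h) => m' /= phi0'.
have ext a b : (forall n, (a <= n)%N -> phi n x = 0) -> (a <= b)%N ->
    \sum_(0 <= n < b) phi n x *: g n x = \sum_(0 <= n < a) phi n x *: g n x.
  move=> pa ab; rewrite (@big_cat_nat _ _ _ a 0 b)//=.
  rewrite (_ : \sum_(a <= n < b) _ = 0) ?addr0//.
  by rewrite big_nat big1// => n /andP[an _]; rewrite pa// scale0r.
rewrite -(big_mkord xpredT (fun n => phi n x *: g n x)).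
by have [/ext ->|/ltnW/ext ->] := leqP m m'.
Qed.

End Glue.

Section LocallyLipschitzApproximation.
Context {R : realType} {X Z : normedModType R}.

(** Constants H p are averaged over a partition subordinate to sets of small oscillation of H.
    Locally only the Lipschitz functions phi n vary, since c n is locally constant wherever phi n is
    not locally 0. *)
Lemma locally_lipschitz_approximation (k : option nat) (U : set X) (H : X -> Z) (eta : R) :
  (forall N : X -> set X, (forall p, U p -> open (N p)) -> (forall p, U p -> N p p) ->
    exists phi c L, partition_of_unity k U N phi c L) ->
  open U -> (forall x, U x -> {for x, continuous H}) -> 0 < eta ->
  exists H' : X -> Z, forall x, U x ->
    `|H' x - H x| <= eta /\ exists2 L : R, 0 <= L & lip_near x L H'.
Proof.
move=> pou oU cH eta0.
pose N p := [set z | `|H p - H z| <= eta]°.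
have [||phi [c [L pouU]]] := pou N.
- by move=> p _; exact: open_interior.
- move=> p Up; have /continuous_normP/(_ _ eta0)[d d0 dP] := cH _ Up.
  by apply/near_normP; exists d => // y /dP; rewrite /= distrC.
exists (glue phi (fun n z => H (c n z))) => x Ux.
have [m near_m] := pou_sum pouU Ux; split.
  have [phi0 phi1] := nbhs_singleton near_m.
  rewrite (glueE _ phi0) -[H x]scale1r -phi1 big_mkord scaler_suml -sumrB.
  rewrite (le_trans (ler_norm_sum _ _ _))// -[eta]mul1r -phi1 mulr_suml.
  apply: ler_sum => n _; rewrite -scalerBr normrZ ger0_norm ?(pou_ge0 pouU)//.
  have [/nbhs_singleton ->|[p [Up Npx /nbhs_singleton cp]]] := pou_sub pouU n x.
    by rewrite !mul0r.
  rewrite ler_wpM2l ?(pou_ge0 pouU)// cp; exact: (interior_subset Npx).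
(* Where phi n vanishes near x, c n need not be locally constant; such a term contributes 0. *)
pose B n := if `[< \forall y \near x, phi n y = 0 >] then 0 else L n * `|H (c n x)|.
have B0 n : 0 <= B n.
  by rewrite /B; case: ifP => // _; rewrite mulr_ge0 ?(pou_L_ge0 pouU).
exists (\sum_(0 <= n < m) B n); first exact: sumr_ge0.
apply: (@lip_near_eq _ _ _ _ _ (fun z => \sum_(0 <= n < m) phi n z *: H (c n z))).
  by apply: (filterS _ near_m) => y [phi0 _]; rewrite (glueE _ phi0).
apply: lip_near_sum => n _; rewrite /B; case: asboolP => [phi0|phiN0].
  apply: lip_near_eq (lip_near_cst x 0).
  by apply: filterS phi0 => y ->; rewrite scale0r.
have [//|[p [Up Npx cp]]] := pou_sub pouU n x.
have cx := nbhs_singleton cp; rewrite cx.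
apply: (@lip_near_eq _ _ _ _ _ (fun z => phi n z *: H p)).
  by apply: filterS cp => y ->.
exists 1 => // y z _ _; rewrite -scalerBl normrZ mulrAC ler_wpM2r//.
exact: (pou_lip pouU).
Qed.

End LocallyLipschitzApproximation.

Lemma sum_half_pow_le (R : realType) N m :
  \sum_(N <= n < m) (2^-1 ^+ n : R) <= 2 * 2^-1 ^+ N.
Proof.
have [mN|Nm] := ltnP m N; first by rewrite big_geq ?(ltnW mN)// mulr_ge0// exprn_ge0.
suff -> : \sum_(N <= n < m) (2^-1 ^+ n : R) = 2 * 2^-1 ^+ N - 2 * 2^-1 ^+ m.
  by rewrite lerBlDr lerDl mulr_ge0// exprn_ge0.
elim: m Nm => [|m IH]; first by rewrite leqn0 => /eqP ->; rewrite big_geq// subrr.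
rewrite leq_eqVlt => /predU1P[->|Nm]; first by rewrite big_geq// subrr.
by rewrite big_nat_recr//= IH// exprS; lra.
Qed.

(** * Replacing H by a map whose local Lipschitz constant times e tends to 0 *)

Section VanishingOscillation.
Context {R : realType} {X Z : normedModType R}.
Context (U : set X) (e : X -> R^o) (K : R) (H : X -> Z) (M : R).
Hypotheses (oU : open U) (K1 : 1 <= K) (eK : lip_on U K e)
  (e_ge0 : forall x, U x -> 0 <= e x) (M0 : 0 <= M)
  (HM : forall x, U x -> `|H x| <= M).
Hypothesis approx : forall eta : R, 0 < eta -> exists H' : X -> Z, forall x, U x ->
  `|H' x - H x| <= eta /\ exists2 L : R, 0 <= L & lip_near x L H'.

Let h n : R := 2^-1 ^+ n.
Let h_gt0 n : 0 < h n. Proof. by rewrite exprn_gt0. Qed.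
Let h_le1 n : h n <= 1. Proof. by rewrite exprn_ile1// invf_le1// ler1n. Qed.

Let approx_n n : exists H' : X -> Z, forall x, U x ->
  `|H' x - H x| <= h n /\ exists2 L : R, 0 <= L & lip_near x L H'.
Proof. exact: approx. Qed.

Let Hn n : X -> Z := if n is n'.+1 then sval (cid (approx_n n)) else 0.

Let Hn_near n x : U x -> `|Hn n.+1 x - H x| <= h n.+1.
Proof. by move=> /(svalP (cid (approx_n n.+1)))[]. Qed.

Let Hn_lip n x : U x -> exists2 L : R, 0 <= L & lip_near x L (Hn n).
Proof.
case: n => [|n Ux]; first by exists 0 => //; exact: lip_near_cst.
by have [] := svalP (cid (approx_n n.+1)) x Ux.
Qed.

(** The step from the initial 0 is at most M plus one error; each later step is bounded by two
    consecutive errors, hence by 2 h n. *)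
Let D : R := M + 2.
Let D0 : 0 <= D. Proof. by rewrite addr_ge0. Qed.

Let dH n x := Hn n.+1 x - Hn n x.

Let dH_le n x : U x -> `|dH n x| <= D * h n.
Proof.
move=> Ux; rewrite /dH -(subrKA (H x)) (le_trans (ler_normD _ _))//.
have := Hn_near n Ux; case: n => [|n] h1.
  rewrite [Hn 0%N x]/= subr0 [h 0]expr0 mulr1 addrC lerD ?HM//.
  by rewrite (le_trans h1)// (le_trans (h_le1 _))// ler1n.
rewrite (@le_trans _ _ (h n.+2 + h n.+1))//.
  by rewrite lerD// distrC; exact: Hn_near.
rewrite /D mulrDl; have : 0 <= M * h n.+1 by rewrite mulr_ge0// ltW.
have : h n.+2 <= h n.+1 by rewrite /h exprS ler_piMl ?exprn_ge0// invf_le1// ler1n.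
lra.
Qed.

Let dH_lip n x : U x -> exists2 L : R, 0 <= L & lip_near x L (dH n).
Proof.
move=> Ux; have [L1 L10 l1] := Hn_lip n.+1 Ux; have [L2 L20 l2] := Hn_lip n Ux.
exists (L1 + L2); first exact: addr_ge0.
apply: lip_near_add => //; case: l2 => r r0 l2; exists r => // y z yr zr.
by rewrite opprK addrC distrC; exact: l2.
Qed.

(** With r <= h n / (L + 1), a Lipschitz constant L is at most h n / r: it is expressed by the scale
    alone, with a summable weight. *)
Let rho_exists n x : exists r : R, U x ->
  [/\ 0 < r, r <= h n.+2 & lip_on (ball x r) (h n / r) (dH n)].
Proof.
have [Ux|nU] := pselect (U x); last by exists 0.
have [L L0 [r r0 dL]] := dH_lip n Ux.
have L1 : 0 < L + 1 by rewrite ltr_wpDl.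
pose r' := Num.min r (Num.min (h n.+2) (h n / (L + 1))).
have r'0 : 0 < r' by rewrite !lt_min r0 h_gt0 divr_gt0.
exists r' => _; split=> //; first by rewrite !ge_min lexx orbT.
apply: (@lip_on_le _ _ _ _ L).
  rewrite ler_pdivlMr// mulrC.
  have : r' <= h n / (L + 1) by rewrite !ge_min lexx !orbT.
  rewrite ler_pdivlMr// => h1; apply: le_trans h1.
  by rewrite ler_wpM2l ?(ltW r'0)// lerDl.
by apply: lip_on_sub dL; apply: le_ball; rewrite ge_min lexx.
Qed.

Let rho n x := sval (cid (rho_exists n x)).
Let rhoP n x : U x ->
  [/\ 0 < rho n x, rho n x <= h n.+2 & lip_on (ball x (rho n x)) (h n / rho n x) (dH n)].
Proof. exact: (svalP (cid (rho_exists n x))). Qed.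

(* [delta n] is a positive 1-Lipschitz minorant of the scale at which [dH n] is
   tame; the step from [Hn n] to [Hn n.+1] takes place where e is about [delta n],
   so that the transition function [s n] has Lipschitz constant O(1 / e). *)
Let E n z : set R := [set t | t = 0 \/ exists2 x, U x & t = rho n x - `|z - x|].
Let delta n z : R := sup (E n z).

Let E_ub n z : ubound (E n z) (h n.+2).
Proof.
move=> _ [->|[x Ux ->]]; first exact: ltW.
by have [_ r1 _] := rhoP n Ux; rewrite lerBlDr (le_trans r1)// lerDl.
Qed.

Let E_has n z : has_sup (E n z).
Proof. by split; [exists 0; left|exists (h n.+2); exact: E_ub]. Qed.

Let delta_le n z : delta n z <= h n.+2.
Proof. by apply: ge_sup; [exists 0; left|exact: E_ub]. Qed.

Let delta_ge0 n z : 0 <= delta n z.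
Proof. by apply: ub_le_sup; [case: (E_has n z)|left]. Qed.

Let delta_gt0 n z : U z -> 0 < delta n z.
Proof.
move=> Uz; have [r0 _ _] := rhoP n Uz; apply: (lt_le_trans r0).
apply: ub_le_sup; first by case: (E_has n z).
by right; exists z => //; rewrite subrr normr0 subr0.
Qed.

Let delta_lip n y z : `|delta n y - delta n z| <= 1 * `|y - z|.
Proof.
suff le u v : delta n u - delta n v <= `|u - v|.
  by rewrite mul1r ler_norml le andbT lerNl opprB distrC le.
rewrite lerBlDr; apply: ge_sup; first by exists 0; left.
move=> _ [->|[x Ux ->]]; first by rewrite addr_ge0.
rewrite -lerBlDl; apply: (@le_trans _ _ (rho n x - `|v - x|)).
  by rewrite -addrA lerD2l -opprD lerN2 [leRHS]addrC (distrC u) ler_distD.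
by apply: ub_le_sup; [case: (E_has n v)|right; exists x].
Qed.

(** Some x satisfies rho n x - |z - x| > t; then the ball of radius t about z lies in the ball where
    dH n is controlled, and rho n x > t. *)
Let delta_ball n z t : 0 < t -> t < delta n z -> lip_on (ball z t) (h n / t) (dH n).
Proof.
move=> t0 tz; have d0 : 0 < delta n z - t by rewrite subr_gt0.
have [_ [->|[x Ux ->]]] := sup_adherent d0 (E_has n z);
  rewrite -/(delta n z) opprB addrC subrK => ht.
  by move: (lt_trans ht t0); rewrite ltxx.
have [r0 _ dL] := rhoP n Ux.
apply: (@lip_on_le _ _ _ _ (h n / rho n x)).
  rewrite ler_wpM2l ?(ltW (h_gt0 n))// lef_pV2 ?posrE//.
  by rewrite ltW// (lt_le_trans ht)// lerBlDr lerDl.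
apply: lip_on_sub dL => y; rewrite -!ball_normE /= => zy.
rewrite (le_lt_trans (ler_distD z _ _))// -ltrBrDl (lt_trans zy)//.
by rewrite distrC.
Qed.

(** Equals 1 where 0 < e <= delta n and 0 where e >= 2 delta n. As a K-Lipschitz function divided by
    e, it has a Lipschitz constant of order K / e that does not involve delta n. *)
Let s n : X -> R^o := fun z => Num.max 0 (2 * Num.min (delta n z) (e z) / e z - 1).

Let s_ge0 n z : 0 <= s n z. Proof. by rewrite le_max lexx. Qed.

Let s_le1 n z : 0 < e z -> s n z <= 1.
Proof.
move=> ez; rewrite ge_max ler01/= lerBlDr ler_pdivrMr// -[1 + 1]/2 ler_pM2l//.
by rewrite ge_min lexx orbT.
Qed.

Let s_eq1 n z : 0 < e z -> e z <= delta n z -> s n z = 1.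
Proof.
move=> ez ed; rewrite /s min_r// mulfK ?gt_eqF//.
by rewrite max_r; lra.
Qed.

Let s_eq0 n z : 0 < e z -> 2 * delta n z <= e z -> s n z = 0.
Proof.
move=> ez ed; rewrite /s max_l// subr_le0 ler_pdivrMr// mul1r (le_trans _ ed)//.
by rewrite ler_pM2l// ge_min lexx.
Qed.

Let e_cont z : U z -> {for z, continuous e}.
Proof. by move=> Uz; exact: lip_near_continuous (lip_on_near oU Uz eK). Qed.

Let near_U z : U z -> \forall w \near z, U w.
Proof. by move=> Uz; exact: open_nbhs_nbhs. Qed.

Let min_lip n : lip_on U K (fun z => Num.min (delta n z) (e z) : R^o).
Proof.
move=> y z Uy Uz; have := eK Uy Uz; have := delta_lip n y z.
have : 1 * `|y - z| <= K * `|y - z| by rewrite ler_wpM2r.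
move: (K * _) (1 * _) => a b ba.
rewrite !ler_norml => /andP[d1 d2] /andP[e1 e2].
by case: (leP (delta n y) (e y)) => ?; case: (leP (delta n z) (e z)) => ?; apply/andP; split; lra.
Qed.

(** The factor 8 is 2 from the definition, 2 from the two terms of the quotient rule, and 2 from 1 /
    e(y) <= 2 / e(z) near z. *)
Let s_lip n z : U z -> 0 < e z -> lip_near z (8 * K / e z) (s n).
Proof.
move=> Uz ez; have ez2 : e z / 2 < e z by rewrite ltr_pdivrMr// ltr_pMr// ltr1n.
have ngt := continuous_near_ge (e_cont Uz) ez2.
have /near_normP[r r0 rP] : \forall w \near z, U w /\ e z / 2 < e w.
  by apply: filterI => //; exact: near_U.
exists r => // y w; rewrite -!ball_normE /= ![`|z - _|]distrC => /rP[Uy ey] /rP[Uw ew].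
have ez20 : 0 < e z / 2 by rewrite divr_gt0.
have ey0 := lt_trans ez20 ey; have ew0 := lt_trans ez20 ew.
set my := Num.min (delta n y) (e y); set mw := Num.min (delta n w) (e w).
have max_le (a b : R) : `|Num.max 0 a - Num.max 0 b| <= `|a - b|.
  rewrite /Num.max; case: ifP => a0; case: ifP => b0.
  - by [].
  - by rewrite subr0 !ger0_norm ?subr_ge0 ?lerDl; lra.
  - by rewrite sub0r normrN; rewrite gtr0_norm// distrC (le_trans _ (ler_norm _))//; lra.
  - by rewrite subrr normr0.
rewrite (le_trans (max_le _ _))// opprB addrA subrK.
have -> : 2 * my / e y - 2 * mw / e w = 2 * ((my - mw) / e y + mw / e w * ((e w - e y) / e y)).
  by field; rewrite !gt_eqF.
have mw1 : 0 <= mw / e w <= 1.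
  rewrite divr_ge0 ?(ltW ew0) ?le_min ?delta_ge0 ?(ltW ew0)//=.
  by rewrite ler_pdivrMr// mul1r ge_min lexx orbT.
have A : `|(my - mw) / e y| <= K * `|y - w| / e y.
  by rewrite normrM normfV (gtr0_norm ey0) ler_pM2r ?invr_gt0//; exact: min_lip.
have B : `|mw / e w * ((e w - e y) / e y)| <= K * `|y - w| / e y.
  rewrite normrM -[leRHS]mul1r ler_pM//.
    by rewrite ger0_norm; case/andP: mw1.
  by rewrite normrM normfV (gtr0_norm ey0) ler_pM2r ?invr_gt0// distrC; exact: eK.
rewrite normrM ger0_norm// (@le_trans _ _ (2 * (K * `|y - w| / e y + K * `|y - w| / e y)))//.
  by rewrite ler_wpM2l// (le_trans (ler_normD _ _))// lerD.
have C : (e y)^-1 <= 2 / e z.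
  by rewrite -[2 / e z]invf_div lef_pV2 ?posrE// ltW.
have K0 : 0 <= K * `|y - w| by rewrite mulr_ge0// (le_trans ler01).
have -> : 8 * K / e z * `|y - w| = 4 * (K * `|y - w| * (2 / e z)) by field; rewrite gt_eqF.
have : K * `|y - w| / e y <= K * `|y - w| * (2 / e z) by rewrite ler_wpM2l.
by move: (_ / e y) (_ * (2 / e z)) => a b; lra.
Qed.

(** 4 comes from the Lipschitz constant of dH n on a ball of radius e/4, and 8 K D from the
    variation of s n times |dH n|. *)
Let B : R := 4 + 8 * K * D.
Let B0 : 0 <= B.
Proof. by rewrite addr_ge0// !mulr_ge0// (le_trans ler01). Qed.

Let pos_near z : U z -> 0 < e z -> \forall w \near z, U w /\ 0 < e w.
Proof.
move=> Uz ez; apply: filterI; first exact: near_U.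
exact: continuous_near_ge (e_cont Uz) ez.
Qed.

Let term_lip n z : U z -> 0 < e z ->
  lip_near z (B * h n / e z) (fun w => s n w *: dH n w).
Proof.
move=> Uz ez; have ez4 : 0 < e z / 4 by rewrite divr_gt0.
(* If delta n z > e z / 4, dH n is tame on the ball of radius e z / 4. Otherwise, near z, delta n
   stays below 3/8 e z while e exceeds 3/4 e z, so s n vanishes there. *)
have [dz|dz] := ltP (e z / 4) (delta n z).
  have dL : lip_near z (4 * h n / e z) (dH n).
    exists (e z / 4) => //; apply: lip_on_le (delta_ball ez4 dz).
    by rewrite invf_div mulrA [h n * 4]mulrC.
  have sM : \forall w \near z, `|s n w| <= 1.
    by apply: filterS (pos_near Uz ez) => w [Uw ew]; rewrite ger0_norm ?s_le1.
  have dM : \forall w \near z, `|dH n w| <= D * h n.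
    by apply: filterS (near_U Uz) => w; exact: dH_le.
  have K0 : 0 <= 8 * K / e z by rewrite divr_ge0 ?(ltW ez)// mulr_ge0// (le_trans ler01).
  have h0 : 0 <= 4 * h n / e z by rewrite divr_ge0 ?(ltW ez)// mulr_ge0// ltW.
  apply: lip_near_le (lip_near_scale K0 h0 sM dM (s_lip n Uz ez) dL).
  by rewrite le_eqVlt; apply/orP; left; apply/eqP; rewrite /B; field; rewrite gt_eqF.
apply: (@lip_near_le _ _ _ _ 0); first by rewrite divr_ge0 ?(ltW ez)// mulr_ge0// ltW.
apply: lip_near_eq (lip_near_cst z 0).
have e2 : e z / 2 + e z / 4 < e z by move: ez; lra.
have ng : \forall w \near z, 3 / 4 * e z < e w.
  by apply: (continuous_near_ge (e_cont Uz)); move: ez; lra.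
have nd : \forall w \near z, delta n w < 3 / 8 * e z.
  apply/near_normP; exists (e z / 8); first by rewrite divr_gt0.
  move=> w wz; have := delta_lip n w z; rewrite mul1r => /(le_trans (ler_norm _)).
  by move: dz wz; move: `|w - z| => a; lra.
have npos := pos_near Uz ez; near=> w.
rewrite s_eq0 ?scale0r//; first by near: w; apply: filterS npos => w [].
have : 3 / 4 * e z < e w by near: w.
have : delta n w < 3 / 8 * e z by near: w.
lra.
Unshelve. all: by end_near. Qed.

(** [glue] serves here as a locally finite sum of the steps; the s n do not add up to 1. Where the
    first N of them equal 1, the sum telescopes to H_N plus a tail. *)
Let Ht : X -> Z := glue s dH.

Let s_eventually_0 z : U z -> 0 < e z -> exists m, \forall w \near z,
  forall n, (m <= n)%N -> s n w = 0.
Proof.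
move=> Uz ez; have ez2 : e z / 2 < e z by rewrite ltr_pdivrMr// ltr_pMr// ltr1n.
have /near_normP[r r0 rP] := continuous_near_ge (e_cont Uz) ez2.
exists (Num.truncn (e z)^-1).+1; apply/near_normP; exists r => // w /rP ew n mn.
have ew0 : 0 < e w by apply: lt_trans ew; rewrite divr_gt0.
apply: s_eq0 => //; apply: (le_trans _ (ltW ew)).
have hn : h n <= e z.
  rewrite /h exprVn invf_ple ?posrE ?exprn_gt0//.
  apply: (@le_trans _ _ n%:R); last by rewrite -natrX ler_nat ltnW// ltn_expl.
  by rewrite ltW// (lt_le_trans (truncnS_gt _))// ler_nat.
rewrite (@le_trans _ _ (2 * h n.+2))//; first by rewrite ler_pM2l.
by move: hn; rewrite /h !exprS; lra.
Qed.

Lemma vanishing_oscillation_extension : exists (Ht : X -> Z) (B : R),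
  [/\ 0 <= B,
    forall z, U z -> 0 < e z -> `|Ht z| <= B /\ lip_near z (B / e z) Ht &
    forall x, U x -> e x = 0 -> forall eta : R, 0 < eta ->
      \forall z \near x, U z -> 0 < e z ->
        `|Ht z - H z| <= eta /\ lip_near z (eta / e z) Ht].
Proof.
exists Ht, (2 * D + 2 * B); split; first by rewrite addr_ge0// mulr_ge0.
  move=> z Uz ez; have [m near_m] := s_eventually_0 Uz ez; split.
    rewrite /Ht (glueE _ (nbhs_singleton near_m)) (le_trans (ler_norm_sum _ _ _))//.
    apply: (@le_trans _ _ (\sum_(0 <= n < m) D * h n)).
      apply: ler_sum => n _; rewrite normrZ ger0_norm// -[leRHS]mul1r.
      by rewrite ler_pM ?s_le1 ?dH_le.
    rewrite -mulr_sumr (@le_trans _ _ (2 * D))// ?lerDl ?mulr_ge0//.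
    by rewrite [leRHS]mulrC ler_wpM2l// (le_trans (sum_half_pow_le _ _ _))// expr0 mulr1.
  apply: (@lip_near_eq _ _ _ _ _ (fun w => \sum_(0 <= n < m) s n w *: dH n w)).
    by apply: (filterS _ near_m) => w s0; rewrite /Ht (glueE _ s0).
  apply: lip_near_le (lip_near_sum (fun n _ => term_lip n Uz ez)).
  rewrite -mulr_suml ler_pM2r ?invr_gt0// -mulr_sumr.
  apply: (@le_trans _ _ (2 * B)); last by rewrite lerDr mulr_ge0.
  by rewrite [leRHS]mulrC ler_wpM2l// (le_trans (sum_half_pow_le _ _ _))// expr0 mulr1.
move=> x Ux ex eta eta0.
have DB0 : 0 < 2 * D + 2 * B + 2 by rewrite ltr_wpDl// addr_ge0// mulr_ge0.
(* 2 D h N bounds the tail, 2 B h N / e its Lipschitz constant, and h N the error of H_N; half of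
   eta covers these, and L e < eta / 2 handles the variation of H_N. As a successor, N avoids the
   zero map at the start of the sequence. *)
pose N := (Num.truncn ((2 * D + 2 * B + 2) / eta * 2)).+1.
have hN : (2 * D + 2 * B + 2) * h N <= eta / 2.
  rewrite -ler_pdivlMl// /h exprVn.
  rewrite -[leRHS]invrK lef_pV2 ?posrE ?invr_gt0 ?mulr_gt0 ?invr_gt0 ?exprn_gt0//.
  apply: (@le_trans _ _ N%:R); last by rewrite -natrX ler_nat ltnW// ltn_expl.
  rewrite ltW// (le_lt_trans _ (truncnS_gt _))//.
  by rewrite le_eqVlt; apply/orP; left; apply/eqP; field; rewrite !gt_eqF.
have [L L0 [r r0 HL]] := Hn_lip N Ux.
have near1 : \forall z \near x, forall i : 'I_N, e z < delta i z.
  apply: filter_forall => i; have d0 := delta_gt0 i Ux.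
  have ne : \forall z \near x, e z < delta i x / 2.
    by apply: (continuous_near_le (e_cont Ux)); rewrite ex divr_gt0.
  have nd : \forall z \near x, delta i x / 2 < delta i z.
    apply/near_normP; exists (delta i x / 2); first by rewrite divr_gt0.
    move=> w wx; have := delta_lip i x w; rewrite distrC in wx.
    rewrite mul1r => /(le_trans (ler_norm _)).
    by move: wx; move: `|x - w| => a; lra.
  by apply: filterS2 ne nd => z; exact: lt_trans.
have near2 : \forall z \near x, L * e z < eta / 2.
  have eL : e x < eta / 2 / (L + 1) by rewrite ex !divr_gt0// ltr_wpDl.
  apply: filterS2 (near_U Ux) (continuous_near_le (e_cont Ux) eL) => z Uz.
  rewrite ltr_pdivlMr ?ltr_wpDl// => /(le_lt_trans _); apply.
  by rewrite mulrDr mulr1 mulrC lerDl e_ge0.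
have near3 : \forall z \near x, `|z - x| < r.
  by apply/near_normP; exists r.
near=> z => Uz ez.
have zr : `|z - x| < r by near: z.
have zL : L * e z < eta / 2 by near: z.
have zd : forall i : 'I_N, e z < delta i z by near: z.
have HNL : lip_near z L (Hn N).
  apply: lip_on_near HL; first exact: ball_open.
  by rewrite -ball_normE /= distrC.
have [m0 near_m0] := s_eventually_0 Uz ez.
pose m := maxn m0 N; have Nm : (N <= m)%N by exact: leq_maxr.
have near_m : \forall w \near z, forall n, (m <= n)%N -> s n w = 0.
  apply: (filterS _ near_m0) => w s0 n mn; apply: s0.
  by rewrite (leq_trans _ mn)// leq_maxl.
have near_s : \forall w \near z, forall i : 'I_N, s i w = 1.
  apply: filter_forall => i.
  have lip2 : {for z, continuous (fun w => delta i w - e w : R^o)}.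
    have d1 : lip_near z 1 (delta i : X -> R^o).
      by exists 1 => // y w _ _; exact: delta_lip.
    apply: (@continuousB _ R^o _ (delta i) e); first exact: (lip_near_continuous d1).
    exact: e_cont.
  have de0 : 0 < delta i z - e z by rewrite subr_gt0.
  have pos := continuous_near_ge lip2 de0.
  have npos := pos_near Uz ez; near=> w.
  have [Uw ew] : U w /\ 0 < e w by near: w.
  apply: s_eq1 => //.
  have : 0 < delta i w - e w by near: w.
  by rewrite subr_gt0 => /ltW.
have split_near : \forall w \near z,
    Hn N w + \sum_(N <= n < m) s n w *: dH n w = Ht w.
  near=> w.
  have s0 : forall n, (m <= n)%N -> s n w = 0 by near: w.
  have s1 : forall i : 'I_N, s i w = 1 by near: w.
  rewrite /Ht (glueE _ s0) (@big_cat_nat _ _ _ N 0 m)//=; congr (_ + _).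
  rewrite big_nat; under eq_bigr => n /andP[_ nN] do rewrite (s1 (Ordinal nN)) scale1r.
  by rewrite -big_nat /dH telescope_sumr// subr0.
split.
  rewrite -(nbhs_singleton split_near) addrAC (le_trans (ler_normD _ _))//.
  have A : `|Hn N z - H z| <= h N by exact: Hn_near.
  have S : `|\sum_(N <= n < m) s n z *: dH n z| <= D * (2 * h N).
    rewrite (le_trans (ler_norm_sum _ _ _))//.
    apply: (@le_trans _ _ (\sum_(N <= n < m) D * h n)).
      apply: ler_sum => n _; rewrite normrZ ger0_norm// -[leRHS]mul1r.
      by rewrite ler_pM ?s_le1 ?dH_le.
    by rewrite -mulr_sumr ler_wpM2l// sum_half_pow_le.
  have B1 : 0 <= B * h N by rewrite mulr_ge0// ltW.
  have hN' : 2 * (D * h N) + 2 * (B * h N) + 2 * h N <= eta / 2.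
    by rewrite !mulrA -!mulrDl.
  by move: S hN' A B1 (h_gt0 N); rewrite mulrCA; lra.
apply: (lip_near_eq split_near).
apply: lip_near_le (lip_near_add HNL (lip_near_sum (fun n _ => term_lip n Uz ez))).
rewrite -mulr_suml -mulr_sumr ler_pdivlMr// mulrDl mulfVK ?gt_eqF//.
have S : B * \sum_(N <= n < m) h n <= B * (2 * h N) by rewrite ler_wpM2l// sum_half_pow_le.
have D1 : 0 <= D * h N by rewrite mulr_ge0// ltW.
have hN' : 2 * (D * h N) + 2 * (B * h N) + 2 * h N <= eta / 2.
  by rewrite !mulrA -!mulrDl.
by move: S hN' D1 (h_gt0 N) zL; rewrite [B * (2 * _)]mulrCA; lra.
Unshelve. all: by end_near. Qed.

End VanishingOscillation.

(** * Fine approximation *)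

Lemma addr_shuffle (V : zmodType) (a b c d e : V) :
  a - c - (b - e) - (d - c) = a - b - (d - e).
Proof.
rewrite (addrAC a (- c)) -[LHS]addrA -[- c - _]opprD [c + _]addrC subrK.
by rewrite !opprB !addrA (addrAC a e).
Qed.

Lemma subrACA (V : zmodType) (a b c d : V) : a - b - (c - d) = a - c - (b - d).
Proof. by rewrite !opprB addrACA [RHS]addrACA [- b + _]addrC. Qed.

Lemma increment_split (V : zmodType) (a a' p p' q q' s s' t : V) :
  a + p - (q + s) - (a' + p' - (q' + s')) =
  a - a' - (s - s') + (p - t + (t - p' - (q - q'))).
Proof.
rewrite subrACA -[t - p' - _]addrA [p - t + _]addrA subrK.
rewrite (opprD a' p') (opprD q' s') [a + p + _]addrACA [q + s + _]addrACA.
by rewrite (opprD (q - q')) [- (q - q') - _]addrC (addrA p (- p')) [LHS]addrACA.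
Qed.

Lemma taylor_split (V : zmodType) (g u b v t1 t2 : V) :
  g - b - (t1 + t2) = g - (u + v) + (u - b - t2 + (v - t1)).
Proof.
rewrite -[u - b - t2]addrA [u + _ + _]addrACA [RHS]addrA [X in _ = X + _]subrK.
by rewrite !opprD !addrA addrAC.
Qed.

Section FineApproximation.
Context {R : realType} {X Y : normedModType R}.

Definition Ck_near (k : option nat) (x : X) (f : X -> Y) : Prop :=
  exists U : set X, [/\ open U, U x & Ck_on k U f].

Lemma Ck_near_eq k x (f g : X -> Y) :
  (\forall y \near x, f y = g y) -> Ck_near k x f -> Ck_near k x g.
Proof.
move=> /near_normP[d d0 fg] [U [oU Ux CU]].
have oB : open (U `&` ball x d) by apply: openI => //; exact: ball_open.
exists (U `&` ball x d); split=> //; first by split=> //; exact: ballxx.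
apply: (Ck_on_eq oB) (Ck_on_sub (@subIsetl _ _ _) CU) => y [_].
by rewrite -ball_normE /= distrC => /fg.
Qed.

Lemma Ck_near_add k x (f g : X -> Y) :
  Ck_near k x f -> Ck_near k x g -> Ck_near k x (fun z => f z + g z).
Proof.
move=> [U [oU Ux fU]] [V [oV Vx gV]]; exists (U `&` V); split=> //.
  exact: openI.
by apply: Ck_on_add; [apply: Ck_on_sub fU|apply: Ck_on_sub gV].
Qed.

Lemma Ck_near_cst k x (y : Y) : Ck_near k x (fun=> y).
Proof. by exists setT; split=> //; [exact: openT|exact: Ck_on_const]. Qed.

Lemma Ck_near_sum k x m (f : nat -> X -> Y) :
  (forall n, Ck_near k x (f n)) -> Ck_near k x (fun z => \sum_(0 <= n < m) f n z).
Proof.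
move=> Cf; elim: m => [|m IH].
  by under eq_fun do rewrite big_geq//; exact: Ck_near_cst.
have -> : (fun z => \sum_(0 <= n < m.+1) f n z) =
    (fun z => \sum_(0 <= n < m) f n z + f m z).
  by apply/funext => z; rewrite big_nat_recr.
exact: Ck_near_add.
Qed.

Context (k : option nat) (C : R) (C0 : 0 <= C) (LA : LA_balls X Y k C).
Context (Omega : set X) (F : X -> Y) (s : X -> R) (T : X -> contlin X Y) (w eta : X -> R).
Hypotheses (oO : open Omega)
  (s0 : forall p, Omega p -> 0 < s p) (w0 : forall p, Omega p -> 0 <= w p)
  (eta0 : forall p, Omega p -> 0 < eta p)
  (FT : forall p, Omega p -> lip_on (ball p (s p)) (w p) (fun z => F z - T p z)).
Hypothesis pou : forall N : X -> set X,
  (forall p, Omega p -> open (N p)) -> (forall p, Omega p -> N p p) ->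
  exists phi c L, partition_of_unity k Omega N phi c L.

(** Near z the map is an average of T p plus a smooth correction, over indices p whose ball contains
    z. Which p occur is not known, hence the bounds over all of them. C w p bounds the derivative of
    the correction, and eta p pays for the variation of the partition functions. *)
Lemma fine_approximation : exists g : X -> Y, [/\ Ck_on k Omega g,
  forall z M, Omega z -> (forall p, Omega p -> ball p (s p) z -> eta p <= M) ->
    `|g z - F z| <= M &
  forall z (S D : contlin X Y) M M', Omega z ->
    (forall p, Omega p -> ball p (s p) z -> `|T p - S| + C * w p <= M) ->
    (forall p, Omega p -> ball p (s p) z -> eta p <= M') ->
    is_diff z g D -> `|D - S| <= M + M'].
Proof.
have [||phi [c [L P]]] := pou (N := fun p => ball p (s p)).
- by move=> p _; exact: ball_open.
- by move=> p Op; apply: ballxx; exact: s0.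
(* 1 + L n offsets the Lipschitz constant of phi n, and 2 ^ (n+1) makes the contributions of all n
   sum to at most the bound for eta. *)
pose err n p := eta p / (2 ^+ n.+1 * (1 + L n)).
have L1 n : 0 < 1 + L n by rewrite ltr_pwDl// (pou_L_ge0 P).
have err0 n p : Omega p -> 0 < err n p.
  by move=> Op; rewrite divr_gt0 ?eta0// mulr_gt0// exprn_gt0.
have gex n p : exists g : X -> Y, Omega p ->
   [/\ lip_on (ball p (s p)) (C * w p) g, Ck_on k (ball p (s p)) g &
      forall x, ball p (s p) x -> `|F x - T p x - g x| <= err n p].
  have [Op|nO] := pselect (Omega p); last by exists 0.
  have [g gP] := LA (s0 Op) (w0 Op) (err0 n p Op) (FT Op).
  by exists g.
pose g n p := sval (cid (gex n p)).
have gP n p : Omega p ->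
   [/\ lip_on (ball p (s p)) (C * w p) (g n p), Ck_on k (ball p (s p)) (g n p) &
      forall x, ball p (s p) x -> `|F x - T p x - g n p x| <= err n p].
  exact: (svalP (cid (gex n p))).
pose gg n z := T (c n z) z + g n (c n z) z.
have phi_ge0 := pou_ge0 P.
exists (glue phi gg).
have gg_near n z p : Omega p -> ball p (s p) z -> c n z = p -> `|gg n z - F z| <= err n p.
  move=> Op pz cz; rewrite /gg cz distrC opprD addrA.
  by have [_ _] := gP n p Op; apply.
have sum1 z : Omega z -> exists m, \forall y \near z,
    glue phi gg y = \sum_(0 <= n < m) phi n y *: gg n y /\ \sum_(0 <= n < m) phi n y = 1.
  move=> Oz; have [m near_m] := pou_sum P Oz; exists m.
  apply: (filterS _ near_m) => y [phi0 phi1]; rewrite (glueE _ phi0); split=> //.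
  by rewrite big_mkord.
split.
- apply: Ck_on_local => x Ox; have [m near_m] := sum1 x Ox.
  suff : Ck_near k x (glue phi gg) by [].
  apply: (@Ck_near_eq _ _ (fun z => \sum_(0 <= n < m) phi n z *: gg n z)).
    by apply: (filterS _ near_m) => y [].
  apply: Ck_near_sum => n; have [phi0|[p [Op px cp]]] := pou_sub P n x.
    apply: Ck_near_eq (Ck_near_cst k x 0).
    by apply: (filterS _ phi0) => y ->; rewrite scale0r.
  apply: (@Ck_near_eq _ _ (fun z => phi n z *: (T p z + g n p z))).
    by apply: (filterS _ cp) => y cy; rewrite /gg cy.
  exists (ball p (s p)); split=> //; first exact: ball_open.
  apply: Ck_on_scale; first exact: Ck_on_sub (pou_Ck P n).
  by apply: Ck_on_add; [exact: Ck_on_contlin|case: (gP n p Op)].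
- move=> z M Oz etaM; have [m /nbhs_singleton[-> phi1]] := sum1 z Oz.
  rewrite -[F z]scale1r -phi1 scaler_suml -sumrB.
  rewrite (le_trans (ler_norm_sum _ _ _))// -[M]mul1r -phi1 mulr_suml.
  apply: ler_sum => n _; rewrite -scalerBr normrZ ger0_norm//.
  have [/nbhs_singleton ->|[p [Op pz /nbhs_singleton cp]]] := pou_sub P n z.
    by rewrite !mul0r.
  rewrite ler_wpM2l// (le_trans (gg_near _ _ _ Op pz cp))// (le_trans _ (etaM _ Op pz))//.
  rewrite /err ler_pdivrMr ?mulr_gt0 ?exprn_gt0// ler_peMr ?(ltW (eta0 Op))//.
  rewrite -[leLHS]mul1r ler_pM//; first by rewrite exprn_ege1// ler1n.
  by rewrite lerDl (pou_L_ge0 P).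
move=> z S D M M' Oz TM etaM' gD.
have Ozz : ball z (s z) z by apply: ballxx; exact: s0.
have M0 : 0 <= M.
  by rewrite (le_trans _ (TM _ Oz Ozz))// addr_ge0// mulr_ge0// w0.
have M'0 : 0 <= M' by rewrite (le_trans _ (etaM' _ Oz Ozz))// ltW// eta0.
have gSD : is_diff z (fun y => glue phi gg y + (- S) y) (D - S).
  by apply: is_diff_add => //; exact: is_diff_contlin.
apply: (is_diff_bound _ _ gSD); first exact: addr_ge0.
have [m near_m] := sum1 z Oz; have [gz phiz] := nbhs_singleton near_m.
(* Since the phi n sum to 1 near z, F z and S (y - z) may be subtracted inside the sum; the
   increment of phi n is then multiplied by the error at z alone. *)
pose a n y := gg n y - F z - S (y - z).
have near_a : \forall y \near z, forall n : 'I_m,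
    `|phi n y *: a n y - phi n z *: a n z| <=
      (phi n y * M + (2^-1 ^+ n.+1) * M') * `|y - z|.
  apply: filter_forall => n.
  have [phi0|[p [Op pz cp]]] := pou_sub P n z.
    apply: (filterS _ phi0) => y ->.
    rewrite (nbhs_singleton phi0) !scale0r subrr normr0 mul0r add0r.
    by rewrite !mulr_ge0// exprn_ge0.
  have near_p : \forall y \near z, ball p (s p) y.
    by apply: open_nbhs_nbhs; split=> //; exact: ball_open.
  have cz := nbhs_singleton cp.
  apply: filterS2 cp near_p => y cy py.
  have -> : phi n y *: a n y - phi n z *: a n z =
      phi n y *: (a n y - a n z) + (phi n y - phi n z) *: a n z.
    by rewrite (scalerBr _ (a n y)) (scalerBl _ _ (a n z)) addrA subrK.
  rewrite (le_trans (ler_normD _ _))// mulrDl lerD// normrZ.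
    rewrite ger0_norm// -mulrA ler_wpM2l//.
    have -> : a n y - a n z = (T p - S) (y - z) + (g n p y - g n p z).
      rewrite /a /gg cy cz subrr linear0 subr0 contlinBE (linearB (T p)).
      rewrite (addrAC _ (- F z)) opprB addrA subrK opprD !addrA; congr (_ - _).
      by rewrite (addrAC (T p y)) addrAC (addrAC (T p y)).
    rewrite (le_trans (ler_normD _ _))// (le_trans _ (ler_wpM2r (normr_ge0 _) (TM _ Op pz)))//.
    by rewrite mulrDl lerD ?contlin_le//; have [+ _ _] := gP n p Op; apply.
  have az : a n z = gg n z - F z by rewrite /a subrr linear0 subr0.
  rewrite az; apply: (@le_trans _ _ (L n * `|y - z| * err n p)).
    by rewrite ler_pM// ?(pou_lip P)//; exact: gg_near.
  rewrite mulrAC ler_wpM2r// /err exprVn mulrA ler_pdivrMr ?mulr_gt0 ?exprn_gt0//.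
  rewrite [leRHS](_ : _ = M' * (1 + L n)); last by field; rewrite expf_neq0.
  rewrite mulrC ler_pM ?(ltW (eta0 Op)) ?(pou_L_ge0 P) ?etaM'//.
  by rewrite lerDr.
apply: filterS2 near_m near_a => y [gy phiy] ay.
have E x' : \sum_(0 <= n < m) phi n x' = 1 ->
    \sum_(0 <= n < m) phi n x' *: gg n x' - F z - S (x' - z) =
    \sum_(0 <= n < m) phi n x' *: a n x'.
  move=> p1; rewrite -[F z]scale1r -[S (x' - z)]scale1r -{1 2}p1 !scaler_suml.
  by rewrite -!sumrB; apply: eq_bigr => n _; rewrite -!scalerBr.
have -> : glue phi gg y + (- S) y - (glue phi gg z + (- S) z) =
    \sum_(0 <= n < m) (phi n y *: a n y - phi n z *: a n z).
  rewrite sumrB -(E _ phiy) -(E _ phiz) gy gz !contlinNE subrr linear0 subr0 (linearB S).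
  exact/esym/addr_shuffle.
rewrite (le_trans (ler_norm_sum _ _ _))//.
apply: (@le_trans _ _ (\sum_(0 <= n < m) (phi n y * M + 2^-1 ^+ n.+1 * M') * `|y - z|)).
  by rewrite !big_mkord; apply: ler_sum => n _; exact: ay.
rewrite -mulr_suml ler_wpM2r// big_split /= -!mulr_suml phiy mul1r lerD2l.
rewrite -[leRHS]mul1r ler_wpM2r//.
under eq_bigr do rewrite exprS.
rewrite -mulr_sumr -ler_pdivlMl ?invr_gt0// invrK mulr1.
by rewrite (le_trans (sum_half_pow_le _ _ _))// expr0 mulr1.
Qed.

End FineApproximation.

(** * Extension along a Lipschitz retraction *)

Lemma continuous_within_normP (R : realType) (X Y : normedModType R) (A : set X)
    (G : X -> Y) (x : X) (e : R) :
  {within A, continuous G} -> A x -> 0 < e ->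
  exists2 d : R, 0 < d & forall y, A y -> `|y - x| < d -> `|G y - G x| <= e.
Proof.
move=> /subspace_continuousP cG Ax e0.
have /cvgrPdist_le/(_ _ e0) := cG _ Ax.
rewrite near_withinE => /near_normP[d d0 dP]; exists d => // y Ay yx.
by rewrite distrC; exact: dP.
Qed.

Section LocalExtension.
Context {R : realType} {X Y : normedModType R}.
Context (k : option nat) (k0 : k <> Some 0%N).
Context (C : R) (C0 : 0 <= C) (LA : LA_balls X Y k C).
Hypothesis pou : forall (Omega : set X) (N : X -> set X),
  (forall p, Omega p -> open (N p)) -> (forall p, Omega p -> N p p) ->
  exists phi c L, partition_of_unity k Omega N phi c L.
Context (A : set X) (f : X -> Y) (G : X -> contlin X Y) (fG : condition_W A f G).
Context (U : set X) (r : X -> X) (K Lf M : R).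
Hypotheses (oU : open U) (K1 : 1 <= K) (rK : lip_on U K r)
  (rA : forall z, U z -> A (r z)) (r_id : forall z, U z -> A z -> r z = z)
  (Lf0 : 0 <= Lf) (M0 : 0 <= M)
  (fL : forall z w, U z -> U w -> `|f (r z) - f (r w)| <= Lf * `|r z - r w|)
  (GM : forall z, U z -> `|G (r z)| <= M).

Let K0 : 0 <= K. Proof. exact: le_trans ler01 K1. Qed.

Let e : X -> R^o := fun z => `|z - r z|.

Let eK : lip_on U (1 + K) e.
Proof.
move=> y z Uy Uz; rewrite (le_trans (ler_dist_dist _ _))// subrACA.
by rewrite mulrDl mul1r (le_trans (ler_normB _ _))// lerD2l; exact: rK.
Qed.

Let e_ge0 z : 0 <= e z. Proof. exact: normr_ge0. Qed.

Let e_eq0 z : U z -> e z = 0 <-> A z.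
Proof.
move=> Uz; split=> [/normr0_eq0/eqP|Az]; last by rewrite /e r_id// subrr normr0.
by rewrite subr_eq0 => /eqP ->; exact: rA.
Qed.

Let Omega : set X := [set z | U z /\ 0 < e z].

Let Omega_not z : Omega z -> ~ A z.
Proof. by move=> [Uz ez] /(e_eq0 Uz) e0; rewrite e0 ltxx in ez. Qed.

Let not_Omega z : U z -> ~ A z -> Omega z.
Proof.
move=> Uz nA; split=> //; rewrite lt_neqAle e_ge0 andbT eq_sym.
by apply/eqP => /(e_eq0 Uz).
Qed.

Let e_cont z : U z -> {for z, continuous e}.
Proof. by move=> Uz; exact: lip_near_continuous (lip_on_near oU Uz eK). Qed.

Let near_U z : U z -> \forall w \near z, U w.
Proof. by move=> Uz; exact: open_nbhs_nbhs. Qed.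

Let near_Omega z : Omega z -> \forall w \near z, Omega w.
Proof.
move=> [Uz ez]; apply: filterI; first exact: near_U.
exact: continuous_near_ge (e_cont Uz) ez.
Qed.

Let oO : open Omega.
Proof. by rewrite openE => z; exact: near_Omega. Qed.

Let H z := G (r z).

Let H_cont z : U z -> {for z, continuous H}.
Proof.
move=> Uz; apply/continuous_normP => eps eps0.
have [d d0 dP] := continuous_within_normP fG.1 (rA Uz) eps0.
have /continuous_normP/(_ (d / 2))[|d' d'0 d'P] := lip_near_continuous (lip_on_near oU Uz rK).
  by rewrite divr_gt0.
have /near_normP[d2 d20 d2P] := near_U Uz.
exists (Num.min d' d2); first by rewrite lt_min d'0.
move=> y; rewrite lt_min => /andP[yd' /d2P Uy]; apply: dP; first exact: rA.
by rewrite (le_lt_trans (d'P _ yd'))// ltr_pdivrMr// ltr_pMr// ltr1n.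
Qed.

Let Ht_exists : exists HB : (X -> contlin X Y) * R,
  [/\ 0 <= HB.2,
    forall z, Omega z -> `|HB.1 z| <= HB.2 /\ lip_near z (HB.2 / e z) HB.1 &
    forall x, U x -> A x -> forall eta : R, 0 < eta ->
      \forall z \near x, Omega z ->
        `|HB.1 z - H z| <= eta /\ lip_near z (eta / e z) HB.1].
Proof.
have [||||||Ht [B [B0 B1 B2]]] := @vanishing_oscillation_extension R X (contlin X Y) U e (1 + K) H M oU.
- by rewrite lerDl.
- exact: eK.
- by move=> x _; exact: e_ge0.
- exact: M0.
- exact: GM.
- move=> eta eta0.
  by apply: (@locally_lipschitz_approximation R X (contlin X Y) k U H eta (pou (Omega := U))).
exists (Ht, B); split=> //= [z [Uz ez]|x Ux Ax eta eta0]; first exact: B1.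
by apply: filterS (B2 x Ux ((e_eq0 Ux).2 Ax) eta eta0) => z h [Uz ez]; exact: h.
Qed.

Let Ht : X -> contlin X Y := (sval (cid Ht_exists)).1.
Let B : R := (sval (cid Ht_exists)).2.
Let B0 : 0 <= B. Proof. by case: (svalP (cid Ht_exists)). Qed.
Let Ht_bound z : Omega z -> `|Ht z| <= B.
Proof. by case: (svalP (cid Ht_exists)) => _ + _ => /[apply] -[]. Qed.
Let Ht_lip z : Omega z -> lip_near z (B / e z) Ht.
Proof. by case: (svalP (cid Ht_exists)) => _ + _ => /[apply] -[]. Qed.
Let Ht_near x eta : U x -> A x -> 0 < eta -> \forall z \near x, Omega z ->
  `|Ht z - H z| <= eta /\ lip_near z (eta / e z) Ht.
Proof. by case: (svalP (cid Ht_exists)) => _ _ h Ux Ax; exact: h. Qed.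

Let F z : Y := f (r z) + Ht z (z - r z).

Let F_lip z (a b : R) : Omega z -> 0 <= b ->
  (exists2 d : R, 0 < d & forall w w', U w -> U w' -> `|w - z| < d -> `|w' - z| < d ->
     `|f (r w) - f (r w') - Ht z (r w - r w')| <= a * `|r w - r w'|) ->
  0 <= a -> lip_near z (b / e z) Ht ->
  lip_near z (a * K + b * (3 + K)) (fun w => F w - Ht z w).
Proof.
move=> [Uz ez] b0 [d d0 fa] a0 HtL.
have near_e : \forall w \near z, e w < 2 * e z.
  by apply: (continuous_near_le (e_cont Uz)); rewrite ltr_pMl// ltr1n.
have near_d : \forall w \near z, `|w - z| < Num.min d (e z).
  by apply/near_normP; exists (Num.min d (e z)); rewrite ?lt_min ?d0.
have near_all : \forall w \near z, U w /\ (e w < 2 * e z /\ `|w - z| < Num.min d (e z)).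
  exact: filterI (near_U Uz) (filterI near_e near_d).
have [s [s0 {}HtL sP]] := lip_nearP HtL near_all.
exists s => // w w' ws ws'.
have [Uw [ew]] := sP _ ws; rewrite lt_min => /andP[wd we].
have [Uw' [ew']] := sP _ ws'; rewrite lt_min => /andP[wd' we'].
have zs : ball z s z by exact: ballxx.
set v := w - r w; set v' := w' - r w'.
have -> : F w - Ht z w - (F w' - Ht z w') =
    (f (r w) - f (r w') - Ht z (r w - r w')) +
    ((Ht w - Ht w') v + (Ht w' - Ht z) (v - v')).
  rewrite /F -/v -/v'.
  have -> : Ht z w = Ht z v + Ht z (r w) by rewrite -linearD subrK.
  have -> : Ht z w' = Ht z v' + Ht z (r w') by rewrite -linearD subrK.
  rewrite !contlinBE (linearB (Ht w') v v') (linearB (Ht z) v v') (linearB (Ht z) (r w) (r w')).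
  exact: increment_split.
have rw : `|r w - r w'| <= K * `|w - w'| by exact: rK.
have vv : `|v - v'| <= (1 + K) * `|w - w'|.
  by rewrite /v /v' subrACA mulrDl mul1r (le_trans (ler_normB _ _))// lerD2l.
have t1 : `|f (r w) - f (r w') - Ht z (r w - r w')| <= a * K * `|w - w'|.
  by rewrite (le_trans (fa _ _ Uw Uw' wd wd'))// -mulrA ler_wpM2l.
have be0 : 0 <= b / e z by rewrite divr_ge0// ltW.
have t2 : `|(Ht w - Ht w') v| <= b * 2 * `|w - w'|.
  rewrite (le_trans (contlin_le _ _))//.
  apply: (@le_trans _ _ (b / e z * `|w - w'| * (2 * e z))).
    by rewrite ler_pM// ?HtL// ltW.
  by rewrite le_eqVlt; apply/orP; left; apply/eqP; field; rewrite gt_eqF.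
have t3 : `|(Ht w' - Ht z) (v - v')| <= b * (1 + K) * `|w - w'|.
  rewrite (le_trans (contlin_le _ _))// -mulrA ler_pM//.
  rewrite (le_trans (HtL _ _ ws' zs))// mulrAC ler_pdivrMr// ler_wpM2l// ltW//.
rewrite (le_trans (ler_normD _ _))// mulrDl lerD//.
rewrite (le_trans (ler_normD _ _))//.
rewrite (_ : b * (3 + K) * `|w - w'| = b * 2 * `|w - w'| + b * (1 + K) * `|w - w'|); last by ring.
exact: lerD.
Qed.

(* [om z] exceeds the infimum of the admissible constants by a quantity that
   vanishes at A, so it tends to 0 at A. *)
Let adm z : set R := [set w | 0 <= w /\ lip_near z w (fun y => F y - Ht z y)].
Let om z : R := inf (adm z) + Num.min 1 (e z).
(** [F_lip] with a = Lf + B and b = B: an admissible constant on all of Omega, from which the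
    uniform bound on the derivative comes. *)
Let W0 : R := (Lf + B) * K + B * (3 + K).

Let adm_W0 z : Omega z -> adm z W0.
Proof.
move=> Oz; have [Uz ez] := Oz; split.
  by rewrite addr_ge0 ?mulr_ge0 ?addr_ge0.
apply: F_lip => //; [|exact: addr_ge0|exact: Ht_lip].
exists 1 => // w w' Uw Uw' _ _; rewrite (le_trans (ler_normB _ _))// mulrDl lerD//.
  exact: fL.
by rewrite (le_trans (contlin_le _ _))// ler_wpM2r// Ht_bound.
Qed.

Let adm_lb z : has_lbound (adm z). Proof. by exists 0 => w []. Qed.

Let om_le z w : adm z w -> om z <= w + Num.min 1 (e z).
Proof. by move=> zw; rewrite lerD2r; apply: ge_inf. Qed.

Let om_ge0 z : Omega z -> 0 <= om z.
Proof.
move=> Oz; rewrite addr_ge0//; last by rewrite le_min ler01 e_ge0.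
by apply: lb_le_inf; [exists W0; exact: adm_W0|move=> w []].
Qed.

Let om_lip z : Omega z -> lip_near z (om z) (fun y => F y - Ht z y).
Proof.
move=> Oz; have m0 : 0 < Num.min 1 (e z) by rewrite lt_min ltr01; case: Oz.
have ha : has_inf (adm z) by split; [exists W0; exact: adm_W0|exact: adm_lb].
have [w [w0 wL] wlt] := inf_adherent m0 ha.
by apply: lip_near_le wL; exact: ltW.
Qed.

(** When a point tends to A, so do the centres of all balls that contain it; smallness near A at the
    centres is thus inherited by the point. *)
Let rad_exists z : exists s : R, Omega z ->
  [/\ 0 < s, lip_on (ball z s) (om z) (fun y => F y - Ht z y) &
      forall w, ball z s w -> e z < 2 * e w /\ `|w - z| <= e w].
Proof.
have [Oz|nO] := pselect (Omega z); last by exists 0.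
have [Uz ez] := Oz.
have ne : \forall w \near z, e z / 2 < e w.
  by apply: (continuous_near_ge (e_cont Uz)); rewrite ltr_pdivrMr// ltr_pMr// ltr1n.
have nd : \forall w \near z, `|w - z| < e z / 2.
  by apply/near_normP; exists (e z / 2); rewrite ?divr_gt0.
have near_all : \forall w \near z, e z / 2 < e w /\ `|w - z| < e z / 2 by exact: filterI.
have [s [s0 sL sP]] := lip_nearP (om_lip Oz) near_all.
exists s => _; split=> // w /sP[h1 h2].
split; last by rewrite ltW// (lt_trans h2).
by move: h1; rewrite ltr_pdivrMr// mulrC.
Qed.

Let rad z := sval (cid (rad_exists z)).
Let radP z : Omega z ->
  [/\ 0 < rad z, lip_on (ball z (rad z)) (om z) (fun y => F y - Ht z y) &
      forall w, ball z (rad z) w -> e z < 2 * e w /\ `|w - z| <= e w].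
Proof. exact: (svalP (cid (rad_exists z))). Qed.

(** The square makes g - F of smaller order than e at A and the derivative error vanish there; the 1
    keeps both bounded. *)
Let eta z : R := Num.min 1 (e z ^+ 2).

Let g0_exists : exists g : X -> Y, [/\ Ck_on k Omega g,
  forall z N, Omega z -> (forall p, Omega p -> ball p (rad p) z -> eta p <= N) ->
    `|g z - F z| <= N &
  forall z (S D : contlin X Y) N N', Omega z ->
    (forall p, Omega p -> ball p (rad p) z -> `|Ht p - S| + C * om p <= N) ->
    (forall p, Omega p -> ball p (rad p) z -> eta p <= N') ->
    is_diff z g D -> `|D - S| <= N + N'].
Proof.
apply: fine_approximation => //.
- by move=> p /radP[].
- by move=> p [_ ep]; rewrite lt_min ltr01 exprn_gt0.
- by move=> p /radP[].
- exact: pou.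
Qed.

Let g0 := sval (cid g0_exists).
Let g0_Ck : Ck_on k Omega g0. Proof. by case: (svalP (cid g0_exists)). Qed.
Let g0_near z N : Omega z -> (forall p, Omega p -> ball p (rad p) z -> eta p <= N) ->
  `|g0 z - F z| <= N.
Proof. by case: (svalP (cid g0_exists)) => _ h _; exact: h. Qed.
Let g0_diff z (S D : contlin X Y) N N' : Omega z ->
  (forall p, Omega p -> ball p (rad p) z -> `|Ht p - S| + C * om p <= N) ->
  (forall p, Omega p -> ball p (rad p) z -> eta p <= N') ->
  is_diff z g0 D -> `|D - S| <= N + N'.
Proof. by case: (svalP (cid g0_exists)) => _ _ h; exact: h. Qed.

Let g z : Y := if `[< A z >] then f z else g0 z.

Let gA z : A z -> g z = f z.
Proof. by move=> Az; rewrite /g asboolT. Qed.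
Let gO z : Omega z -> g z = g0 z.
Proof. by move=> /Omega_not nA; rewrite /g asboolF. Qed.

Let g_Ck : Ck_on k Omega g.
Proof. by apply: (Ck_on_eq oO) g0_Ck => z /gO ->. Qed.

Let g_diff_Omega z : Omega z -> exists D : contlin X Y, is_diff z g D.
Proof. exact: Ck_on_diff k0 g_Ck. Qed.

Let g_diff_g0 z (D : contlin X Y) : Omega z -> is_diff z g D -> is_diff z g0 D.
Proof. by move=> Oz; apply: is_diff_near_eq; apply: filterS (near_Omega Oz) => y /gO. Qed.

Let eta_le p z : Omega p -> ball p (rad p) z -> eta p <= 4 * e z ^+ 2.
Proof.
move=> Op pz; have [_ _ /(_ _ pz)[h _]] := radP Op.
rewrite ge_min; apply/orP; right.
have -> : 4 * e z ^+ 2 = (2 * e z) ^+ 2 by ring.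
by rewrite ler_pXn2r ?nnegrE ?mulr_ge0 ?e_ge0// ltW.
Qed.

Let g_bound_Omega z (D : contlin X Y) : Omega z -> is_diff z g D ->
  `|D| <= B + C * (W0 + 1) + 1.
Proof.
(* Comparison with the operator S = 0 turns the estimate of D - S into a bound. *)
move=> Oz /(g_diff_g0 Oz) gD; rewrite -[D]subr0; apply: (g0_diff Oz _ _ gD).
  move=> p Op _; rewrite subr0 lerD ?Ht_bound// ler_wpM2l//.
  by rewrite (le_trans (om_le (adm_W0 Op)))// lerD2l ge_min lexx.
by move=> p _ _; rewrite ge_min lexx.
Qed.

Let e_le x z : U x -> A x -> U z -> e z <= (1 + K) * `|z - x|.
Proof.
move=> Ux Ax Uz; have := eK Uz Ux; rewrite ((e_eq0 Ux).2 Ax) subr0.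
by rewrite ger0_norm// e_ge0.
Qed.

Let near_A x (eps : R) : U x -> A x -> 0 < eps -> exists2 d : R, 0 < d &
  forall z, `|z - x| < d -> U z /\ (Omega z ->
    [/\ `|Ht z - G x| <= 2 * eps, lip_near z (eps / e z) Ht & 
        forall w w', U w -> U w' -> `|w - x| < d -> `|w' - x| < d ->
        `|f (r w) - f (r w') - G x (r w - r w')| <= eps * `|r w - r w'|]).
Proof.
move=> Ux Ax eps0.
have [d1 d10 d1P] := fG.2 _ Ax _ eps0.
have /continuous_normP/(_ _ eps0)[d2 d20 d2P] := H_cont Ux.
have /near_normP[d3 d30 d3P] := Ht_near Ux Ax eps0.
have /near_normP[d4 d40 d4P] := near_U Ux.
(* Division by K keeps r w within d1 of x, because r x = x. *)
pose d := Num.min (Num.min (d1 / K) d2) (Num.min d3 d4).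
have K00 : 0 < K by exact: lt_le_trans ltr01 K1.
have d0 : 0 < d by rewrite !lt_min d20 d30 d40 divr_gt0.
have dP z : `|z - x| < d -> [/\ `|z - x| < d1 / K, `|z - x| < d2, `|z - x| < d3 & `|z - x| < d4].
  by rewrite !lt_min => /andP[/andP[? ?] /andP[? ?]].
exists d => // z /dP[_ z2 z3 z4]; split; first exact: d4P.
move=> Oz; have [HtH HtL] := d3P _ z3 Oz; split=> //.
  rewrite -(subrKA (H z)) (le_trans (ler_normD _ _))// mulr2n mulrDl mul1r lerD//.
  by have := d2P _ z2; rewrite /H (r_id Ux Ax).
have rB w : U w -> `|w - x| < d -> (ball x d1 `&` A) (r w).
  move=> Uw /dP[w1 _ _ _]; split; last exact: rA.
  rewrite -ball_normE /= distrC -[X in r w - X](r_id Ux Ax) (le_lt_trans (rK Uw Ux))//.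
  by rewrite mulrC -ltr_pdivlMr.
by move=> w w' Uw Uw' wd wd'; apply: d1P; exact: rB.
Qed.

Let g_diff_A x : U x -> A x -> is_diff x g (G x).
Proof.
move=> Ux Ax; apply/is_diff_normP => eps eps0.
(* The summands pay for |g - F| <= 4 e^2, for f along r, for (Ht z - G x)[z - r z], and 1 for points
   of A. *)
pose c := 4 * (1 + K) ^+ 2 + K + 2 * (1 + K) + 1.
have c0 : 0 < c by rewrite ltr_wpDl// !addr_ge0// mulr_ge0 ?addr_ge0// exprn_ge0// addr_ge0.
pose ep := eps / c; have ep0 : 0 < ep by rewrite divr_gt0.
have [d1 d10 d1P] := near_A Ux Ax ep0.
have [d2 d20 d2P] := fG.2 _ Ax _ ep0.
exists (Num.min (Num.min d1 d2) ep); first by rewrite !lt_min d10 d20.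
move=> z; rewrite !lt_min => /andP[/andP[z1 z2] zep].
have epc : eps = ep * c by rewrite /ep mulfVK// gt_eqF.
rewrite (gA Ax).
have [Az|nAz] := pselect (A z).
  rewrite gA//; apply: (@le_trans _ _ (ep * `|z - x|)).
    by apply: d2P; split=> //; [exact: ballxx|rewrite -ball_normE /= distrC].
  rewrite ler_wpM2r// epc ler_peMr ?(ltW ep0)// lerDr.
  by rewrite !addr_ge0// mulr_ge0 ?addr_ge0// exprn_ge0// addr_ge0.
have [Uz /(_ (not_Omega (d1P _ z1).1 nAz))[HtG _ fr]] := d1P _ z1.
have Oz := not_Omega Uz nAz.
have ez := e_le Ux Ax Uz.
have A1 : `|g z - F z| <= ep * (4 * (1 + K) ^+ 2) * `|z - x|.
  rewrite gO//; apply: (@le_trans _ _ (4 * e z ^+ 2)).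
    by apply: g0_near => // p Op; exact: eta_le.
  apply: (@le_trans _ _ (4 * ((1 + K) * `|z - x|) ^+ 2)).
    by rewrite ler_wpM2l// ler_pXn2r ?nnegrE ?mulr_ge0 ?addr_ge0.
  rewrite exprMn [leRHS](_ : _ = 4 * ((1 + K) ^+ 2 * (ep * `|z - x|))); last by ring.
  rewrite ler_wpM2l// ler_wpM2l ?exprn_ge0 ?addr_ge0// expr2 ler_wpM2r//.
  exact: ltW.
have A2 : `|f (r z) - f (r x) - G x (r z - r x)| <= ep * K * `|z - x|.
  rewrite (le_trans (fr z x Uz Ux z1 _))// ?subrr ?normr0//.
  by rewrite -mulrA ler_wpM2l ?(ltW ep0)//; exact: rK.
have A3 : `|(Ht z - G x) (z - r z)| <= ep * (2 * (1 + K)) * `|z - x|.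
  rewrite (le_trans (contlin_le _ _))//.
  rewrite [leRHS](_ : _ = 2 * ep * ((1 + K) * `|z - x|)); last by ring.
  by rewrite ler_pM.
have -> : g z - f x - G x (z - x) = (g z - F z) +
    ((f (r z) - f (r x) - G x (r z - r x)) + (Ht z - G x) (z - r z)).
  rewrite /F (r_id Ux Ax) contlinBE.
  have -> : G x (z - x) = G x (z - r z) + G x (r z - x) by rewrite -linearD subrKA.
  exact: taylor_split.
rewrite (le_trans (ler_normD _ _))//.
apply: (@le_trans _ _ (ep * (4 * (1 + K) ^+ 2) * `|z - x| +
   (ep * K * `|z - x| + ep * (2 * (1 + K)) * `|z - x|))).
  by rewrite lerD// (le_trans (ler_normD _ _))// lerD.
rewrite -!mulrDl -!mulrDr ler_wpM2r// epc ler_wpM2l ?(ltW ep0)//.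
by rewrite /c addrA lerDl.
Qed.

Let g_deriv_near_A x (eps : R) : U x -> A x -> 0 < eps ->
  exists2 d : R, 0 < d & forall z (D : contlin X Y), `|z - x| < d -> U z ->
    is_diff z g D -> `|D - G x| <= eps.
Proof.
move=> Ux Ax eps0.
(* 2 pays for Ht p - G x; the bracket is [F_lip] with a = 3 ep and b = ep, plus the term e p <= ep
   of [om]; 4 pays for eta, and 1 is spare. *)
pose c := 2 + C * (3 * K + (3 + K) + 1) + 4 + 1.
have c0 : 0 < c by rewrite /c ltr_wpDl// !addr_ge0// mulr_ge0 ?addr_ge0 ?mulr_ge0.
pose ep := Num.min 1 (eps / c).
have ep0 : 0 < ep by rewrite lt_min ltr01 divr_gt0.
have epc : ep * c <= eps.
  by rewrite -ler_pdivlMr// ge_min lexx orbT.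
have [d1 d10 d1P] := near_A Ux Ax ep0.
have [d2 d20 d2P] := continuous_within_normP fG.1 Ax eps0.
(* If z lies in the ball of p, then |p - x| <= e z + |z - x| <= (2 + K) |z - x| and e p < 2 e z <= 2
   (1 + K) |z - x|. *)
have K2 : 0 < 2 * (2 + K) by rewrite mulr_gt0// ltr_wpDr.
pose d := Num.min (Num.min d1 ep / (2 * (2 + K))) d2.
have m0 : 0 < Num.min d1 ep by rewrite lt_min d10.
exists d; first by rewrite lt_min d20 divr_gt0.
move=> z D; rewrite lt_min => /andP[zd zd2] Uz gD.
have [Az|nAz] := pselect (A z).
  by rewrite (is_diff_unique gD (g_diff_A Uz Az)); exact: d2P.
have Oz := not_Omega Uz nAz.
have ez := e_le Ux Ax Uz.
move: zd; rewrite ltr_pdivlMr// => zd.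
have zx0 := normr_ge0 (z - x); have zxK : 0 <= `|z - x| * K by exact: mulr_ge0.
have near_p p : Omega p -> ball p (rad p) z -> `|p - x| < Num.min d1 ep /\ e p <= ep.
  move=> Op pz; have [_ _ /(_ _ pz)[h1 h2]] := radP Op.
  have ep2 : Num.min d1 ep <= ep by rewrite ge_min lexx orbT.
  split; last by move: h1 ez zd ep2; move: (Num.min d1 ep) => m; lra.
  have : `|p - x| <= `|z - p| + `|z - x| by rewrite (distrC z p) ler_distD.
  by move: h2 ez zd; move: (Num.min d1 ep) => m; lra.
have e1 : 4 * e z ^+ 2 <= 4 * ep.
  have e_ep : e z <= ep.
    have ep2 : Num.min d1 ep <= ep by rewrite ge_min lexx orbT.
    by move: ez zd ep2; move: (Num.min d1 ep) => m; lra.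
  rewrite ler_wpM2l// expr2 -[leRHS]mulr1 ler_pM ?e_ge0//.
  by rewrite (le_trans e_ep)// ge_min lexx.
rewrite (@le_trans _ _ ((2 * ep + C * (3 * ep * K + ep * (3 + K) + ep)) + 4 * ep))//; last first.
  apply: le_trans epc; rewrite [leRHS](_ : _ = 2 * ep + C * (3 * ep * K + ep * (3 + K) + ep) + 4 * ep + ep).
    by rewrite lerDl ltW.
  by rewrite /c; ring.
apply: (g0_diff Oz _ _ (g_diff_g0 Oz gD)) => p Op pz; last exact: le_trans (eta_le Op pz) e1.
have [px ep_le] := near_p _ Op pz; have [Up ep_gt0] := Op.
have px1 : `|p - x| < d1 by move: px; rewrite lt_min => /andP[].
have [_ /(_ Op)[HtG HtL fr]] := d1P _ px1.
rewrite lerD// ler_wpM2l// (@le_trans _ _ ((3 * ep * K + ep * (3 + K)) + Num.min 1 (e p)))//.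
  apply: om_le; split.
    by rewrite addr_ge0// !mulr_ge0// ?(ltW ep0)// addr_ge0.
  apply: F_lip => //; [exact: ltW| |by rewrite mulr_ge0// ltW].
  exists (d1 - `|p - x|); first by rewrite subr_gt0.
  have tri w : `|w - p| < d1 - `|p - x| -> `|w - x| < d1.
    by rewrite ltrBrDr; apply: le_lt_trans; exact: ler_distD.
  move=> w w' Uw Uw' /tri wd /tri wd'.
  have -> : f (r w) - f (r w') - Ht p (r w - r w') =
    (f (r w) - f (r w') - G x (r w - r w')) - (Ht p - G x) (r w - r w').
    by rewrite contlinBE opprB addrA subrK.
  rewrite (le_trans (ler_normB _ _))//.
  rewrite (_ : 3 * ep = ep + 2 * ep); last by ring.
  rewrite mulrDl lerD//; first exact: fr.
  by rewrite (le_trans (contlin_le _ _))// ler_wpM2r.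
by rewrite lerD2l ge_min ep_le orbT.
Qed.

(** The last clause covers every derivative of g on U, so that it can be fed to the mean value
    inequality when U is the whole space. *)
Lemma local_extension : exists g : X -> Y,
  [/\ forall x, A x -> g x = f x,
      Ck_on (Some 1%N) U g,
      forall x, U x -> A x -> is_diff x g (G x),
      Ck_on k (U `\` A) g &
      exists B : R, forall x (D : contlin X Y), U x -> is_diff x g D -> `|D| <= B].
Proof.
have UA_Omega : U `\` A = Omega.
  by apply/seteqP; split=> z; [move=> [Uz nAz]; exact: not_Omega|move=> Oz; split; [case: Oz|exact: Omega_not]].
have gdiff x : exists D : contlin X Y, U x -> is_diff x g D.
  have [Ux|nU] := pselect (U x); last by exists 0.
  have [Ax|nA] := pselect (A x); first by exists (G x) => _; exact: g_diff_A.
  by have [D gD] := g_diff_Omega (not_Omega Ux nA); exists D.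
pose Dg x := sval (cid (gdiff x)).
have DgP x : U x -> is_diff x g (Dg x) by exact: (svalP (cid (gdiff x))).
exists g; split=> //.
- exists Dg => // x Ux; have [Ax|nA] := pselect (A x).
    apply/continuous_normP => eps eps0.
    have [d d0 dP] := g_deriv_near_A Ux Ax eps0.
    have /near_normP[d' d'0 d'P] := near_U Ux.
    exists (Num.min d d'); first by rewrite lt_min d0.
    move=> y; rewrite lt_min => /andP[yd /d'P Uy].
    rewrite (is_diff_unique (DgP _ Ux) (g_diff_A Ux Ax)).
    exact: dP yd Uy (DgP _ Uy).
  have Ox := not_Omega Ux nA.
  have [D' gD' cD'] := Ck_on_C1 k0 g_Ck.
  apply: (Cn_on_eq (n := 0) oO) Ox; last exact: cD'.
  by move=> z Oz; apply: is_diff_unique (gD' _ Oz) (DgP _ _); case: Oz.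
- by rewrite UA_Omega.
- exists (Num.max M (B + C * (W0 + 1) + 1)) => x D Ux gD; rewrite le_max.
  have [Ax|nA] := pselect (A x).
    by rewrite (is_diff_unique gD (g_diff_A Ux Ax)) -(r_id Ux Ax) GM.
  by rewrite (g_bound_Omega (not_Omega Ux nA) gD) orbT.
Qed.

End LocalExtension.

(** * Lipschitz retractions *)

Section ConvexRetraction.
Context {R : realType} {X : normedModType R}.
Context (B : set X) (b0 : X) (rho D : R).
Hypotheses (closedB : closed B) (convexB : convex_set B) (rho0 : 0 < rho)
  (rhoB : forall x, `|x - b0| < rho -> B x)
  (DB : forall x, B x -> `|x - b0| <= D).

Let B_conv x y t : 0 <= t -> t <= 1 -> B x -> B y -> B (t *: x + (1 - t) *: y).
Proof.
move=> t0 t1 Bx By; have := convexB (Itv01 t0 t1) (mem_set Bx) (mem_set By).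
by rewrite inE.
Qed.

Let Bb0 : B b0. Proof. by apply: rhoB; rewrite subrr normr0. Qed.
Let D0 : 0 <= D. Proof. exact: le_trans (normr_ge0 _) (DB Bb0). Qed.

Let adm v : set R := [set s | 0 < s /\ B (b0 + s^-1 *: v)].

Let adm_rho v s : `|v| < rho * s -> adm v s.
Proof.
move=> vs; have s0 : 0 < s.
  by rewrite -(pmulr_rgt0 _ rho0); apply: le_lt_trans vs.
split=> //; apply: rhoB; rewrite addrAC subrr add0r normrZ gtr0_norm ?invr_gt0//.
by rewrite ltr_pdivrMl// mulrC.
Qed.

Let adm_up v s t : adm v s -> s <= t -> adm v t.
Proof.
move=> [s0 Bs] st; have t0 := lt_le_trans s0 st; split=> //.
have st0 : 0 <= s / t by rewrite divr_ge0 ?ltW.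
have st1 : s / t <= 1 by rewrite ler_pdivrMr ?mul1r.
have := B_conv st0 st1 Bs Bb0; congr B.
rewrite scalerDr scalerA mulrAC divff ?gt_eqF// mul1r scalerBl scale1r.
by rewrite addrC addrA subrK.
Qed.

(** The Minkowski functional of B translated so that b0 becomes the origin. *)
Definition gauge v : R := inf (adm v).

Let adm_ex v : adm v (`|v| / rho + 1).
Proof.
by apply: adm_rho; rewrite mulrDr mulr1 mulrCA divff ?gt_eqF// mulr1 ltrDl.
Qed.

Let adm_lb v : has_lbound (adm v).
Proof. by exists 0 => s [/ltW]. Qed.

Let gauge_le v s : adm v s -> gauge v <= s.
Proof. exact: ge_inf. Qed.

Let gauge_ge v m : (forall s, adm v s -> m <= s) -> m <= gauge v.
Proof. by move=> h; apply: lb_le_inf => //; exists (`|v| / rho + 1). Qed.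

Let gauge_lt v s : gauge v < s -> adm v s.
Proof.
move=> vs; have vs0 : 0 < s - gauge v by rewrite subr_gt0.
have h : has_inf (adm v) by split=> //; exists (`|v| / rho + 1).
have [t vt ts] := inf_adherent vs0 h; apply: (adm_up vt).
by move: ts; rewrite -/(gauge v) addrC subrK => /ltW.
Qed.

Let gauge_norm v : gauge v <= `|v| / rho.
Proof.
apply/ler_addgt0Pr => e e0; apply: gauge_le; apply: adm_rho.
by rewrite mulrDr mulrCA divff ?gt_eqF// mulr1 ltrDl mulr_gt0.
Qed.

Let norm_gauge v : `|v| <= D * gauge v.
Proof.
have [->|v0] := eqVneq v 0.
  by rewrite normr0 mulr_ge0//; apply: gauge_ge => s [/ltW].
have nv : 0 < `|v| by rewrite normr_gt0.
have h s : adm v s -> `|v| <= D * s.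
  move=> [s0 /DB]; rewrite addrAC subrr add0r normrZ gtr0_norm ?invr_gt0//.
  by rewrite ler_pdivrMl// mulrC.
have Dp : 0 < D.
  have [s0 _] := adm_ex v; rewrite -(pmulr_lgt0 _ s0).
  exact: lt_le_trans nv (h _ (adm_ex v)).
by rewrite -ler_pdivrMl//; apply: gauge_ge => s /h; rewrite ler_pdivrMl.
Qed.

Let gaugeD u v : gauge (u + v) <= gauge u + gauge v.
Proof.
apply/ler_addgt0Pr => e e0; rewrite [e]splitr addrACA.
have e2 : 0 < e / 2 by rewrite divr_gt0.
have [s0 Bs] : adm u (gauge u + e / 2) by apply: gauge_lt; rewrite ltrDl.
have [t0 Bt] : adm v (gauge v + e / 2) by apply: gauge_lt; rewrite ltrDl.
move: (gauge u + _) (gauge v + _) s0 Bs t0 Bt => s t s0 Bs t0 Bt.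
have st0 : 0 < s + t by exact: addr_gt0.
apply: gauge_le; split=> //.
have w0 : 0 <= s / (s + t) by rewrite divr_ge0 ?ltW.
have w1 : s / (s + t) <= 1 by rewrite ler_pdivrMr// mul1r lerDl ltW.
have := B_conv w0 w1 Bs Bt; congr B.
have -> : 1 - s / (s + t) = t / (s + t) by field; rewrite gt_eqF.
rewrite !scalerDr !scalerA addrACA -scalerDl -mulrDl divff ?gt_eqF// scale1r.
by rewrite mulrAC divff ?gt_eqF// mul1r mulrAC divff ?gt_eqF// mul1r.
Qed.

Let gauge_lip u v : `|gauge u - gauge v| <= `|u - v| / rho.
Proof.
suff h x y : gauge x - gauge y <= `|x - y| / rho.
  by rewrite ler_norml h andbT lerNl opprB distrC h.
rewrite lerBlDr (le_trans _ (lerD (gauge_norm (x - y)) (lexx _)))//.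
by have := gaugeD (x - y) y; rewrite subrK.
Qed.

(** If b0 + v / m were outside the closed set B, a whole ball around it would be, although b0 + v /
    (m + e) is in B for every e > 0. *)
Let gauge_B v m : 0 < m -> gauge v <= m -> B (b0 + m^-1 *: v).
Proof.
move=> m0 vm; apply: contrapT => nB.
have /openP_norm/(_ _ nB)[d d0 dP] : open (~` B) by exact: closed_openC.
have nv : 0 < `|v| + 1 by rewrite ltr_wpDl.
(* Chosen so that |v| e / m^2 < d, which bounds the distance between v / (m + e) and v / m. *)
pose e := m * (m * d / (`|v| + 1)).
have e0 : 0 < e by rewrite !mulr_gt0// invr_gt0.
have [s0 Bs] : adm v (m + e) by apply: gauge_lt; rewrite (le_lt_trans vm)// ltrDl.
apply: (dP _ _ Bs).
rewrite opprD addrACA subrr add0r -scalerBl normrZ.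
have -> : (m + e)^-1 - m^-1 = - (e / (m * (m + e))).
  by field; rewrite !gt_eqF.
rewrite normrN gtr0_norm ?divr_gt0 ?mulr_gt0//.
apply: (@le_lt_trans _ _ (e / (m * m) * `|v|)).
  rewrite ler_wpM2r// ler_wpM2l ?(ltW e0)// lef_pV2 ?posrE ?mulr_gt0//.
  by rewrite ler_pM2l// lerDl ltW.
have -> : e / (m * m) * `|v| = d * (`|v| / (`|v| + 1)).
  by rewrite /e; field; rewrite !gt_eqF.
by rewrite gtr_pMr// ltr_pdivrMr// mul1r ltrDl.
Qed.

Lemma convex_retraction : exists (r : X -> X) (K : R),
  [/\ 0 <= K, lip_on setT K r, forall x, B (r x) & forall x, B x -> r x = x].
Proof.
pose m v := Num.max 1 (gauge v).
have m1 v : 1 <= m v by rewrite le_max lexx.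
have m0 v : 0 < m v by exact: lt_le_trans ltr01 (m1 v).
have gm v : gauge v <= m v by rewrite le_max lexx orbT.
have mlip u v : `|m u - m v| <= `|u - v| / rho.
  have := gauge_lip u v; rewrite /m !ler_norml => /andP[h1 h2].
  have h3 : 0 <= `|u - v| / rho by rewrite divr_ge0// ltW.
  by case: (leP 1 (gauge u)) => ?; case: (leP 1 (gauge v)) => ?; apply/andP; split; lra.
(* In 1 + D / rho, the 1 is for division by a fixed m >= 1; the change of 1/m is at most |u - v| /
   (rho m(u) m(v)), which |v| <= D m(u) m(v) compensates. *)
exists (fun x => b0 + (m (x - b0))^-1 *: (x - b0)), (1 + D / rho); split.
- by rewrite addr_ge0// divr_ge0// ltW.
- move=> x y _ _; rewrite opprD addrACA subrr add0r.
  have E : `|x - b0 - (y - b0)| = `|x - y| by rewrite opprB addrA subrK.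
  move: (x - b0) (y - b0) E => u v <-.
  have -> : (m u)^-1 *: u - (m v)^-1 *: v =
      (m u)^-1 *: (u - v) + ((m u)^-1 - (m v)^-1) *: v.
    by rewrite scalerBr scalerBl addrA subrK.
  rewrite (le_trans (ler_normD _ _))// mulrDl mul1r lerD//.
    by rewrite normrZ ger0_norm ?invr_ge0 ?(ltW (m0 _))// ler_piMl// invf_le1.
  rewrite normrZ.
  have -> : (m u)^-1 - (m v)^-1 = (m v - m u) / (m u * m v) by field; rewrite !gt_eqF.
  rewrite normrM (ger0_norm (_ : 0 <= (m u * m v)^-1)); last first.
    by rewrite invr_ge0 mulr_ge0 ?(ltW (m0 _)).
  have vD : `|v| <= D * (m u * m v).
    rewrite (le_trans (norm_gauge _))// ler_wpM2l// (le_trans (gm _))//.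
    by rewrite ler_peMl// ltW.
  rewrite (distrC (m v)) -[leLHS]mulrA [leRHS](_ : _ = `|u - v| / rho * D); last by ring.
  rewrite ler_pM ?mulr_ge0 ?invr_ge0 ?mulr_ge0 ?(ltW (m0 _))//.
  by rewrite ler_pdivrMl ?mulr_gt0// mulrC.
- by move=> x; exact: gauge_B.
- move=> x Bx; have -> : m (x - b0) = 1.
    rewrite /m max_l//; apply: gauge_le; split=> //.
    by rewrite invr1 scale1r addrC subrK.
  by rewrite invr1 scale1r addrC subrK.
Qed.

End ConvexRetraction.

(** * Retractions for the three types of sets *)

Section Retractions.
Context {R : realType} {X : normedModType R}.

Definition lipschitz_retraction (A U : set X) (r : X -> X) (K : R) : Prop :=
  [/\ 1 <= K, lip_on U K r, forall z, U z -> A (r z) & forall z, U z -> A z -> r z = z].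

(** The retraction is q conjugated by the chart; q takes values in the image of A within U, so Phi
    is inverted only there, and this costs a factor K on each side of L. *)
Lemma chart_retraction (W : normedModType R) (A U : set X) (Phi : X -> W) (V : set W)
    (q : W -> W) (L : R) : 0 <= L ->
  bilipschitz_onto Phi U V -> lip_on V L q ->
  (forall w, V w -> (Phi @` (A `&` U)) (q w)) ->
  (forall w, (Phi @` (A `&` U)) w -> q w = w) ->
  exists r K, lipschitz_retraction A U r K.
Proof.
move=> L0 [PhiV [K K0 PhiK]] qL qA q_id.
have inj x y : U x -> U y -> Phi x = Phi y -> x = y.
  move=> Ux Uy xy; have /andP[+ _] := PhiK _ _ Ux Uy.
  rewrite xy subrr normr0 pmulr_rle0 ?invr_gt0// normr_le0 subr_eq0 => /eqP.
  exact.
have inv_ex z : exists y, U z -> [/\ A y, U y & Phi y = q (Phi z)].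
  have [Uz|nU] := pselect (U z); last by exists z.
  have [|y [Ay Uy] yz] := qA (Phi z); first by rewrite -PhiV; exists z.
  by exists y.
pose r z := sval (cid (inv_ex z)).
have rP z : U z -> [/\ A (r z), U (r z) & Phi (r z) = q (Phi z)].
  exact: (svalP (cid (inv_ex z))).
exists r, (Num.max 1 (K * (L * K))); split.
- by rewrite le_max lexx.
- apply: (@lip_on_le _ _ _ _ (K * (L * K))); first by rewrite le_max lexx orbT.
  move=> y z Uy Uz; have [_ Ury ry] := rP _ Uy; have [_ Urz rz] := rP _ Uz.
  have /andP[h1 _] := PhiK _ _ Ury Urz; have /andP[_ h2] := PhiK _ _ Uy Uz.
  move: h1; rewrite ler_pdivrMl// => /le_trans; apply; rewrite -mulrA ler_pM2l//.
  have PV x : U x -> V (Phi x) by move=> Ux; rewrite -PhiV; exists x.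
  by rewrite ry rz -mulrA (le_trans (qL _ _ (PV _ Uy) (PV _ Uz)))// ler_wpM2l.
- by move=> z /rP[].
- move=> z Uz Az; have [_ Ur rz] := rP _ Uz; apply: inj => //.
  by rewrite rz q_id//; exists z.
Qed.

(** The inverse of Psi is a chart on the whole space that carries A to the convex set. *)
Lemma convex_body_retraction (A : set X) : bilipschitz_convex_body A ->
  exists r K, lipschitz_retraction A setT r K.
Proof.
move=> [B [Psi [clB cB bB [b0 Bb0] [[PsiT [K K0 PsiK]] ->]]]].
have [rho rho0 rhoB] : exists2 rho, 0 < rho & forall x, `|x - b0| < rho -> B x.
  by apply/near_normP; exact: Bb0.
have [M MB] : exists M, forall x, B x -> `|x - b0| <= M.
  have [M0 /= [_ MB]] := bB.
  exists (M0 + 1 + `|b0|) => x Bx; rewrite (le_trans (ler_normB _ _))// lerD2r.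
  by apply: (MB (M0 + 1)); rewrite ?ltrDl.
have [q [L [L0 qL qB q_id]]] := convex_retraction clB cB rho0 rhoB MB.
have inv_ex y : exists x, Psi x = y.
  by have : setT y by []; rewrite -PsiT => -[x _ <-]; exists x.
pose Phi y := sval (cid (inv_ex y)).
have PhiK y : Psi (Phi y) = y by exact: (svalP (cid (inv_ex y))).
have inj x y : Psi x = Psi y -> x = y.
  move=> xy; have /andP[+ _] := PsiK x y I I.
  by rewrite xy subrr normr0 pmulr_rle0 ?invr_gt0// normr_le0 subr_eq0 => /eqP.
have PsiKK x : Phi (Psi x) = x by apply: inj; rewrite PhiK.
have Phi_onto : bilipschitz_onto Phi setT setT.
  split; first by apply/seteqP; split=> // x _; exists (Psi x).
  exists K => // x y _ _; have := PsiK (Phi x) (Phi y) I I; rewrite !PhiK => /andP[h1 h2].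
  by rewrite ler_pdivrMl// h2 -ler_pdivrMl.
apply: (chart_retraction L0 Phi_onto qL) => [w _|w].
  by exists (Psi (q w)); rewrite ?PsiKK//; split=> //; exists (q w).
by move=> [_ [[x Bx <-] _] <-]; rewrite PsiKK q_id.
Qed.

Definition locally_retract (A : set X) : Prop := forall a, A a ->
  exists (U : set X) r K, [/\ open U, U a & lipschitz_retraction A U r K].

(** In a chart, (u1, u2) -> (u1, 0) is 1-Lipschitz for the maximum norm. *)
Lemma submanifold_retract (A : set X) :
  lipschitz_submanifold A -> locally_retract A.
Proof.
move=> [_ Asub] a /Asub[U [E1 [E2 [Phi [[oU Ua] _ _ Phib PhiA]]]]].
have b0 : ball (0 : E2) 1 0 by exact: ballxx.
have [|||r [K rK]] := @chart_retraction _ A U Phi _ (fun w => (w.1, 0)) 1 ler01 Phib.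
- move=> [u1 u2] [v1 v2] _ _ /=; rewrite mul1r !prod_normE /= subrr normr0.
  by rewrite ge_max le_max lexx/= le_max normr_ge0.
- by rewrite PhiA => -[u1 u2] [].
- by rewrite PhiA => -[u1 u2] [/= _ ->].
by exists U, r, K.
Qed.

(** At a point of D the identity on D serves. At a boundary point the chart carries the closure to
    U_E x [0, 1), and t -> max(0, t) in the last coordinate retracts onto it. *)
Lemma closure_domain_retract (D : set X) :
  lipschitz_domain D -> locally_retract (closure D).
Proof.
move=> [oD _ Dchart] a clDa; have [Da|nDa] := pselect (D a).
  exists D, id, 1; split=> //; split=> //.
    by move=> x y _ _; rewrite mul1r.
  by move=> z; exact: subset_closure.
have bE : boundary D = closure D `\` D by rewrite /boundary (interior_id _).1.
have [|V [E [Phi [[oV Va] Phib PhiD Phibd]]]] := Dchart a.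
  by rewrite bE.
have clE : Phi @` (closure D `&` V) = ball 0 1 `*` [set t | 0 <= t < 1].
  have -> : closure D `&` V = (D `&` V) `|` (boundary D `&` V).
    rewrite bE -setIUl; congr (_ `&` _).
    apply/seteqP; split=> x; last by move=> [Dx|[]//]; exact: subset_closure.
    by move=> cx; have [?|?] := pselect (D x); [left|right].
  rewrite image_setU PhiD Phibd; apply/seteqP; split=> -[u t] /=.
    move=> [[ub]|[ub ->]]; last by split=> //; rewrite lexx ltr01.
    by rewrite in_itv/= => /andP[/ltW -> ->].
  move=> [ub /andP[]]; rewrite le_eqVlt => /predU1P[<- _|t0 t1]; first by right.
  by left; split=> //; rewrite in_itv/= t0.
have [|||r [K rK]] := @chart_retraction _ (closure D) V Phi _
    (fun w => (w.1, Num.max 0 w.2 : R^o)) 1 ler01 Phib.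
- move=> [u1 u2] [v1 v2] _ _ /=; rewrite mul1r !prod_normE /=.
  apply: le_max2 => //.
  case: (leP 0 u2) => ?; case: (leP 0 v2) => ?; rewrite ?subrr ?normr0//.
    by rewrite subr0 !ger0_norm ?subr_ge0 ?lerDl; lra.
  by rewrite sub0r normrN (ger0_norm (_ : 0 <= v2))// distrC (le_trans _ (ler_norm _))//; lra.
- rewrite clE => -[u t] [/= ub]; rewrite in_itv/= => /andP[t1 t2]; split=> //=.
  by rewrite le_max lexx/= gt_max ltr01.
- by rewrite clE => -[u t] [/= _ /andP[t0 _]]; rewrite max_r.
by exists V, r, K.
Qed.

(** A is the set of fixed points of the continuous map r. *)
Lemma retraction_closed (A : set X) r K : lipschitz_retraction A setT r K -> closed A.
Proof.
move=> [_ rK rA r_id]; rewrite -[A]setCK; apply: open_closedC.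
have rc x : {for x, continuous r}.
  by apply: (@lip_near_continuous _ _ _ _ K); exists 1 => //; exact: lip_on_sub rK.
rewrite openE => x nAx; have xr : 0 < `|x - r x|.
  rewrite normr_gt0 subr_eq0; apply/eqP => xr; apply: nAx; rewrite xr; exact: rA.
have ec : {for x, continuous (fun y => `|y - r y| : R^o)}.
  by apply: cvg_norm; apply: cvgB; [exact: cvg_id|exact: rc].
apply: filterS (continuous_near_ge ec xr) => y /[swap] Ay.
by rewrite r_id// subrr normr0 ltxx.
Qed.

End Retractions.

(** * Globalization *)

Section Globalization.
Context {R : realType} {X Y : normedModType R}.
Context (k : option nat) (k0 : k <> Some 0%N).
Hypothesis pou : forall (Omega : set X) (N : X -> set X),
  (forall p, Omega p -> open (N p)) -> (forall p, Omega p -> N p p) ->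
  exists phi c L, partition_of_unity k Omega N phi c L.
Context (A : set X) (f : X -> Y) (G : X -> contlin X Y).

Definition C1_extension (U : set X) (g : X -> Y) : Prop :=
  [/\ forall x, A x -> g x = f x, Ck_on (Some 1%N) U g,
      forall x, U x -> A x -> is_diff x g (G x) & Ck_on k (U `\` A) g].

(** Points off A receive the open complement of A as neighbourhood and the function 0; these pieces
    never reach A, so at a point of A only genuine extensions are averaged. *)
Lemma extension_glue : closed A ->
  (forall a, A a -> exists (U : set X) g, [/\ open U, U a & C1_extension U g]) ->
  exists g, C1_extension setT g.
Proof.
move=> clA loc.
have Ug_ex p : exists Ug : set X * (X -> Y),
    [/\ open Ug.1, Ug.1 p, (A p -> C1_extension Ug.1 Ug.2) &
        (~ A p -> Ug.1 `<=` ~` A /\ Ug.2 = fun=> 0)].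
  have [Ap|nAp] := pselect (A p).
    by have [U [g [oU Up gU]]] := loc p Ap; exists (U, g); split.
  by exists (~` A, fun=> 0); split=> //= [|_]; [exact: closed_openC|split].
pose N p := (sval (cid (Ug_ex p))).1; pose gl p := (sval (cid (Ug_ex p))).2.
have UgP p : [/\ open (N p), N p p, (A p -> C1_extension (N p) (gl p)) &
    (~ A p -> N p `<=` ~` A /\ gl p = fun=> 0)] := svalP (cid (Ug_ex p)).
have oN p : open (N p) by case: (UgP p).
have AN p x : N p x -> A x -> A p.
  by move=> Nx Ax; apply: contrapT => nA; have [_ _ _ /(_ nA)[/(_ _ Nx)]] := UgP p.
have [||phi [c [L P]]] := pou (Omega := setT) (N := N).
- by move=> p _.
- by move=> p _; case: (UgP p).
pose gg n z := gl (c n z) z.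
have sum1 (z : X) : exists m, \forall y \near z,
    glue phi gg y = \sum_(0 <= n < m) phi n y *: gg n y /\ \sum_(0 <= n < m) phi n y = 1.
  have [m near_m] := pou_sum P (I : setT z); exists m.
  apply: (filterS _ near_m) => y [phi0 phi1]; rewrite (glueE _ phi0); split=> //.
  by rewrite big_mkord.
(* Used with j = 1 on the whole space and with j = k off A. *)
have Ck_glue j x (S : set X) : open S -> S x ->
    (forall n, Ck_on j setT (phi n)) ->
    (forall p, N p x -> Ck_on j (N p `&` S) (gl p)) -> Ck_near j x (glue phi gg).
  move=> oS Sx phij glj; have [m near_m] := sum1 x.
  apply: (@Ck_near_eq _ _ _ _ _ (fun z => \sum_(0 <= n < m) phi n z *: gg n z)).
    by apply: (filterS _ near_m) => y [].
  apply: Ck_near_sum => n; have [phi0|[p [_ px cp]]] := pou_sub P n x.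
    apply: Ck_near_eq (Ck_near_cst j x 0).
    by apply: (filterS _ phi0) => y ->; rewrite scale0r.
  apply: (@Ck_near_eq _ _ _ _ _ (fun z => phi n z *: gl p z)).
    by apply: (filterS _ cp) => y cy; rewrite /gg cy.
  exists (N p `&` S); split=> //; first exact: openI.
  by apply: Ck_on_scale; [exact: Ck_on_sub (phij n)|exact: glj].
have gf x : A x -> glue phi gg x = f x.
  move=> Ax; have [m /nbhs_singleton[-> phi1]] := sum1 x.
  rewrite -[f x]scale1r -phi1 scaler_suml; apply: eq_bigr => n _.
  have [/nbhs_singleton ->|[p [_ px /nbhs_singleton cp]]] := pou_sub P n x.
    by rewrite !scale0r.
  have [_ _ /(_ (AN _ _ px Ax))[glf _ _ _] _] := UgP p.
  by rewrite /gg cp glf.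
exists (glue phi gg); split=> //.
- apply: Ck_on_local => x _; apply: (Ck_glue (Some 1%N) x setT) => //; first exact: openT.
    by move=> n; exact: Ck_on_C1 (pou_Ck P n).
  move=> p _; have [_ _ h1 h2] := UgP p.
  have [/h1[_ + _ _]|/h2[_ ->]] := pselect (A p); last exact: Ck_on_const.
  by apply: Ck_on_sub => z [].
(* All pieces that matter share the value f x and the derivative G x at x, so the remainder of the
   glued map is an average of their remainders and the phi n are not differentiated. *)
- move=> x _ Ax; apply/is_diff_normP => eps eps0.
  have [m near_m] := sum1 x.
  have near_n : \forall y \near x, forall n : 'I_m,
      `|phi n y *: (gg n y - f x - G x (y - x))| <= phi n y * (eps * `|y - x|).
    apply: filter_forall => n; have [phi0|[p [_ px cp]]] := pou_sub P n x.
      by apply: (filterS _ phi0) => y ->; rewrite scale0r normr0 mul0r.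
    have [_ _ /(_ (AN _ _ px Ax))[glf _ gld _] _] := UgP p.
    have /is_diff_normP/(_ _ eps0)[d d0 dP] := gld _ px Ax.
    have near_d : \forall y \near x, `|y - x| < d by apply/near_normP; exists d.
    apply: filterS2 cp near_d => y cy /dP.
    by rewrite (glf x Ax) /gg cy normrZ (ger0_norm (pou_ge0 P _ _)) => h; rewrite ler_wpM2l ?(pou_ge0 P).
  have /near_normP[d1 d10 gphi] := near_m.
  have /near_normP[d2 d20 dP] := near_n.
  exists (Num.min d1 d2); first by rewrite lt_min d10.
  move=> y; rewrite lt_min => /andP[/gphi[gy phiy] /dP ny]; rewrite gy gf//.
  have -> : \sum_(0 <= n < m) phi n y *: gg n y - f x - G x (y - x) =
      \sum_(0 <= n < m) phi n y *: (gg n y - f x - G x (y - x)).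
    rewrite -[f x]scale1r -[G x (y - x)]scale1r -{1 2}phiy !scaler_suml -!sumrB.
    by apply: eq_bigr => n _; rewrite -!scalerBr !scale1r.
  rewrite (le_trans (ler_norm_sum _ _ _))// -[leRHS]mul1r -phiy mulr_suml.
  by rewrite !big_mkord; apply: ler_sum => n _; exact: ny.
- apply: Ck_on_local => x [_ nAx].
  apply: (Ck_glue k x (~` A)) => //; [exact: closed_openC|exact: pou_Ck P|].
  move=> p _; have [_ _ h1 h2] := UgP p.
  by have [/h1[_ _ _]|/h2[_ ->]] := pselect (A p); last exact: Ck_on_const.
Qed.

End Globalization.

Section LocalExtensionAtPoint.
Context {R : realType} {X Y : normedModType R}.
Context (k : option nat) (k0 : k <> Some 0%N).
Context (C : R) (C0 : 0 <= C) (LA : LA_balls X Y k C).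
Hypothesis pou : forall (Omega : set X) (N : X -> set X),
  (forall p, Omega p -> open (N p)) -> (forall p, Omega p -> N p p) ->
  exists phi c L, partition_of_unity k Omega N phi c L.
Context (A : set X) (f : X -> Y) (G : X -> contlin X Y) (fG : condition_W A f G).

(** Condition (W) with tolerance 1 at a makes f Lipschitz and G bounded on A near a, with constant 1
    + |G a|; dividing the radius by K keeps the retracted points where this holds. *)
Lemma extension_at_point a : A a -> locally_retract A ->
  exists (U : set X) g, [/\ open U, U a & C1_extension k A f G U g].
Proof.
move=> Aa retA; have [U [r [K [oU Ua [K1 rK rA r_id]]]]] := retA a Aa.
have K0 : 0 < K by exact: lt_le_trans ltr01 K1.
have [d1 d10 d1P] := fG.2 _ Aa _ (@ltr01 R).
have [d2 d20 d2P] := continuous_within_normP fG.1 Aa (@ltr01 R).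
pose d := Num.min d1 d2 / K.
have d0 : 0 < d by rewrite divr_gt0// lt_min d10.
pose V := U `&` ball a d.
have oV : open V by apply: openI => //; exact: ball_open.
have ra z : V z -> `|r z - a| < d1 /\ `|r z - a| < d2.
  move=> [Uz]; rewrite -ball_normE /= distrC /d ltr_pdivlMr// => zd.
  suff : `|r z - a| < Num.min d1 d2 by rewrite lt_min => /andP.
  rewrite -[X in r z - X](r_id a Ua Aa) (le_lt_trans (rK _ _ Uz Ua))//.
  by rewrite mulrC.
have [|||||||g [gf gC1 gd gCk _]] :=
  @local_extension R X Y k k0 C C0 LA pou A f G fG V r K (1 + `|G a|) (1 + `|G a|) oV K1.
- by apply: lip_on_sub rK => z [].
- by move=> z [Uz _]; exact: rA.
- by move=> z [Uz _]; exact: r_id.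
- by rewrite addr_ge0.
- by rewrite addr_ge0.
- move=> z w Vz Vw; have [z1 _] := ra z Vz; have [w1 _] := ra w Vw.
  rewrite -[f (r z) - f (r w)](subrK (G a (r z - r w))).
  rewrite (le_trans (ler_normD _ _))// mulrDl lerD ?contlin_le//.
  apply: d1P; split; try (rewrite -ball_normE /= distrC//).
    by apply: rA; case: Vw.
  by apply: rA; case: Vz.
- move=> z Vz; have [_ z2] := ra z Vz.
  rewrite -[G (r z)](subrK (G a)) (le_trans (ler_normD _ _))// lerD2r.
  by apply: d2P => //; apply: rA; case: Vz.
by exists V, g; split=> //; split=> //; exact: ballxx.
Qed.

End LocalExtensionAtPoint.

Unset Implicit Arguments.

(** In the second case A is taken closed: on a submanifold such as an open segment in the plane, a
    map satisfying (W) may blow up at an end point and then has no continuous extension. *)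
Theorem corollary42 (R : realType) (X : normedModType R)
    (Y : completeNormedModType R) (k : option nat) (A : set X)
    (f : X -> Y) (G : X -> contlin X Y) :
  k <> Some 0%N ->
  property_LA X Y k ->
  [\/ bilipschitz_convex_body A,
      lipschitz_submanifold A /\ closed A |
      exists2 D : set X, lipschitz_domain D & A = closure D] ->
  condition_W A f G ->
  (exists g : X -> Y,
    [/\ (forall x, A x -> g x = f x),
        Ck_on (Some 1%N) setT g,
        (forall x, A x -> is_diff x g (G x)) &
        Ck_on k (~` A) g]) /\
  (bilipschitz_convex_body A ->
   [lipschitz f x | x in A] ->
   [bounded G x | x in A] ->
   exists g : X -> Y,
    [/\ (forall x, A x -> g x = f x),
        Ck_on (Some 1%N) setT g,
        (forall x, A x -> is_diff x g (G x)),
        Ck_on k (~` A) g &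
        lipschitz g]).
Proof.
move=> k0 /property_LA_balls[C C0 LA] typeA fG.
(* Without a nonzero vector in Y, (LA_k) says nothing about real functions and yields no partitions
   of unity; the zero map is then the extension. *)
have [[y yN0]|Y0] := pselect (exists y : Y, y != 0); last first.
  have Y0' (y : Y) : y = 0.
    by apply/eqP/negPn/negP => y0; apply: Y0; exists y.
  have g0 : [/\ (forall x, A x -> (fun _ : X => 0 : Y) x = f x),
      Ck_on (Some 1%N) setT (fun _ : X => 0 : Y),
      (forall x, A x -> is_diff x (fun _ : X => 0 : Y) (G x)) &
      Ck_on k (~` A) (fun _ : X => 0 : Y)].
    split; [by move=> x _; rewrite [f x]Y0'|exact: Ck_on_const| |exact: Ck_on_const].
    move=> x _; have -> : G x = 0 by apply/val_inj/funext => h /=; exact: Y0'.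
    exact: is_diff_const.
  move: g0 => [h1 h2 h3 h4].
  split=> [|_ _ _]; exists (fun=> 0); split=> //.
  apply: (@klipschitzW _ _ _ 0).
    exact: (@globally_properfilter _ _ (0, 0)).
  by move=> [u v] _ /=; rewrite subrr normr0 mul0r.
have LAR := LA_balls_real yN0 C0 LA.
have pou (Omega : set X) (N : X -> set X) :
    (forall p, Omega p -> open (N p)) -> (forall p, Omega p -> N p p) ->
    exists phi c L, partition_of_unity k Omega N phi c L.
  by move=> oN Np; exact: (partition_of_unity_exists C0 LAR oN Np).
have setTD : setT `\` A = ~` A by rewrite setTD.
split.
  have [retA clA] : locally_retract A /\ closed A.
    case: typeA => [bodyA|[subA clA]|[D domD ->]].
    - have [r [K rK]] := convex_body_retraction bodyA.
      split; last exact: retraction_closed rK.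
      by move=> a _; exists setT, r, K; split=> //; exact: openT.
    - by split=> //; exact: submanifold_retract.
    - by split; [exact: closure_domain_retract|exact: closed_closure].
  have [a Aa|g [h1 h2 h3 h4]] := @extension_glue R X Y k k0 pou A f G clA.
    exact: (@extension_at_point R X Y k k0 C C0 LA pou A f G fG a Aa retA).
  by exists g; split=> //; [move=> x; exact: h3|rewrite -setTD].
move=> /convex_body_retraction[r [K [K1 rK rA r_id]]] /pinfty_ex_gt0[Lf Lf0 fL] /pinfty_ex_gt0[M M0 GM].
(* The retraction is defined on the whole space, so no gluing intervenes and the bound on the
   derivatives is global. *)
have [|||||g [h1 h2 h3 h4 [B gB]]] :=
  @local_extension R X Y k k0 C C0 LA pou A f G fG setT r K Lf M _ K1 rK rA r_id.
- exact: openT.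
- exact: ltW.
- exact: ltW.
- by move=> z w _ _; apply: (fL (r z, r w)); split; exact: rA.
- by move=> z _; apply: GM; exact: rA.
exists g; split=> //; [by move=> x; exact: h3|by rewrite -setTD|].
apply: (@klipschitzW _ _ _ B).
  exact: (@globally_properfilter _ _ (0, 0)).
move=> [u v] _ /=; apply: mean_value_le => t _.
have [Dg gD _] := h2; exists (Dg (v + t *: (u - v))); first exact: gD.
by apply: gB => //; exact: gD.
Qed.
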